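(* Let $\delta\in(0,1)$. Let $\omega=(\omega_x)_{x\in\mathbb Z}$ be an i.i.d. random environment satisfying $\mathbb E[\log\rho_0]=0$, $\operatorname{Var}(\log\rho_0)>0$ (where $\rho_0=\frac{1-\omega_0}{\omega_0}$), and $\mathbb P(\varepsilon\le\omega_0\le 1-\varepsilon)=1$ for some $\varepsilon\in(0,\tfrac12)$. Let $\nu$ be a probability distribution on $\mathbb Z$ admitting a first moment, and let $\tilde\nu:=\nu(-\,\cdot)*\nu$. Assume that $(\tilde\nu^{*n}(A_n\,\cdot))_n$ converges to a $\beta$-stable distribution with $\beta>1$, for a suitable increasing sequence $(A_n)_n$ of positive real numbers. Given $\omega$, let $(M_n)_{n\ge0}$ be a Markov chain with values in $\mathbb Z^2$ such that $$P_\omega(M_0=(0,0))=1,$$ $$P_\omega\big(M_{n+1}=(x+1,y)\mid M_n=(x,y)\big)=\delta\,\omega_x,$$ $$P_\omega\big(M_{n+1}=(x-1,y)\mid M_n=(x,y)\big)=\delta\,(1-\omega_x),$$ $$P_\omega\big(M_{n+1}=(x,y+z)\mid M_n=(x,y)\big)=(1-\delta)\,\nu((-1)^xz)\qquad(z\in\mathbb Z).$$ Then, for $\mathbb P$-a.e. environment $\omega$, $(M_n)_{n\ge0}$ is recurrent.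
   Context: $\omega=(\omega_x)_{x\in\mathbb Z}$ is a sequence of i.i.d. random variables with values in $(0,1)$ defined on a probability space $(\Omega,\mathcal F,\mathbb P)$; $\mathbb E$ and $\operatorname{Var}$ refer to $\mathbb P$. $\tilde\nu=\nu(-\,\cdot)*\nu$ is the distribution of $Z_2-Z_1$ when $Z_1,Z_2$ are independent with distribution $\nu$. $\tilde\nu^{*n}(A_n\,\cdot)$ denotes the distribution of $(W_1+\dots+W_n)/A_n$, where $W_1,\dots,W_n$ are i.i.d. with distribution $\tilde\nu$; convergence is weak convergence. A $\beta$-stable distribution is understood to be non-degenerate (so $\beta\in(1,2]$ here). Recurrent means that, $P_\omega$-almost surely, the chain returns to its starting point $(0,0)$ infinitely often. *)

(* Defs.v *)
From HB Require Import structures.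
From mathcomp Require Import all_boot all_order all_algebra.
From mathcomp Require Import finmap.
From mathcomp Require Import all_classical all_reals all_analysis.

Set Implicit Arguments.
Unset Strict Implicit.
Unset Printing Implicit Defensive.

Import Order.TTheory GRing.Theory Num.Theory.
Import numFieldNormedType.Exports.

Local Open Scope classical_set_scope.
Local Open Scope ring_scope.

HB.instance Definition _ := isPointed.Build int 0.

HB.instance Definition _ := @isMeasurable.Build default_measure_display
  int discrete_measurable discrete_measurable0
  discrete_measurableC discrete_measurableU.

Lemma measurable_int_prod (A : set (int * int)) : measurable A.
Proof.
have -> : A = \bigcup_(p : int * int) (A `&` [set p]).
  by apply/seteqP; split => [p Ap|p [q _ []//]]; exists p.
apply: countable_bigcupT_measurable; first exact: countableP.
move=> [x y]; have [Axy|Axy] := pselect (A (x, y)).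
  suff -> : A `&` [set (x, y)] = [set x] `*` [set y] by exact: measurableX.
  by apply/seteqP; split => [[u v] [_ [-> ->]]//|[u v] [/= -> ->]].
suff -> : A `&` [set (x, y)] = set0 by exact: measurable0.
by apply/seteqP; split => // p [Ap pxy]; apply: Axy; rewrite -pxy.
Qed.

Definition oppZ (z : int) : int := - z.

Definition addZ (p : int * int) : int := p.1 + p.2.

Definition scaleZ (R : realType) (a : R) (z : int) : R := z%:~R / a.

Fact measurable_oppZ : measurable_fun [set: int] oppZ.
Proof. by []. Qed.
HB.instance Definition _ :=
  isMeasurableFun.Build _ _ _ _ oppZ measurable_oppZ.

Fact measurable_addZ : measurable_fun [set: int * int] addZ.
Proof. by move=> _ B _; exact: measurable_int_prod. Qed.
HB.instance Definition _ :=
  isMeasurableFun.Build _ _ _ _ addZ measurable_addZ.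

Fact measurable_scaleZ (R : realType) (a : R) :
  measurable_fun [set: int] (scaleZ a).
Proof. by []. Qed.
HB.instance Definition _ (R : realType) (a : R) :=
  isMeasurableFun.Build _ _ _ _ (scaleZ a) (measurable_scaleZ a).

Section laws.
Context {R : realType}.
Implicit Types mu nu : probability int R.

Definition convolution mu nu : probability int R := distribution (mu \x nu)%E addZ.

Fixpoint convolution_pow mu (n : nat) : probability int R :=
  if n is n'.+1 then convolution (convolution_pow mu n') mu else dirac (0 : int).

Definition symmetrized nu : probability int R :=
  convolution (distribution nu oppZ) nu.

Definition rescale (a : R) mu : probability R R := distribution mu (scaleZ a).

Definition cvg_weakly (mu_ : nat -> probability R R) (mu : probability R R) :=
  forall f : R -> R, continuous f -> (exists K, forall x, `|f x| <= K) ->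
    (\int[mu_ n]_x (f x)%:E)%E @[n --> \oo] --> (\int[mu]_x (f x)%:E)%E.

(* For X, Y independent of law mu and a, b > 0, the variable a X + b Y has the
   law of (a^beta + b^beta)^(1/beta) X + d for some real d. *)
Definition stable_law (beta : R) (mu : probability R R) :=
  [/\ 0 < beta <= 2,
      ~ (exists c, mu [set c] = 1%E) &
      forall a b, 0 < a -> 0 < b -> exists d,
        forall B : set R, measurable B ->
          (mu \x mu)%E [set p | B (a * p.1 + b * p.2)] =
          mu [set x | B ((a `^ beta + b `^ beta) `^ beta^-1 * x + d)]].

End laws.

Section random_variables.
Context {d : measure_display} {T : measurableType d} {R : realType}.
Variable P : probability T R.

Definition mutually_independent (I : choiceType) (X : I -> {RV P >-> R}) :=
  forall (J : {fset I}) (B : I -> set R), (forall i, measurable (B i)) ->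
    P (\bigcap_(i in [set` J]) (X i @^-1` B i)) =
    (\prod_(i <- J) P (X i @^-1` B i))%E.

Definition identically_distributed (I : Type) (X : I -> {RV P >-> R}) :=
  forall i j (B : set R), measurable B ->
    distribution P (X i) B = distribution P (X j) B.

(* Junk value 0 when P B = 0. *)
Definition cond_prob (A B : set T) : R := fine (P (A `&` B)) / fine (P B).

Definition markov_property (S : Type) (M : nat -> T -> S) :=
  forall (n : nat) (s : nat -> S) (y : S),
    let past := [set t | forall k, (k <= n)%N -> M k t = s k] in
    P past != 0%E ->
    cond_prob [set t | M n.+1 t = y] past =
    cond_prob [set t | M n.+1 t = y] [set t | M n t = s n].

End random_variables.

Definition rho {R : realType} (u : R) : R := (1 - u) / u.

(* Q plays the role of the quenched law in the environment omega.  (-1) ^ x is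
   the power with exponent in int, -1 being a unit: it is 1 or -1 according to
   the parity of x, also for x < 0. *)
Definition quenched_chain (R : realType) (delta : R) (nu : probability int R)
    (omega : int -> R) (d : measure_display) (T : measurableType d)
    (Q : probability T R) (M : nat -> {RV Q >-> (int * int)%type}) :=
  [/\ markov_property Q (fun n => M n),
      Q [set t | M 0%N t = (0, 0)] = 1%E &
      forall (n : nat) (x y : int),
        let now := [set t | M n t = (x, y)] in
        Q now != 0%E ->
        [/\ cond_prob Q [set t | M n.+1 t = (x + 1, y)] now = delta * omega x,
            cond_prob Q [set t | M n.+1 t = (x - 1, y)] now =
              delta * (1 - omega x) &
            forall z : int,
              cond_prob Q [set t | M n.+1 t = (x, y + z)] now =
              (1 - delta) * fine (nu [set (-1) ^ x * z])]].

Definition recurrent (R : realType) (d : measure_display)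
    (T : measurableType d) (Q : probability T R) (S : Type) (o : S)
    (M : nat -> T -> S) :=
  {ae Q, forall t, forall N : nat, exists2 n : nat, (N <= n)%N & M n t = o}.

(* Main.v *)
Require Import Defs.
From HB Require Import structures.
From mathcomp Require Import all_boot all_order all_algebra.
From mathcomp Require Import finmap.
From mathcomp Require Import all_classical all_reals all_analysis.
From mathcomp Require Import measurable_realfun.
From mathcomp Require Import ring lra zify.

Set Implicit Arguments.
Unset Strict Implicit.
Unset Printing Implicit Defensive.

Import Order.TTheory GRing.Theory Num.Theory.
Import numFieldNormedType.Exports.

Local Open Scope classical_set_scope.
Local Open Scope ring_scope.

(** Why the chain is recurrent.  By the Markov property it suffices that the
    expected number of visits to the origin is infinite ([green_recurrent]), and
    visits at even times are enough.

    Record a trajectory by the word of its horizontal and vertical steps.  The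
    walk alternates between even and odd columns at each horizontal step, so the
    word alone decides the orientation of all the vertical steps: given the word,
    the horizontal walk, which is a one-dimensional random walk in random
    environment, and the vertical displacement are independent
    ([wsum_le_chain]).  The probability to be at the origin at time [2 n] is thus
    at least the smallest return probability of the horizontal walk at the even
    times up to [2 n], times the weight of the words with an even number of
    horizontal letters whose vertical displacement vanishes.

    Vertical part.  A word with an even number of horizontal letters can be cut
    into two words with an odd number of them; the second one is read mirrored,
    so its displacement is subtracted.  Hence the weight in question is at least
    the sum of the squares of the masses of the law of the displacement at time
    [n] on odd words ([even_return_ge]), and by the Cauchy-Schwarz inequality it
    is at least a constant over [K] if a fixed part of the mass is in a window of
    size [K].  Pairing upward steps with downward ones, the displacement is a sum
    of steps of the symmetrized law, plus an unpaired remainder of order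
    [sqrt n] steps ([excess_sqr_le], [diff_mean_tnm_le]).  The former is of order
    [A n], and [A n] grows along the powers of 2 like [c ^ k] at most, for some
    [c < 2], since the index of the stable limit is larger than 1
    ([norming_doubling], [sums_small]).  So the weight at time [n <= 2 ^ k] is at
    least of order [c ^ - k] ([vertical_return_ge]).

    Horizontal part.  In the logarithm of [rho], the environment is a centered
    random walk, the potential.  At infinitely many scales it climbs by [H] on
    both sides of the origin before descending by a small fraction [theta H]: this
    has a probability bounded below given the smaller scales, by a gambler's ruin
    estimate ([ruin_ge], [ae_climbs]).  In such a valley the reversible walk stays
    for a time exponential in [H], and it is found at the origin at even times
    with a probability at least [exp (- eps L)], where [L = H / 2] and [eps] is
    as small as wanted ([valley_return], [valley_estimate]).

    For [k] about [L], the [2 ^ k] first even times then contribute at least of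
    order [2 ^ k * exp (- eps k) * c ^ - k] to the expected number of visits, which
    is unbounded when [c * exp eps < 2]. *)

(** * Means of bounded functions *)

Section bounded_functions.
Context d (T : measurableType d) (R : realType).
Implicit Types f g : T -> R.

Definition bmf f := measurable_fun [set: T] f /\ exists K, forall x, `|f x| <= K.

Lemma bmf_cst (c : R) : bmf (fun=> c).
Proof. by split; [exact: measurable_cst|exists `|c|]. Qed.

Lemma bmfN f : bmf f -> bmf (fun x => - f x).
Proof.
move=> [mf [K fK]]; split; first exact: measurableT_comp.
by exists K => x; rewrite normrN.
Qed.

Lemma bmfD f g : bmf f -> bmf g -> bmf (fun x => f x + g x).
Proof.
move=> [mf [K fK]] [mg [L gL]]; split; first exact: measurable_funD.
by exists (K + L) => x; rewrite (le_trans (ler_normD _ _))// lerD.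
Qed.

Lemma bmfB f g : bmf f -> bmf g -> bmf (fun x => f x - g x).
Proof. by move=> bf bg; apply: bmfD => //; exact: bmfN. Qed.

Lemma bmfM f g : bmf f -> bmf g -> bmf (fun x => f x * g x).
Proof.
move=> [mf [K fK]] [mg [L gL]]; split; first exact: measurable_funM.
by exists (K * L) => x; rewrite normrM ler_pM.
Qed.

Lemma bmfZ (c : R) f : bmf f -> bmf (fun x => c * f x).
Proof. by move=> bf; apply: bmfM => //; exact: bmf_cst. Qed.

Lemma bmfX f n : bmf f -> bmf (fun x => f x ^+ n).
Proof.
move=> bf; elim: n => [|n IH]; first exact: bmf_cst.
by under eq_fun do rewrite exprS; exact: bmfM.
Qed.

Lemma bmf_norm f : bmf f -> bmf (fun x => `|f x|).
Proof.
move=> [mf [K fK]]; split; first exact: measurableT_comp.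
by exists K => x; rewrite normr_id.
Qed.

Lemma bmf_sum (I : Type) (s : seq I) (F : I -> T -> R) :
  (forall i, bmf (F i)) -> bmf (fun x => \sum_(i <- s) F i x).
Proof.
move=> bF; elim: s => [|i s IH].
  by under eq_fun do rewrite big_nil; exact: bmf_cst.
by under eq_fun do rewrite big_cons; exact: bmfD.
Qed.

Lemma bmf_indic (A : set T) : measurable A -> bmf (\1_A : T -> R).
Proof.
move=> mA; split; first exact: measurable_indic.
by exists 1 => x; rewrite indicE; case: (_ \in _); rewrite /= ?normr1 ?normr0.
Qed.

End bounded_functions.

Lemma bmf_comp d d' (T : measurableType d) (U : measurableType d')
    (R : realType) (X : T -> U) (f : U -> R) :
  measurable_fun setT X -> bmf f -> bmf (fun x => f (X x)).
Proof.
move=> mX [mf [K fK]]; split; first exact: measurableT_comp.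
by exists K.
Qed.

Section mean.
Context d (T : measurableType d) (R : realType) (P : probability T R).
Implicit Types f g : T -> R.

Definition mean f : R := \int[P]_x f x.

Lemma bmf_integrable f : bmf f -> P.-integrable [set: T] (EFin \o f).
Proof.
move=> [mf [K fK]]; apply: measurable_bounded_integrable => //.
  by apply: (le_lt_trans (probability_le1 P measurableT)); rewrite ltry.
exists K; split; first exact: num_real.
by move=> M KM x _; exact: (le_trans (fK x) (ltW KM)).
Qed.

Lemma EFin_mean f : bmf f -> (mean f)%:E = (\int[P]_x (f x)%:E)%E.
Proof.
move=> bf; rewrite /mean /Rintegral fineK//.
exact/integrable_fin_num/bmf_integrable.
Qed.

Lemma eq_mean f g : f =1 g -> mean f = mean g.
Proof. by move=> fg; congr mean; exact/funext. Qed.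

Lemma mean_cst (c : R) : mean (fun=> c) = c.
Proof. by rewrite /mean Rintegral_cst// [X in fine X](@probability_setT _ _ _ P) mulr1. Qed.

Lemma meanD f g : bmf f -> bmf g -> mean (fun x => f x + g x) = mean f + mean g.
Proof. by move=> bf bg; rewrite /mean RintegralD//; exact: bmf_integrable. Qed.

Lemma meanB f g : bmf f -> bmf g -> mean (fun x => f x - g x) = mean f - mean g.
Proof. by move=> bf bg; rewrite /mean RintegralB//; exact: bmf_integrable. Qed.

Lemma meanZ (c : R) f : bmf f -> mean (fun x => c * f x) = c * mean f.
Proof. by move=> bf; rewrite /mean RintegralZl//; exact: bmf_integrable. Qed.

Lemma le_mean f g : bmf f -> bmf g -> (forall x, f x <= g x) -> mean f <= mean g.
Proof. by move=> bf bg fg; apply: le_Rintegral => //; exact: bmf_integrable. Qed.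

Lemma mean_ge0 f : (forall x, 0 <= f x) -> 0 <= mean f.
Proof. by move=> f0; exact: Rintegral_ge0. Qed.

Lemma mean_norm_le f : bmf f -> `|mean f| <= mean (fun x => `|f x|).
Proof. by move=> bf; apply: le_normr_Rintegral => //; exact: bmf_integrable. Qed.

Lemma mean_le_cst f (K : R) : bmf f -> (forall x, f x <= K) -> mean f <= K.
Proof.
by move=> bf fK; rewrite -[leRHS]mean_cst; apply: le_mean => //; exact: bmf_cst.
Qed.

Lemma mean_norm_le_cst f (K : R) : bmf f -> (forall x, `|f x| <= K) ->
  `|mean f| <= K.
Proof.
move=> bf fK; apply: (le_trans (mean_norm_le bf)).
by apply: mean_le_cst => //; exact: bmf_norm.
Qed.

Lemma mean_sum (I : Type) (s : seq I) (F : I -> T -> R) :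
  (forall i, bmf (F i)) ->
  mean (fun x => \sum_(i <- s) F i x) = \sum_(i <- s) mean (F i).
Proof.
move=> bF; elim: s => [|i s IH].
  by rewrite big_nil; under eq_mean do rewrite big_nil; exact: mean_cst.
rewrite big_cons; under eq_mean do rewrite big_cons.
by rewrite meanD ?IH//; exact: bmf_sum.
Qed.

Lemma mean_indic (A : set T) : measurable A -> mean \1_A = fine (P A).
Proof.
by move=> mA; rewrite /mean /Rintegral integral_indic// setIT.
Qed.

End mean.

Lemma mean_distribution d d' (T : measurableType d) (U : measurableType d')
    (R : realType) (P : probability T R) (X : {RV P >-> U}) (f : U -> R) :
  bmf f -> mean (distribution P X) f = mean P (fun x => f (X x)).
Proof.
move=> bf; apply: EFin_inj; rewrite !EFin_mean//; last exact: bmf_comp.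
rewrite (integral_distribution (f := EFin \o f))//.
- by case: bf => mf _; exact/measurable_EFinP.
- by apply: bmf_integrable; exact: bmf_comp.
Qed.

Section mean_prod.
Context d1 d2 (T1 : measurableType d1) (T2 : measurableType d2) (R : realType).
Variables (P1 : probability T1 R) (P2 : probability T2 R).
Implicit Type f : T1 * T2 -> R.

Lemma bmf_pair1 f x : bmf f -> bmf (fun y => f (x, y)).
Proof. by move=> bf; apply: (@bmf_comp _ _ _ _ _ (pair x)). Qed.

Lemma bmf_pair2 f y : bmf f -> bmf (fun x => f (x, y)).
Proof. by move=> bf; apply: (@bmf_comp _ _ _ _ _ (pair^~ y)). Qed.

Let intE f : bmf f -> (P1 \x P2)%E.-integrable [set: T1 * T2] (EFin \o f).
Proof. exact: (@bmf_integrable _ _ _ (P1 \x P2)%E). Qed.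

Lemma bmf_mean_snd f : bmf f -> bmf (fun x => mean P2 (fun y => f (x, y))).
Proof.
move=> bf; split.
  apply/measurable_EFinP.
  have := measurable_fubini_F (intE bf); apply: eq_measurable_fun => x _ /=.
  by rewrite /fubini_F -EFin_mean//; exact: bmf_pair1.
have [_ [K fK]] := bf; exists K => x.
by apply: mean_norm_le_cst => //; exact: bmf_pair1.
Qed.

Lemma bmf_mean_fst f : bmf f -> bmf (fun y => mean P1 (fun x => f (x, y))).
Proof.
move=> bf; split.
  apply/measurable_EFinP.
  have := measurable_fubini_G (intE bf); apply: eq_measurable_fun => x _ /=.
  by rewrite /fubini_G -EFin_mean//; exact: bmf_pair2.
have [_ [K fK]] := bf; exists K => x.
by apply: mean_norm_le_cst => //; exact: bmf_pair2.
Qed.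

Lemma mean_prod12 f : bmf f ->
  mean (P1 \x P2)%E f = mean P1 (fun x => mean P2 (fun y => f (x, y))).
Proof.
move=> bf; apply: EFin_inj; rewrite !EFin_mean//; last exact: bmf_mean_snd.
have := integral12_prod_meas1 (intE bf); rewrite /fubini_F /= => <-.
by apply: eq_integral => x _; rewrite EFin_mean//; exact: bmf_pair1.
Qed.

Lemma mean_prod21 f : bmf f ->
  mean (P1 \x P2)%E f = mean P2 (fun y => mean P1 (fun x => f (x, y))).
Proof.
move=> bf; apply: EFin_inj; rewrite !EFin_mean//; last exact: bmf_mean_fst.
have := integral21_prod_meas1 (intE bf); rewrite /fubini_G /= => <-.
by apply: eq_integral => y _; rewrite EFin_mean//; exact: bmf_pair2.
Qed.

End mean_prod.

(** * Laws on the integers *)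

Section integer_laws.
Context {R : realType}.
Implicit Types (mu nu : probability int R) (f g : int -> R) (K : R).

Lemma int_bmf f K : (forall x, `|f x| <= K) -> bmf f.
Proof. by move=> fK; split => //; exists K. Qed.

Lemma intprod_bmf (F : int -> int -> R) K : (forall x y, `|F x y| <= K) ->
  bmf (fun p : int * int => F p.1 p.2).
Proof.
move=> FK; split; last by exists K => -[x y].
by move=> _ B _; exact: measurable_int_prod.
Qed.

Lemma bd_mean mu f K : (forall x, `|f x| <= K) -> `|mean mu f| <= K.
Proof. by move=> fK; apply: mean_norm_le_cst => //; exact: int_bmf fK. Qed.

Lemma meanC mu nu (F : int -> int -> R) K : (forall x y, `|F x y| <= K) ->
  mean mu (fun x => mean nu (F x)) = mean nu (fun y => mean mu (F^~ y)).
Proof.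
move=> FK; have b := intprod_bmf FK.
by rewrite -(mean_prod12 mu nu b) -(mean_prod21 mu nu b).
Qed.

Lemma mean_conv mu nu f K : (forall x, `|f x| <= K) ->
  mean (convolution mu nu) f = mean mu (fun x => mean nu (fun y => f (x + y))).
Proof.
move=> fK; rewrite mean_distribution; last exact: int_bmf fK.
have b : bmf (fun p : int * int => f (p.1 + p.2)).
  exact: (@intprod_bmf (fun x y => f (x + y)) K).
by rewrite -(mean_prod12 mu nu b).
Qed.

Definition mirror nu : probability int R := distribution nu oppZ.

Lemma mean_mirror nu f K : (forall x, `|f x| <= K) ->
  mean (mirror nu) f = mean nu (fun x => f (- x)).
Proof. by move=> fK; rewrite mean_distribution//; exact: int_bmf fK. Qed.

Lemma mean_dirac (a : int) f K : (forall x, `|f x| <= K) ->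
  mean (dirac a : probability int R) f = f a.
Proof.
move=> fK; apply: EFin_inj; rewrite EFin_mean; last exact: int_bmf fK.
by rewrite integral_dirac// diracT mul1e.
Qed.

Definition pm mu (z : int) : R := fine (mu [set z]).

Lemma pmE mu z : pm mu z = mean mu (fun x => (x == z)%:R).
Proof.
by rewrite /pm -mean_indic//; apply: eq_mean => x; rewrite indicE in_set1.
Qed.

Lemma pm_ge0 mu z : 0 <= pm mu z. Proof. exact: fine_ge0. Qed.

Lemma bool_bd (b : bool) : `|b%:R| <= 1 :> R.
Proof. by case: b; rewrite ?normr1 ?normr0. Qed.

Lemma le_imean mu f g K : (forall x, `|f x| <= K) -> (forall x, `|g x| <= K) ->
  (forall x, f x <= g x) -> mean mu f <= mean mu g.
Proof. by move=> fK gK fg; apply: le_mean => //; [exact: int_bmf fK|exact: int_bmf gK]. Qed.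

Lemma imeanD mu f g K : (forall x, `|f x| <= K) -> (forall x, `|g x| <= K) ->
  mean mu (fun x => f x + g x) = mean mu f + mean mu g.
Proof. by move=> fK gK; apply: meanD; [exact: int_bmf fK|exact: int_bmf gK]. Qed.

Lemma imeanZ mu f K c : (forall x, `|f x| <= K) ->
  mean mu (fun x => c * f x) = c * mean mu f.
Proof. by move=> fK; apply: meanZ; exact: int_bmf fK. Qed.

End integer_laws.

(* Discharges the uniform bounds required to exchange or unfold means. *)
Ltac bd :=
  intros; first [solve [auto] | apply: bd_mean; bd].

Section convolution_powers.
Context {R : realType}.
Implicit Types (mu nu : probability int R) (f g : int -> R) (K : R).

Lemma mean_powS mu n f K : (forall x, `|f x| <= K) ->
  mean (convolution_pow mu n.+1) f =
  mean (convolution_pow mu n) (fun x => mean mu (fun y => f (x + y))).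
Proof. exact: mean_conv. Qed.

Lemma mean_pow0 mu f K : (forall x, `|f x| <= K) ->
  mean (convolution_pow mu 0) f = f 0.
Proof. exact: mean_dirac. Qed.

Lemma mean_powD mu m n f K : (forall x, `|f x| <= K) ->
  mean (convolution_pow mu (m + n)) f =
  mean (convolution_pow mu m)
    (fun x => mean (convolution_pow mu n) (fun y => f (x + y))).
Proof.
elim: n f => [|n IH] f fK.
  rewrite addn0; apply: eq_mean => x.
  by rewrite (mean_pow0 mu (K := K)) ?addr0//.
rewrite addnS (mean_powS _ _ fK) IH; last by bd.
apply: eq_mean => x; rewrite (mean_powS _ _ (K := K)); last by bd.
by apply: eq_mean => y; apply: eq_mean => z; rewrite addrA.
Qed.

Lemma mean_powSl mu n f K : (forall x, `|f x| <= K) ->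
  mean (convolution_pow mu n.+1) f =
  mean mu (fun y => mean (convolution_pow mu n) (fun x => f (y + x))).
Proof.
move=> fK; rewrite (mean_powS _ _ fK) (meanC _ _ (K := K)); last by bd.
by apply: eq_mean => y; apply: eq_mean => x; rewrite addrC.
Qed.

Lemma mean_symmetrized nu f K : (forall x, `|f x| <= K) ->
  mean (symmetrized nu) f = mean nu (fun x => mean nu (fun y => f (y - x))).
Proof.
move=> fK; rewrite (mean_conv _ _ fK) (mean_mirror _ (K := K)); last by bd.
by apply: eq_mean => x; apply: eq_mean => y; rewrite addrC.
Qed.

Definition symmetric mu := forall f K, (forall x, `|f x| <= K) ->
  mean mu (fun x => f (- x)) = mean mu f.

Lemma symmetrized_symmetric nu : symmetric (symmetrized nu).
Proof.
move=> f K fK; rewrite !(mean_symmetrized _ (K := K)); [|by bd|by bd].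
rewrite (meanC _ _ (K := K)); last by bd.
by apply: eq_mean => x; apply: eq_mean => y; rewrite opprB.
Qed.

Lemma pow_symmetric mu n : symmetric mu -> symmetric (convolution_pow mu n).
Proof.
move=> smu; elim: n => [|n IH] f K fK.
  by rewrite !(mean_pow0 _ (K := K)) ?oppr0.
rewrite !(mean_powS _ _ (K := K))//.
rewrite -[RHS](IH _ K); last by bd.
apply: eq_mean => x; rewrite -[RHS](smu _ K)//.
by apply: eq_mean => y; rewrite opprD.
Qed.

(** Steps commute, so the vertical displacement along a word depends on it only
    through the numbers [a] and [c] of its upward and downward steps. *)
Definition diff_mean nu (a c : nat) f : R :=
  mean (convolution_pow nu a)
    (fun x => mean (convolution_pow (mirror nu) c) (fun y => f (x + y))).

Lemma diff_mean_diag nu c f K : (forall x, `|f x| <= K) ->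
  diff_mean nu c c f = mean (convolution_pow (symmetrized nu) c) f.
Proof.
elim: c f => [|c IH] f fK.
  by rewrite /diff_mean !(mean_pow0 _ (K := K))//; bd.
rewrite (mean_powS _ _ fK) -IH; last by bd.
rewrite /diff_mean (mean_powS _ _ (K := K)); last by bd.
apply: eq_mean => x.
transitivity (mean nu (fun v => mean (convolution_pow (mirror nu) c)
    (fun y => mean (mirror nu) (fun u => f (x + v + (y + u)))))).
  by apply: eq_mean => v; rewrite (mean_powS _ _ (K := K)).
rewrite (meanC _ _ (K := K)); last by bd.
apply: eq_mean => y; rewrite (mean_conv _ _ (K := K)); last by bd.
rewrite (meanC _ _ (K := K)); last by bd.
apply: eq_mean => u; apply: eq_mean => v.
by congr f; rewrite -!addrA; congr (_ + _); rewrite addrCA [v + u]addrC.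
Qed.

(** A truncated absolute moment: it dominates the tail beyond [K], and it is
    subadditive along sums, without any moment assumption. *)
Definition tnm (K : R) (y : int) : R := Num.min 1 (`|y%:~R| / K).

Lemma tnm_ge0 K y : 0 < K -> 0 <= tnm K y.
Proof. by move=> K0; rewrite /tnm le_min ler01 divr_ge0// ltW. Qed.

Lemma tnm_bd K y : 0 < K -> `|tnm K y| <= 1.
Proof. by move=> K0; rewrite ger0_norm ?tnm_ge0// /tnm ge_min lexx. Qed.

Lemma tnmD K x y : 0 < K -> tnm K (x + y) <= tnm K x + tnm K y.
Proof.
move=> K0.
have h : `|(x + y)%:~R| / K <= `|x%:~R| / K + `|y%:~R| / K :> R.
  by rewrite -mulrDl ler_pM2r ?invr_gt0// rmorphD/= ler_normD.
have hx : 0 <= `|x%:~R| / K :> R by rewrite divr_ge0// ltW.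
have hy : 0 <= `|y%:~R| / K :> R by rewrite divr_ge0// ltW.
by rewrite /tnm; move: h hx hy; rewrite !minElt; repeat case: ifPn => ?; lra.
Qed.

Lemma tnm_mid K x u : 0 < K -> tnm K x <= tnm K (x + u) + tnm K (x - u).
Proof.
move=> K0.
have h : `|x%:~R| / K <= `|(x + u)%:~R| / K + `|(x - u)%:~R| / K :> R.
  rewrite -mulrDl ler_pM2r ?invr_gt0// !(rmorphD, rmorphN)/=.
  set a : R := x%:~R; set b : R := u%:~R.
  have : `|(a + b) + (a - b)| <= `|a + b| + `|a - b| by exact: ler_normD.
  rewrite (_ : a + b + (a - b) = 2 * a); last by ring.
  by rewrite normrM ger0_norm//; have := normr_ge0 a; lra.
have hx : 0 <= `|x%:~R| / K :> R by rewrite divr_ge0// ltW.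
have h1 : 0 <= `|(x + u)%:~R| / K :> R by rewrite divr_ge0// ltW.
have h2 : 0 <= `|(x - u)%:~R| / K :> R by rewrite divr_ge0// ltW.
by rewrite /tnm; move: h hx h1 h2; rewrite !minElt; repeat case: ifPn => ?; lra.
Qed.

(** Adding an independent symmetric variable [U] cannot make a truncated moment
    much smaller: [X] is the midpoint of [X + U] and [X - U], which have the
    same law. *)
Lemma tnm_pow_le mu b n K : symmetric mu -> 0 < K ->
  mean (convolution_pow mu b) (tnm K) <=
  2 * mean (convolution_pow mu (b + n)) (tnm K).
Proof.
move=> smu K0; have tK x := tnm_bd x K0.
rewrite (mean_powD _ _ _ tK) -(imeanZ _ _ (K := 1)); last by bd.
have tK2 x : `|tnm K x| <= 2 by apply: (le_trans (tK _)); lra.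
apply: (@le_imean _ _ _ _ 2) => [//|x|x].
  by rewrite normrM ger0_norm// ler_piMr//; apply: bd_mean => y; exact: tK.
rewrite mulrDl mul1r.
rewrite -[X in _ <= X + _](pow_symmetric (K := 1) _ smu); last by bd.
rewrite -(imeanD _ (K := 1)); [|by bd|by bd].
rewrite -[leLHS](mean_cst (convolution_pow mu n)).
apply: (@le_imean _ _ _ _ 2) => [//|y|y].
  by rewrite (le_trans (ler_normD _ _))//; have := tK (x - y); have := tK (x + y); lra.
by have := tnm_mid x y K0; lra.
Qed.

Lemma diff_mean_tnmSl nu a c K : 0 < K ->
  diff_mean nu a.+1 c (tnm K) <= diff_mean nu a c (tnm K) + mean nu (tnm K).
Proof.
move=> K0; have tK x := tnm_bd x K0.
rewrite /diff_mean (mean_powS _ _ (K := 1)); last by bd.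
rewrite -[X in _ <= _ + X](mean_cst (convolution_pow nu a)) -(imeanD _ (K := 1)).
- apply: (@le_imean _ _ _ _ 2) => [x|x|x].
  + by apply: (@le_trans _ _ 1); [bd|lra].
  + rewrite (le_trans (ler_normD _ _))// (_ : 2 = 1 + 1); last by ring.
    by apply: lerD; bd.
  + rewrite (meanC _ _ (K := 1)); last by bd.
    rewrite -[X in _ <= _ + X](mean_cst (convolution_pow (mirror nu) c)).
    rewrite -(imeanD _ (K := 1)); [|by bd|by bd].
    apply: (@le_imean _ _ _ _ 2) => [y|y|y].
    * by apply: (@le_trans _ _ 1); [bd|lra].
    * rewrite (le_trans (ler_normD _ _))// (_ : 2 = 1 + 1); last by ring.
      by apply: lerD; bd.
    * rewrite -[X in X + _](mean_cst nu) -(imeanD _ (K := 1)); [|by bd|by bd].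
      apply: (@le_imean _ _ _ _ 2) => [z|z|z].
      -- by apply: (@le_trans _ _ 1); [bd|lra].
      -- rewrite (le_trans (ler_normD _ _))// (_ : 2 = 1 + 1); last by ring.
         by apply: lerD; bd.
      -- by rewrite addrAC tnmD.
- by bd.
- by bd.
Qed.

Lemma tnmN K x : tnm K (- x) = tnm K x.
Proof. by rewrite /tnm rmorphN normrN. Qed.

Lemma diff_meanC nu a c f K : (forall x, `|f x| <= K) ->
  diff_mean nu a c f = diff_mean nu c a (fun x => f (- x)).
Proof.
have powM n g : (forall x, `|g x| <= K) ->
    mean (convolution_pow (mirror nu) n) g =
    mean (convolution_pow nu n) (fun x => g (- x)).
  elim: n g => [|n IH] g gK; first by rewrite !(mean_pow0 _ (K := K)) ?oppr0.
  rewrite !(mean_powS _ _ (K := K))// IH; last by bd.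
  apply: eq_mean => x; rewrite (mean_mirror _ (K := K)); last by bd.
  by apply: eq_mean => y; rewrite opprD.
move=> fK; rewrite /diff_mean (meanC _ _ (K := K)); last by bd.
rewrite powM; last by bd.
apply: eq_mean => x; rewrite powM; last by bd.
by apply: eq_mean => y; rewrite opprD opprK addrC.
Qed.

(** Pairing the steps of opposite directions leaves a symmetrized sum of
    [minn a c] terms and only [|a - c|] unpaired steps. *)
Lemma diff_mean_tnm_le nu a c K : 0 < K ->
  diff_mean nu a c (tnm K) <=
  mean (convolution_pow (symmetrized nu) (minn a c)) (tnm K) +
  `|a%:R - c%:R| * mean nu (tnm K).
Proof.
move=> K0; have tK x := tnm_bd x K0.
have step n k : diff_mean nu (n + k) n (tnm K) <=
    mean (convolution_pow (symmetrized nu) n) (tnm K) + k%:R * mean nu (tnm K).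
  elim: k => [|k IH]; first by rewrite addn0 mul0r addr0 (diff_mean_diag _ _ tK).
  rewrite addnS (le_trans (diff_mean_tnmSl _ _ _ K0))//.
  by move: IH; rewrite -natr1; lra.
have [ac|/ltnW ca] := leqP a c.
  rewrite (diff_meanC _ _ _ tK); under [X in diff_mean _ _ _ X]eq_fun do rewrite tnmN.
  have := step a (c - a)%N; rewrite subnKC// natrB//.
  by rewrite distrC ger0_norm// subr_ge0 ler_nat.
have := step c (a - c)%N; rewrite subnKC// natrB//.
by rewrite ger0_norm// subr_ge0 ler_nat.
Qed.

End convolution_powers.

(** * Words of horizontal and vertical steps *)

(** The numbers of vertical letters met after an even, respectively an odd,
    number of horizontal ones. *)
Fixpoint updown (s : seq bool) : nat * nat :=
  match s with
  | [::] => (0, 0)%N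
  | true :: s' => ((updown s').2, (updown s').1)
  | false :: s' => ((updown s').1.+1, (updown s').2)
  end.

Lemma updown_min s : (minn (updown s).1 (updown s).2 <= size s)%N.
Proof.
suff: ((updown s).1 + (updown s).2 <= size s)%N by move=> ?; lia.
by elim: s => [|[] s IH] //=; lia.
Qed.

Section words.
Context {R : realType}.
Variable delta : R.
Implicit Types F G : seq bool -> R.

(** Sums over the words of length [n], where [true] is a horizontal step, of
    weight [delta], and [false] a vertical one, of weight [1 - delta]. *)
Fixpoint wsum (n : nat) F : R :=
  if n is n'.+1 then
    delta * wsum n' (fun s => F (true :: s)) +
    (1 - delta) * wsum n' (fun s => F (false :: s))
  else F [::].

Lemma eq_wsum n F G : (forall s, size s = n -> F s = G s) -> wsum n F = wsum n G.
Proof.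
elim: n F G => [|n IH] F G FG /=; first exact: FG.
by congr (_ * _ + _ * _); apply: IH => s sn; apply: FG; rewrite /= sn.
Qed.

Lemma wsum_cat m n F :
  wsum (m + n) F = wsum m (fun s => wsum n (fun t => F (s ++ t))).
Proof. by elim: m F => [//|m IH] F; rewrite addSn /= !IH. Qed.

Lemma wsum_rcons n F : wsum n.+1 F =
  wsum n (fun s => delta * F (rcons s true) + (1 - delta) * F (rcons s false)).
Proof.
rewrite -addn1 wsum_cat; apply: eq_wsum => s _ /=.
by rewrite !cats1.
Qed.

Lemma wsumD n F G : wsum n (fun s => F s + G s) = wsum n F + wsum n G.
Proof. by elim: n F G => [//|n IH] F G /=; rewrite !IH; ring. Qed.

Lemma wsumZ n c F : wsum n (fun s => c * F s) = c * wsum n F.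
Proof. by elim: n F => [//|n IH] F /=; rewrite !IH; ring. Qed.

Lemma wsum_cst n c : wsum n (fun=> c) = c.
Proof. by elim: n => [//|n /= ->]; ring. Qed.

Lemma wsum_sum n (I : Type) (r : seq I) (F : I -> seq bool -> R) :
  wsum n (fun s => \sum_(i <- r) F i s) = \sum_(i <- r) wsum n (F i).
Proof.
elim: r => [|i r IH].
  by rewrite big_nil -[RHS](wsum_cst n); apply: eq_wsum => s _; rewrite big_nil.
rewrite big_cons -IH -wsumD; apply: eq_wsum => s _; by rewrite big_cons.
Qed.

Lemma wsum_mean d (T : measurableType d) (P : probability T R) n
    (F : seq bool -> T -> R) : (forall s, bmf (F s)) ->
  bmf (fun x => wsum n (fun s => F s x)) /\
  mean P (fun x => wsum n (fun s => F s x)) = wsum n (fun s => mean P (F s)).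
Proof.
elim: n F => [|n IH] F bF /=; first by split; [exact: bF|].
have [b1 e1] := IH (fun s => F (true :: s)) (fun s => bF _).
have [b2 e2] := IH (fun s => F (false :: s)) (fun s => bF _).
split; first by apply: bmfD; apply: bmfZ.
by rewrite meanD ?meanZ// ?e1 ?e2//; exact: bmfZ.
Qed.

Hypothesis delta01 : 0 < delta < 1.

Lemma le_wsum n F G : (forall s, size s = n -> F s <= G s) -> wsum n F <= wsum n G.
Proof.
have /andP[d0 d1] := delta01.
elim: n F G => [|n IH] F G FG /=; first exact: FG.
apply: lerD; (apply: ler_wpM2l; first by lra);
  by apply: IH => s sn; apply: FG; rewrite /= sn.
Qed.

Lemma wsum_ge0 n F : (forall s, 0 <= F s) -> 0 <= wsum n F.
Proof. by move=> F0; rewrite -[leLHS](wsum_cst n); apply: le_wsum. Qed.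

Definition nh (s : seq bool) := count id s.

Lemma odd_words_ge n : (0 < n)%N ->
  Num.min delta (1 - delta) <= wsum n (fun s => (odd (nh s))%:R).
Proof.
have /andP[d0 d1] := delta01.
have oddS m : wsum m.+1 (fun s => (odd (nh s))%:R) =
    delta * (1 - wsum m (fun s => (odd (nh s))%:R)) +
    (1 - delta) * wsum m (fun s => (odd (nh s))%:R).
  rewrite /=; congr (delta * _ + _).
  rewrite (eq_wsum (G := fun s => 1 + -1 * (odd (nh s))%:R)); last first.
    by move=> s _; rewrite /nh /= oddD /=; case: odd; rewrite /=; ring.
  by rewrite wsumD wsumZ wsum_cst mulN1r.
have o1 m : 0 <= wsum m (fun s => (odd (nh s))%:R) <= 1.
  rewrite wsum_ge0// -[leRHS](wsum_cst m); apply: le_wsum => s _.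
  by case: odd.
case: n => // n _; rewrite oddS; have := o1 n.
set p := wsum n _ => p01; rewrite ge_min; apply/orP.
have [h|h] := lerP delta (1 - delta); [left|right]; nra.
Qed.

Definition excess s : R := (updown s).1%:R - (updown s).2%:R.

Definition excess_cst : R := 1 + 2 / (1 - `|1 - 2 * delta|).

(** The sign of the vertical steps is refreshed at a positive rate, so the
    excess is diffusive: its mean is bounded, because a horizontal letter put in
    front of a word reverses the excess. *)
Lemma excess_sqr_le n : wsum n (fun s => excess s ^+ 2) <= excess_cst * n%:R.
Proof.
have /andP[d0 d1] := delta01.
have eT s : excess (true :: s) = - excess s by rewrite /excess /= opprB.
have eF s : excess (false :: s) = 1 + excess s.
  by rewrite /excess /= -natr1; ring.
have q1 : `|1 - 2 * delta| < 1 by rewrite ltr_norml; apply/andP; split; lra.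
set q := `|1 - 2 * delta| in q1.
have q0 : 0 <= q by exact: normr_ge0.
have m1 m : `|wsum m excess| <= (1 - q)^-1.
  elim: m => [|m IH].
    by rewrite /excess /= subrr normr0 invr_ge0 subr_ge0 ltW.
  rewrite /= (eq_wsum (G := fun s => - 1 * excess s)); last first.
    by move=> s _; rewrite eT mulN1r.
  rewrite wsumZ (eq_wsum (F := fun s => excess (false :: s))
    (G := fun s => 1 + excess s)); last by move=> s _; rewrite eF.
  rewrite (wsumD m (fun=> 1) excess) wsum_cst.
  change (`|delta * (-1 * wsum m excess) + (1 - delta) * (1 + wsum m excess)| <=
    (1 - q)^-1).
  rewrite (_ : delta * _ + _ = (1 - 2 * delta) * wsum m excess + (1 - delta)); last by ring.
  rewrite (le_trans (ler_normD _ _))// normrM -/q (@ger0_norm _ (1 - delta)); last lra.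
  have h : q * `|wsum m excess| <= q * (1 - q)^-1 by rewrite ler_wpM2l.
  have e : q * (1 - q)^-1 = (1 - q)^-1 - 1 by field; rewrite subr_eq0 gt_eqF.
  by lra.
elim: n => [|n IH].
  by rewrite /excess /= subrr expr0n mulr0.
rewrite /= (eq_wsum (G := fun s => excess s ^+ 2)); last first.
  by move=> s _; rewrite eT sqrrN.
rewrite (eq_wsum (F := fun s => excess (false :: s) ^+ 2)
  (G := fun s => (1 + 2 * excess s) + excess s ^+ 2)); last first.
  by move=> s _; rewrite eF; ring.
rewrite !wsumD wsumZ wsum_cst.
have := m1 n; rewrite ler_norml => /andP[_ m1n].
move: IH; rewrite /excess_cst -/q -natr1; set w2 := wsum n _; set w := wsum n _ in m1n *.
move=> IH.
have h : (1 - delta) * (1 + 2 * w) <= 1 + 2 / (1 - q).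
  have u0 : 0 <= (1 - q)^-1 by rewrite invr_ge0 subr_ge0 ltW.
  have : (1 - delta) * (1 + 2 * w) <= (1 - delta) * (1 + 2 * (1 - q)^-1).
    by rewrite ler_wpM2l; lra.
  by nra.
by nra.
Qed.

Lemma excess_norm_le n (u : R) : 0 < u ->
  wsum n (fun s => `|excess s|) <= (excess_cst * n%:R / u + u) / 2.
Proof.
move=> u0.
apply: (@le_trans _ _ (wsum n (fun s => (2 * u)^-1 * excess s ^+ 2 + u / 2))).
  apply: le_wsum => s _; rewrite -[_ ^+ 2]real_normK ?num_real//.
  set x := `|_|; rewrite -subr_ge0.
  have -> : (2 * u)^-1 * x ^+ 2 + u / 2 - x = (2 * u)^-1 * ((x - u) ^+ 2).
    by field; rewrite gt_eqF.
  by rewrite mulr_ge0 ?sqr_ge0// invr_ge0 mulr_ge0// ltW.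
rewrite wsumD wsum_cst (wsumZ n (2 * u)^-1).
have := excess_sqr_le n; set w := wsum n _ => h.
rewrite [leRHS]mulrDl lerD2r.
have -> : excess_cst * n%:R / u / 2 = (2 * u)^-1 * (excess_cst * n%:R).
  by field; rewrite gt_eqF.
by rewrite ler_wpM2l// invr_ge0 mulr_ge0// ltW.
Qed.

End words.

Lemma sum_sqr_ge (R : realFieldType) (I : Type) (r : seq I) (f : I -> R) : (0 < size r)%N ->
  (\sum_(z <- r) f z) ^+ 2 / (size r)%:R <= \sum_(z <- r) f z ^+ 2.
Proof.
move=> r0; set S := \sum_(z <- r) f z; set k : R := (size r)%:R.
have k0 : 0 < k by rewrite ltr0n.
have kE : \sum_(z <- r) (1 : R) = k.
  by rewrite big_const_seq count_predT iter_addr_0.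
have : 0 <= \sum_(z <- r) (f z - S / k) ^+ 2 by apply: sumr_ge0 => z _; exact: sqr_ge0.
rewrite (eq_bigr (fun z => f z ^+ 2 +
  (- (2 * S / k) * f z + (S / k) ^+ 2 * 1))); last by move=> z _; ring.
rewrite !big_split/= -!mulr_sumr -/S kE.
rewrite (_ : - _ * _ + _ = - (S ^+ 2 / k)) ?subr_ge0//.
by field; rewrite gt_eqF.
Qed.

Section word_laws.
Context {R : realType}.
Variable nu : probability int R.

(** The law of the vertical displacement along a word read from an even column:
    once a horizontal step is made, all that follows is mirrored. *)
Fixpoint wlaw (s : seq bool) : probability int R :=
  match s with
  | [::] => dirac (0 : int)
  | true :: s' => mirror (wlaw s')
  | false :: s' => convolution nu (wlaw s')
  end.

Definition flip (b : bool) (z : int) : int := if b then - z else z.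

Lemma mean_wlaw_cat s t f K : (forall x, `|f x| <= K) ->
  mean (wlaw (s ++ t)) f =
  mean (wlaw s) (fun x => mean (wlaw t) (fun y => f (x + flip (odd (nh s)) y))).
Proof.
elim: s f => [|b s IH] f fK /=.
  rewrite (mean_dirac _ (K := K)); last by bd.
  by apply: eq_mean => y; rewrite add0r.
case: b => /=.
  rewrite !(mean_mirror _ (K := K))//; [|by bd..].
  rewrite IH; last by bd.
  apply: eq_mean => x; apply: eq_mean => y; rewrite opprD; congr (f (_ + _)).
  by rewrite /nh /= oddD /=; case: odd; rewrite /flip /= ?opprK.
rewrite !(mean_conv _ _ (K := K))//; [|by bd..].
apply: eq_mean => z; rewrite IH; last by bd.
by apply: eq_mean => x; apply: eq_mean => y; rewrite addrA.
Qed.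

Lemma mean_wlaw_diff s f K : (forall x, `|f x| <= K) ->
  mean (wlaw s) f = diff_mean nu (updown s).1 (updown s).2 f.
Proof.
elim: s f => [|[] s IH] f fK /=.
- rewrite /diff_mean (mean_dirac _ fK) (mean_pow0 _ (K := K)); last by bd.
  by rewrite (mean_pow0 _ (K := K)) ?add0r//; bd.
- by rewrite (mean_mirror _ fK) IH ?(diff_meanC _ _ _ fK)//; bd.
- rewrite (mean_conv _ _ fK) /diff_mean (mean_powSl _ _ (K := K)); last by bd.
  apply: eq_mean => z; rewrite IH ?/diff_mean//.
  by apply: eq_mean => x; apply: eq_mean => y; rewrite addrA.
Qed.

Lemma mean_sum_pm (mu : probability int R) (zs : seq int) f K :
  uniq zs -> (forall x, 0 <= f x <= K) ->
  \sum_(z <- zs) f z * pm mu z <= mean mu f.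
Proof.
move=> uzs fK.
have fK' x : `|f x| <= K by rewrite ger0_norm; case/andP: (fK x).
rewrite (eq_bigr (fun z => mean mu (fun x => f z * (x == z)%:R))); last first.
  by move=> z _; rewrite pmE -(imeanZ _ _ (K := 1))// => x; exact: bool_bd.
rewrite -mean_sum; last first.
  by move=> z; apply/bmfZ/(@int_bmf _ _ 1) => x; exact: bool_bd.
apply: le_mean.
- by apply: bmf_sum => z; apply/bmfZ/(@int_bmf _ _ 1) => x; exact: bool_bd.
- exact: int_bmf fK'.
- move=> x; have /andP[fx0 _] := fK x.
  have [xz|xz] := boolP (x \in zs).
    rewrite (bigD1_seq x)//= eqxx mulr1 big1 ?addr0// => z zx.
    by rewrite eq_sym (negbTE zx) mulr0.
  rewrite big_seq big1// => z zz.
  by case: eqP => [xzE|]; rewrite ?mulr0//; move: xz; rewrite xzE zz.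
Qed.

Definition window (K : nat) : seq int := [seq i%:Z - K%:Z | i <- iota 0 (K + K).+1].

Lemma window_uniq K : uniq (window K).
Proof. by rewrite map_inj_uniq ?iota_uniq// => i j /addIr[]. Qed.

Lemma mem_window K z : (z \in window K) = (`|z| <= K)%N.
Proof.
apply/mapP/idP => [[i]|zK]; first by rewrite mem_iota => /andP[_ iK] ->; lia.
by exists (absz (z + K%:Z)); rewrite ?mem_iota; lia.
Qed.

Lemma size_window K : size (window K) = (K + K).+1.
Proof. by rewrite size_map size_iota. Qed.

Lemma mean_le_window (mu : probability int R) (f : int -> R) K : (0 < K)%N ->
  (forall x, 0 <= f x <= 1) ->
  mean mu f <= \sum_(z <- window K) f z * pm mu z + mean mu (tnm K%:R).
Proof.
move=> K0 f01; have K0' : (0 < K%:R :> R) by rewrite ltr0n.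
have bw z : bmf (fun x : int => f z * (x == z)%:R).
  by apply/bmfZ/(@int_bmf _ _ 1) => x; exact: bool_bd.
have bt : bmf (@tnm R K%:R) by exact: int_bmf (fun x => tnm_bd x K0').
rewrite (eq_bigr (fun z => mean mu (fun x => f z * (x == z)%:R))); last first.
  by move=> z _; rewrite pmE -(imeanZ _ _ (K := 1))// => x; exact: bool_bd.
rewrite -mean_sum// -meanD//; last exact: bmf_sum.
apply: le_mean.
- by apply: (@int_bmf _ _ 1) => x; have /andP[? ?] := f01 x; rewrite ger0_norm.
- by apply: bmfD => //; exact: bmf_sum.
move=> x; have /andP[fx0 fx1] := f01 x; have [xz|xz] := boolP (x \in window K).
  rewrite (bigD1_seq x) ?window_uniq//= eqxx mulr1 big1 ?addr0; last first.
    by move=> z zx; rewrite eq_sym (negbTE zx) mulr0.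
  by rewrite lerDl tnm_ge0.
rewrite ler_wpDl//.
  by apply: sumr_ge0 => z _; rewrite mulr_ge0//; case/andP: (f01 z).
apply: (le_trans fx1); rewrite /tnm le_min lexx/= ler_pdivlMr// mul1r.
move: xz; rewrite mem_window -ltnNge => xK.
have -> : `|x%:~R| = (absz x)%:R :> R by rewrite natr_absz intr_norm.
by rewrite ler_nat ltnW.
Qed.

Lemma window_mass (mu : probability int R) K : (0 < K)%N ->
  1 - mean mu (tnm K%:R) <= \sum_(z <- window K) pm mu z.
Proof.
move=> K0; have := @mean_le_window mu (fun=> 1) K K0 (fun=> _).
rewrite mean_cst; under eq_bigr do rewrite mul1r.
by rewrite lerBlDr; apply => x; rewrite ler01 lexx.
Qed.

Variables (delta : R).
Hypothesis delta01 : 0 < delta < 1.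

Definition odd_mass n z := wsum delta n (fun s => (odd (nh s))%:R * pm (wlaw s) z).

(** Concatenating two words that both end on an odd column gives a word ending
    on an even one, and the second part is then read mirrored: the two vertical
    displacements are subtracted, so that they cancel as soon as they agree. *)
Lemma even_return_ge n K :
  (\sum_(z <- window K) odd_mass n z) ^+ 2 / (K + K).+1%:R <=
  wsum delta (n + n) (fun s => (~~ odd (nh s))%:R * pm (wlaw s) 0).
Proof.
rewrite -size_window; apply: (le_trans (sum_sqr_ge _ _)); first by rewrite size_window.
rewrite wsum_cat.
apply: (@le_trans _ _ (wsum delta n (fun s => wsum delta n (fun t =>
   \sum_(z <- window K) ((odd (nh s))%:R * pm (wlaw s) z) *
                        ((odd (nh t))%:R * pm (wlaw t) z))))).
  rewrite (eq_wsum _ (G := fun s => \sum_(z <- window K)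
      odd_mass n z * ((odd (nh s))%:R * pm (wlaw s) z))); last first.
    move=> s _; rewrite wsum_sum; apply: eq_bigr => z _.
    by rewrite wsumZ mulrC.
  rewrite wsum_sum le_eqVlt; apply/orP; left; apply/eqP.
  by apply: eq_bigr => z _; rewrite wsumZ.
apply: le_wsum => // s _; apply: le_wsum => // t _.
rewrite /nh count_cat oddD -/(nh s) -/(nh t).
case os: (odd (nh s)); last first.
  rewrite big1 ?mulr_ge0 ?pm_ge0// => z _.
  by rewrite mul0r mul0r.
case ot: (odd (nh t)); last first.
  by rewrite big1 ?mulr_ge0 ?pm_ge0// => z _; rewrite mul0r mulr0.
rewrite /= !mul1r pmE (mean_wlaw_cat _ _ (K := 1)); last by move=> x; exact: bool_bd.
rewrite os /=.
under [X in _ <= mean _ X]eq_fun => x.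
  under eq_mean do rewrite subr_eq0 eq_sym.
  rewrite -pmE; over.
under eq_bigr do rewrite mul1r mul1r mulrC.
apply: (@mean_sum_pm _ _ _ 1); first exact: window_uniq.
move=> x; rewrite pm_ge0 pmE /=; apply: (le_trans (ler_norm _)).
by apply: bd_mean => y; exact: bool_bd.
Qed.

Lemma odd_mass_ge n N K (u m1 : R) :
  (0 < n <= N)%N -> (0 < K)%N -> 0 < u -> mean nu (tnm K%:R) <= m1 ->
  Num.min delta (1 - delta) -
    (2 * mean (convolution_pow (symmetrized nu) N) (tnm K%:R) +
     (excess_cst delta * n%:R / u + u) / 2 * m1) <=
  \sum_(z <- window K) odd_mass n z.
Proof.
move=> /andP[n0 nN] K0 u0 hm1; have K0' : (0 < K%:R :> R) by rewrite ltr0n.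
have tK x := tnm_bd x K0'.
set e := mean _ _.
have m10 : 0 <= m1 by apply: le_trans hm1; apply: mean_ge0 => x; exact: tnm_ge0.
have -> : \sum_(z <- window K) odd_mass n z = wsum delta n (fun s =>
    (odd (nh s))%:R * \sum_(z <- window K) pm (wlaw s) z).
  rewrite -wsum_sum; apply: eq_wsum => s _; by rewrite mulr_sumr.
apply: (@le_trans _ _ (wsum delta n (fun s => (odd (nh s))%:R +
    -1 * (2 * e + m1 * `|excess s|)))).
  rewrite wsumD (wsumZ delta n (-1)) wsumD (wsumZ delta n m1) wsum_cst.
  have h1 := odd_words_ge delta01 n0; have h2 := excess_norm_le delta01 n u0.
  have h3 : m1 * wsum delta n (fun s => `|excess s|) <=
    m1 * ((excess_cst delta * n%:R / u + u) / 2) by rewrite ler_wpM2l.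
  by lra.
apply: le_wsum => // s sn.
have h : mean (wlaw s) (tnm K%:R) <= 2 * e + m1 * `|excess s|.
  rewrite (mean_wlaw_diff _ tK) (le_trans (diff_mean_tnm_le _ _ _ K0'))//.
  apply: lerD; last by rewrite mulrC ler_wpM2r.
  have mN : (minn (updown s).1 (updown s).2 <= N)%N.
    by rewrite (leq_trans (updown_min s))// sn.
  have := tnm_pow_le (minn (updown s).1 (updown s).2)
    (N - minn (updown s).1 (updown s).2) (symmetrized_symmetric nu) K0'.
  by rewrite subnKC.
have := window_mass (wlaw s) K0.
have : 0 <= mean (wlaw s) (tnm K%:R) by apply: mean_ge0 => x; exact: tnm_ge0.
move: h; set A := _ + _; set B := mean _ _; set C := \sum_(_ <- _) _.
by clearbody A B C; case: odd => /=; rewrite ?mul1r ?mul0r; lra.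
Qed.

End word_laws.

(** * The planar chain dominates the sum over words *)

Section horizontal_walk.
Context {R : realType}.
Variable w : int -> R.

Fixpoint rwre (m : nat) (x : int) : R :=
  if m is m'.+1 then rwre m' (x - 1) * w (x - 1) + rwre m' (x + 1) * (1 - w (x + 1))
  else (x == 0)%:R.

Lemma rwre_parity m x : rwre m x != 0 -> odd m = odd (absz x).
Proof.
elim: m x => [|m IH] x /=; first by case: (x =P 0) => [->|_]; rewrite ?eqxx.
have [h|/IH e _] := eqVneq (rwre m (x - 1)) 0; last by lia.
have [h'|/IH e _] := eqVneq (rwre m (x + 1)) 0; last by lia.
by rewrite h h' !mul0r addr0 eqxx.
Qed.

Hypothesis w01 : forall x, 0 < w x < 1.

Lemma rwre_ge0 m x : 0 <= rwre m x.
Proof.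
elim: m x => [|m IH] x //=.
have /andP[? ?] := w01 (x - 1); have /andP[? ?] := w01 (x + 1).
by rewrite addr_ge0// mulr_ge0// ?subr_ge0; apply/ltW.
Qed.

Variables (delta : R) (nu : probability int R).
Hypothesis delta01 : 0 < delta < 1.

(** Given the word of a trajectory, its horizontal and vertical parts decouple:
    the column parity after [j] horizontal steps is that of [j], whatever the
    columns visited. *)
Lemma wsum_le_chain (p : nat -> int -> int -> R) :
  (forall n x y, 0 <= p n x y <= 1) -> 1 <= p 0%N 0 0 ->
  (forall n x y, delta * w (x - 1) * p n (x - 1) y +
     delta * (1 - w (x + 1)) * p n (x + 1) y +
     (1 - delta) * mean nu (fun z => p n x (y - flip (odd (absz x)) z)) <=
     p n.+1 x y) ->
  forall n x y,
    wsum delta n (fun s => rwre (nh s) x * pm (wlaw nu s) y) <= p n x y.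
Proof.
move=> p01 p0 pS; have /andP[d0 d1] := delta01.
have p0' n x y : 0 <= p n x y by case/andP: (p01 n x y).
have pm1 (mu : probability int R) z : `|pm mu z| <= 1.
  by rewrite pmE; apply: bd_mean => y; exact: bool_bd.
elim=> [|n IH] x y.
  rewrite /= pmE (mean_dirac _ (K := 1)); last by move=> z; exact: bool_bd.
  case: (x =P 0) => [->|_]; last by rewrite mul0r.
  by case: (0 =P y) => [<-|_]; rewrite ?mulr0 ?mulr1.
rewrite wsum_rcons; apply: le_trans (pS n x y).
have nh_rcons s b : nh (rcons s b) = (nh s + b)%N by rewrite /nh -cats1 count_cat /= addn0.
have lT s z : pm (wlaw nu (rcons s true)) z = pm (wlaw nu s) z.
  rewrite !pmE -cats1 (mean_wlaw_cat _ _ _ (K := 1)); last by move=> ?; exact: bool_bd.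
  apply: eq_mean => a /=; rewrite (mean_mirror _ (K := 1)); last by move=> ?; exact: bool_bd.
  rewrite (mean_dirac _ (K := 1)); last by move=> ?; exact: bool_bd.
  by rewrite /flip oppr0; case: odd; rewrite ?oppr0 addr0.
have lF s z : pm (wlaw nu (rcons s false)) z =
    mean nu (fun u => pm (wlaw nu s) (z - flip (odd (nh s)) u)).
  rewrite pmE -cats1 (mean_wlaw_cat _ _ _ (K := 1)); last by move=> ?; exact: bool_bd.
  under eq_mean => a.
    rewrite /= (mean_conv _ _ (K := 1)); last by move=> ?; exact: bool_bd.
    under eq_mean => u.
      rewrite (mean_dirac _ (K := 1)); last by move=> ?; exact: bool_bd.
      rewrite addr0; over.
    over.
  rewrite (meanC _ _ (K := 1)); last by move=> ? ?; exact: bool_bd.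
  apply: eq_mean => u; rewrite pmE; apply: eq_mean => a.
  by rewrite eq_sym -subr_eq eq_sym.
rewrite (eq_wsum _ (G := fun s =>
   delta * w (x - 1) * (rwre (nh s) (x - 1) * pm (wlaw nu s) y) +
   (delta * (1 - w (x + 1)) * (rwre (nh s) (x + 1) * pm (wlaw nu s) y) +
   (1 - delta) * mean nu (fun z =>
      rwre (nh s) x * pm (wlaw nu s) (y - flip (odd (absz x)) z))))); last first.
  move=> s _; rewrite lT lF !nh_rcons addn1 addn0 /= addrA; congr (_ + _); first ring.
  rewrite (imeanZ _ _ (K := 1))//.
  have [->|/rwre_parity ->] := eqVneq (rwre (nh s) x) 0; first by rewrite !mul0r.
  by [].
have /andP[? ?] := w01 (x - 1); have /andP[? ?] := w01 (x + 1).
rewrite wsumD (wsumZ delta n (delta * w (x - 1))) wsumD.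
rewrite (wsumZ delta n (delta * (1 - w (x + 1)))) (wsumZ delta n (1 - delta)) addrA.
have bs s : bmf (fun z => rwre (nh s) x * pm (wlaw nu s) (y - flip (odd (absz x)) z)).
  by apply: bmfZ; exact: (@int_bmf _ _ 1).
have [b <-] := wsum_mean delta nu n bs.
apply: lerD; first apply: lerD.
- by apply: ler_wpM2l => //; rewrite mulr_ge0// ltW.
- by apply: ler_wpM2l => //; rewrite mulr_ge0// ?subr_ge0 ltW.
- apply: ler_wpM2l; first by rewrite subr_ge0 ltW.
  apply: le_mean => //; apply: (@int_bmf _ _ 1) => z.
  by rewrite ger0_norm//; case/andP: (p01 n x (y - flip (odd (absz x)) z)).
Qed.

End horizontal_walk.

(** * Return probabilities inside a valley *)

Section valley.
Context {R : realType}.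
Variables (w : int -> R) (C : int -> R).
Hypothesis w01 : forall x, 0 < w x < 1.
Hypothesis C_gt0 : forall x, 0 < C x.
(* [C x] is the conductance of the edge between [x] and [x + 1]. *)
Hypothesis C_w : forall x, C x * (1 - w x) = C (x - 1) * w x.

Definition rmeas x := C (x - 1) + C x.

Lemma rmeas_gt0 x : 0 < rmeas x.
Proof. by rewrite addr_gt0. Qed.

Lemma rmeas_right x : rmeas x * w x = C x.
Proof. by rewrite /rmeas mulrDl -C_w; ring. Qed.

Lemma rmeas_left x : rmeas x * (1 - w x) = C (x - 1).
Proof. by rewrite mulrBr mulr1 rmeas_right /rmeas addrK. Qed.

Variables l r : nat.

Let N := (l + r)%N.
Let site (i : nat) : int := i%:Z - l%:Z.
Let origin : 'I_N.+1 := inord l.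

Let origin_val : origin = l :> nat.
Proof. by rewrite inordK// ltnS leq_addr. Qed.

(** The transition matrix of the walk killed outside of [-l, r]. *)
Let A : 'M[R]_N.+1 := \matrix_(i, j)
  ((j == i.+1 :> nat)%:R * w (site i) + (i == j.+1 :> nat)%:R * (1 - w (site i))).

Let A_ge0 i j : 0 <= A i j.
Proof.
have /andP[? ?] := w01 (site i).
by rewrite mxE addr_ge0// mulr_ge0// ?subr_ge0 ltW.
Qed.

Let A_sum (i : 'I_N.+1) : \sum_j A i j = 1 - (i == N :> nat)%:R * w (site i)
  - (i == 0 :> nat)%:R * (1 - w (site i)).
Proof.
under eq_bigr do rewrite mxE.
rewrite big_split/= -!mulr_suml.
have -> : \sum_(j < N.+1) (j == i.+1 :> nat)%:R = 1 - (i == N :> nat)%:R :> R.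
  have [iN|iN] := eqVneq (i : nat) N.
    rewrite big1 ?subrr// => j _; rewrite iN; case: eqP => // jN.
    by have := ltn_ord j; rewrite jN ltnn.
  have iN' : (i.+1 < N.+1)%N by rewrite ltnS ltn_neqAle iN -ltnS ltn_ord.
  rewrite (bigD1 (Ordinal iN'))//= eqxx big1 ?addr0 ?subr0// => j.
  by rewrite -val_eqE/= => /negbTE ->.
have -> : \sum_(j < N.+1) (i == j.+1 :> nat)%:R = 1 - (i == 0 :> nat)%:R :> R.
  have [i0|i0] := eqVneq (i : nat) 0%N.
    by rewrite big1 ?subrr// => j _; rewrite i0.
  have i0' : (i.-1 < N.+1)%N by rewrite (leq_ltn_trans (leq_pred i)).
  rewrite (bigD1 (Ordinal i0'))//= prednK ?lt0n// eqxx big1 ?addr0 ?subr0// => j.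
  rewrite -val_eqE/= => ji; case: eqP => // iE; move: ji.
  by rewrite iE eqxx.
by ring.
Qed.

Let Am_ge0 m i j : 0 <= (A ^+ m) i j.
Proof.
elim: m i j => [|m IH] i j; first by rewrite expr0 mxE ler0n.
by rewrite exprS mxE sumr_ge0// => k _; rewrite mulr_ge0.
Qed.

Let A_rev (i j : 'I_N.+1) : rmeas (site i) * A i j = rmeas (site j) * A j i.
Proof.
rewrite !mxE.
have [jE|ji] := eqVneq (j : nat) i.+1.
  have -> : (i == j.+1 :> nat) = false by apply/eqP; lia.
  rewrite mul1r mul0r addr0 mul0r add0r mul1r rmeas_right.
  have -> : site i = site j - 1 by rewrite /site jE; lia.
  by rewrite rmeas_left.
have [iE|ij] := eqVneq (i : nat) j.+1; last by rewrite !mul0r addr0 !mulr0.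
rewrite !mul1r !mul0r addr0 add0r rmeas_right.
have -> : site j = site i - 1 by rewrite /site iE; lia.
by rewrite rmeas_left.
Qed.

(** Detailed balance for [m] steps: it turns the probability to reach an exit from
    the origin into the probability to come back from it, which is at most 1. *)
Let Am_rev m (i j : 'I_N.+1) : rmeas (site i) * (A ^+ m) i j = rmeas (site j) * (A ^+ m) j i.
Proof.
elim: m i j => [|m IH] i j.
  rewrite expr0 !mxE eq_sym; case: eqP => [->//|_]; by rewrite !mulr0.
rewrite [in LHS]exprS [in RHS]exprSr !mxE !mulr_sumr; apply: eq_bigr => k _.
by rewrite mulrA A_rev (mulrC _ (A k i)) -mulrA IH; ring.
Qed.

Let Am_sum m i : \sum_j (A ^+ m) i j <= 1.
Proof.
elim: m i => [|m IH] i.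
  by under eq_bigr do rewrite expr0 mxE; rewrite (bigD1 i)//= eqxx big1 ?addr0// => j;
    rewrite eq_sym => /negbTE ->.
rewrite exprS; under eq_bigr do rewrite mxE.
rewrite exchange_big/=; under eq_bigr do rewrite -mulr_sumr.
apply: (@le_trans _ _ (\sum_k A i k)).
  by apply: ler_sum => k _; rewrite ler_piMr.
have /andP[? ?] := w01 (site i).
by rewrite A_sum; do 2 case: (_ == _); rewrite /=; lra.
Qed.

Let Am_le1 m i j : (A ^+ m) i j <= 1.
Proof.
apply: le_trans (Am_sum m i).
by rewrite (bigD1 j)//= lerDl sumr_ge0.
Qed.

Let sum_eq_le (F : 'I_N.+1 -> R) (c : int) (b : R) (g : 'I_N.+1 -> bool) :
  0 <= b -> (forall i, 0 <= F i) ->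
  (forall i, g i -> site i = c /\ F i <= b) -> \sum_i (g i)%:R * F i <= b.
Proof.
move=> b0 F0 Fb; case: (pickP g) => [i gi|g0]; last first.
  by rewrite big1// => i _; rewrite g0 mul0r.
rewrite (bigD1 i)//= big1 ?addr0; first by rewrite gi mul1r; case: (Fb i gi).
move=> j ji; case gj: (g j); last by rewrite mul0r.
have [e1 _] := Fb i gi; have [e2 _] := Fb j gj.
by move/eqP: ji; case; apply/val_inj => /=; move: e1 e2; rewrite /site; lia.
Qed.

Let Am_le_rwre m (j : 'I_N.+1) : (A ^+ m) origin j <= rwre w m (site j).
Proof.
elim: m j => [|m IH] j.
  rewrite expr0 mxE /=; case: eqP => [<-|]; last by rewrite ler0n.
  by rewrite origin_val /site subrr.
rewrite exprSr mxE /=; under eq_bigr do rewrite [A _ _]mxE mulrDr.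
rewrite big_split/=.
have wg x : 0 <= w x /\ 0 <= 1 - w x.
  by have /andP[? ?] := w01 x; split; rewrite ?subr_ge0 ltW.
apply: lerD.
  under eq_bigr do rewrite mulrCA.
  apply: (@sum_eq_le _ (site j - 1)).
  - by rewrite mulr_ge0 ?rwre_ge0//; case: (wg (site j - 1)).
  - by move=> i; rewrite mulr_ge0//; case: (wg (site i)).
  - move=> i /eqP e; have e' : site i = site j - 1 by rewrite /site e; lia.
    by rewrite -e'; split=> //; rewrite ler_wpM2r//; case: (wg (site i)).
under eq_bigr do rewrite mulrCA.
apply: (@sum_eq_le _ (site j + 1)).
- by rewrite mulr_ge0 ?rwre_ge0//; case: (wg (site j + 1)).
- by move=> i; rewrite mulr_ge0//; case: (wg (site i)).
- move=> i /eqP e; have e' : site i = site j + 1 by rewrite /site e; lia.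
  by rewrite -e'; split=> //; rewrite ler_wpM2r//; case: (wg (site i)).
Qed.

Let site_origin : site origin = 0.
Proof. by rewrite origin_val /site subrr. Qed.

(** The walk cannot leave the valley before a time of the order of the ratio of
    its invariant weight at the origin to the conductance of its exits: at any
    time it is at an exit with at most the invariant probability. *)
Let stay_ge m : 1 - m%:R * (C r%:Z + C (- l%:Z - 1)) / rmeas 0 <=
  \sum_j (A ^+ m) origin j.
Proof.
elim: m => [|m IH].
  rewrite mul0r mul0r subr0 (bigD1 origin)//= expr0 mxE eqxx lerDl sumr_ge0//.
  by move=> j _; rewrite mxE ler0n.
rewrite exprSr; under eq_bigr do rewrite mxE.
rewrite exchange_big/=; under eq_bigr do rewrite -mulr_sumr A_sum mulrBr mulrBr mulr1.
rewrite !sumrB.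
set S := \sum_i _ in IH *.
have p0 := rmeas_gt0 0.
have Aor j : (A ^+ m) origin j <= rmeas (site j) / rmeas 0.
  rewrite ler_pdivlMr// mulrC -site_origin Am_rev ler_piMr// ltW//; exact: rmeas_gt0.
have wg x : 0 <= w x /\ 0 <= 1 - w x.
  by have /andP[? ?] := w01 x; split; rewrite ?subr_ge0 ltW.
have h1 : \sum_(i < N.+1) (A ^+ m) origin i * ((i == N :> nat)%:R * w (site i)) <=
    C r%:Z / rmeas 0.
  under eq_bigr do rewrite mulrCA.
  apply: (@sum_eq_le _ r%:Z).
  - by rewrite divr_ge0// ltW.
  - by move=> i; rewrite mulr_ge0//; case: (wg (site i)).
  - move=> i /eqP e; have e' : site i = r%:Z by rewrite /site e /N; lia.
    split=> //; rewrite -e' -rmeas_right mulrAC ler_wpM2r//.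
    by case: (wg (site i)).
have h2 : \sum_(i < N.+1) (A ^+ m) origin i * ((i == 0 :> nat)%:R * (1 - w (site i)))
    <= C (- l%:Z - 1) / rmeas 0.
  under eq_bigr do rewrite mulrCA.
  apply: (@sum_eq_le _ (- l%:Z)).
  - by rewrite divr_ge0// ltW.
  - by move=> i; rewrite mulr_ge0//; case: (wg (site i)).
  - move=> i /eqP e; have e' : site i = - l%:Z by rewrite /site e; lia.
    split=> //; rewrite -e' -rmeas_left mulrAC ler_wpM2r//.
    by case: (wg (site i)).
rewrite -natr1 (_ : (m%:R + 1) * _ / _ =
  m%:R * (C r%:Z + C (- l%:Z - 1)) / rmeas 0 +
  (C r%:Z / rmeas 0 + C (- l%:Z - 1) / rmeas 0)); last by ring.
by move: IH h1 h2; lra.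
Qed.

Lemma valley_return (G : R) m : 0 < G ->
  (forall x, - l%:Z <= x <= r%:Z -> rmeas x <= G * rmeas 0) ->
  m%:R * (C r%:Z + C (- l%:Z - 1)) <= rmeas 0 / 2 ->
  (4 * G * (l + r).+1%:R)^-1 <= rwre w (m + m) 0.
Proof.
move=> G0 hG hm; have p0 := rmeas_gt0 0.
have := Am_le_rwre (m + m) origin; rewrite site_origin; apply: le_trans.
rewrite exprD mxE.
have S2 : 1 / 2 <= \sum_j (A ^+ m) origin j.
  apply: le_trans (stay_ge m).
  have : m%:R * (C r%:Z + C (- l%:Z - 1)) / rmeas 0 <= 1 / 2.
    by rewrite ler_pdivrMr//; lra.
  lra.
apply: (@le_trans _ _ (G^-1 * \sum_j (A ^+ m) origin j ^+ 2)); last first.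
  rewrite mulr_sumr; apply: ler_sum => j _.
  have e := Am_rev m origin j; rewrite site_origin in e.
  have hj : rmeas (site j) <= G * rmeas 0.
    apply: hG; have := ltn_ord j; rewrite /site /N => jN.
    by apply/andP; split; lia.
  have hab : (A ^+ m) origin j <= (A ^+ m) j origin * G.
    by rewrite -(ler_pM2l p0) e; have := ler_wpM2r (Am_ge0 m j origin) hj; lra.
  by rewrite expr2 mulrCA ler_wpM2l// mulrC ler_pdivrMr.
have := @sum_sqr_ge R _ (enum 'I_N.+1) (fun j => (A ^+ m) origin j).
rewrite -cardE card_ord => /(_ isT); rewrite !big_enum/=.
set S := \sum_(_ < _) _ in S2 *; set T := \sum_(_ < _) _ => h.
rewrite (_ : (4 * G * _)^-1 = G^-1 * ((1 / 2) ^+ 2 / (l + r).+1%:R)); last first.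
  have k0 : (l + r).+1%:R != 0 :> R by rewrite pnatr_eq0.
  by move: _%:R k0 => k k0; field; rewrite (gt_eqF G0) k0.
rewrite ler_wpM2l ?invr_ge0 ?(ltW G0)//; apply: le_trans h.
rewrite ler_wpM2r ?invr_ge0 ?ler0n// lerXn2r ?nnegrE//; last by lra.
Qed.

End valley.

(** * Characteristic functions of laws on the real line *)

Section char_fun.
Context {R : realType}.
Implicit Types mu nu : probability R R.

Lemma cos_lip (a b : R) : `|cos a - cos b| <= `|a - b|.
Proof.
wlog ab : a b / a <= b => [H|].
  by have [/H//|/ltW/H] := leP a b; rewrite distrC (distrC b).
have [|c _ e] := @MVT_segment R cos (fun x => - sin x) a b ab (fun x _ => is_derive_cos x).
  by apply: continuous_subspaceT => x; exact: continuous_cos.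
rewrite distrC e normrM normrN (distrC a) ler_piMl//; exact: sin_max.
Qed.

Definition trunc (h x : R) : R := Num.min 1 (h * `|x|).

Lemma trunc_ge0 h x : 0 <= h -> 0 <= trunc h x.
Proof. by move=> h0; rewrite /trunc le_min ler01 mulr_ge0. Qed.

Lemma trunc_bd h x : 0 <= h -> `|trunc h x| <= 1.
Proof. by move=> h0; rewrite ger0_norm ?trunc_ge0// /trunc ge_min lexx. Qed.

Lemma trunc_cont h : continuous (trunc h).
Proof.
move=> x; apply: (@continuous_min R R^o (fun=> 1) (fun x => h * `|x|)).
  exact: cvg_cst.
by apply: cvgM; [exact: cvg_cst|exact: norm_continuous].
Qed.

Lemma cont_bmf (f : R -> R) K : continuous f -> (forall x, `|f x| <= K) -> bmf f.
Proof. by move=> cf fK; split; [exact: continuous_measurable_fun|exists K]. Qed.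

Lemma trunc_bmf h : 0 <= h -> bmf (trunc h).
Proof.
by move=> h0; apply: (cont_bmf (K := 1)); [exact: trunc_cont|move=> x; exact: trunc_bd].
Qed.

Lemma cos_cont (t : R) : continuous (fun x : R => cos (t * x)).
Proof.
move=> x; apply: (@continuous_comp _ _ _ (fun x => t * x) cos).
  by apply: cvgM; [exact: cvg_cst|exact: cvg_id].
exact: continuous_cos.
Qed.

Lemma sin_cont (t : R) : continuous (fun x : R => sin (t * x)).
Proof.
move=> x; apply: (@continuous_comp _ _ _ (fun x => t * x) sin).
  by apply: cvgM; [exact: cvg_cst|exact: cvg_id].
exact: continuous_sin.
Qed.

Lemma cos_bmf (t : R) : bmf (fun x : R => cos (t * x)).
Proof. by apply: (cont_bmf (K := 1)); [exact: cos_cont|move=> x; exact: cos_max]. Qed.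

Lemma sin_bmf (t : R) : bmf (fun x : R => sin (t * x)).
Proof. by apply: (cont_bmf (K := 1)); [exact: sin_cont|move=> x; exact: sin_max]. Qed.

Lemma trunc_small mu (e : R) : 0 < e -> exists2 h, 0 < h & mean mu (trunc h) <= e.
Proof.
move=> e0.
have h0 n : 0 <= n.+1%:R^-1 :> R by rewrite invr_ge0.
have : (\int[mu]_x (trunc n.+1%:R^-1 x)%:E)%E @[n --> \oo] --> (\int[mu]_x (cst 0 x))%E.
  apply: (@dominated_cvg _ _ _ mu setT measurableT
    (fun n x => (trunc n.+1%:R^-1 x)%:E) (cst 0%E) (cst 1%E)) => //.
  - by move=> n; apply/measurable_EFinP; case: (trunc_bmf (h0 n)).
  - move=> x _; apply/cvg_EFin; first exact: nearW.
    apply: (@squeeze_cvgr _ _ _ _ (fun=> 0) (fun n => n.+1%:R^-1 * `|x|)).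
    + by apply: nearW => n; rewrite trunc_ge0//= /trunc ge_min lexx orbT.
    + exact: cvg_cst.
    + by rewrite -[X in _ --> X](mul0r `|x|); apply: cvgMl; exact: cvg_harmonic.
  - by apply: (@bmf_integrable _ _ _ mu (fun=> 1)); exact: bmf_cst.
  - by move=> n x _; rewrite /= lee_fin trunc_bd.
rewrite integral0 => /fine_cvg /cvgrPdist_le /(_ e e0)[n _ /(_ n (leqnn n))].
rewrite /= sub0r normrN => he; exists n.+1%:R^-1; first by rewrite invr_gt0.
exact: le_trans (ler_norm _) he.
Qed.

Definition chf mu (t : R) := mean mu (fun x => cos (t * x)).

Lemma chf_bd mu t : `|chf mu t| <= 1.
Proof. by apply: mean_norm_le_cst => [|x]; [exact: cos_bmf|exact: cos_max]. Qed.

Lemma chf_lip mu h s t : `|s - t| <= h ->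
  `|chf mu s - chf mu t| <= 2 * mean mu (trunc h).
Proof.
move=> sth; have h0 : 0 <= h by apply: le_trans sth.
rewrite -meanB; [|exact: cos_bmf|exact: cos_bmf].
have bB : bmf (fun x : R => cos (s * x) - cos (t * x)) by apply: bmfB; exact: cos_bmf.
apply: (le_trans (mean_norm_le _ bB)).
rewrite -meanZ; last exact: trunc_bmf.
apply: le_mean => [||x]; [exact: bmf_norm|by apply/bmfZ/trunc_bmf|].
rewrite /trunc minElt; case: ifPn => _.
  rewrite (le_trans (ler_normB _ _))// mulr1 (_ : 2 = 1 + 1); last by ring.
  by apply: lerD; exact: cos_max.
rewrite (le_trans (cos_lip _ _))// -mulrBl normrM.
have : `|s - t| * `|x| <= h * `|x| by rewrite ler_wpM2r.
have : 0 <= h * `|x| by rewrite mulr_ge0.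
by lra.
Qed.

Lemma chf0 mu : chf mu 0 = 1.
Proof.
by rewrite -[RHS](mean_cst mu); apply: eq_mean => x; rewrite mul0r cos0.
Qed.

(** If all the means of [cos (t * x)] are [1] then, almost surely, [cos (x / n)]
    is [1] for all [n > 0], which only happens at the origin. *)
Lemma chf1_degenerate mu : (forall t, 0 <= t -> chf mu t = 1) -> mu [set 0] = 1%E.
Proof.
move=> c1.
have null n : mu.-negligible [set x | cos (n.+1%:R^-1 * x) != 1].
  set t : R := n.+1%:R^-1.
  have t0 : 0 <= t by rewrite invr_ge0.
  pose f (x : R) : R := 1 - cos (t * x).
  have b1 : bmf f by apply: bmfB; [exact: bmf_cst|exact: cos_bmf].
  have m0 : mean mu f = 0.
    rewrite meanB; [|exact: bmf_cst|exact: cos_bmf].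
    by rewrite mean_cst -/(chf mu t) c1// subrr.
  have /ae_eq_integral_abs : measurable_fun [set: R] (EFin \o f).
    by apply/measurable_EFinP; case: b1.
  move=> /(_ mu measurableT)[+ _].
  have -> : (\int[mu]_x `|(EFin \o f) x|)%E = 0%E.
    rewrite -[RHS]/(0%:E) -m0 EFin_mean//; apply: eq_integral => x _ /=.
    by rewrite ger0_norm// subr_ge0 cos_le1.
  move=> /(_ erefl); apply: negligibleS => x /= cx; apply/not_implyP; split => //.
  by apply/eqP; rewrite eqe subr_eq0 eq_sym.
have /negligibleS : mu.-negligible (\bigcup_n [set x | cos (n.+1%:R^-1 * x) != 1]).
  exact: negligible_bigcup.
move=> /(_ (~` [set 0])) H.
have neg0 : mu.-negligible (~` [set 0]).
  apply: H => x /= x0.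
  have px : 0 < pi :> R by exact: pi_gt0.
  have [n hn] : exists n, `|x| / n.+1%:R <= pi.
    exists (Num.truncn (`|x| / pi)).
    rewrite ler_pdivrMr// mulrC -ler_pdivrMr//; apply/ltW.
    by have /andP[] := Num.Theory.truncn_itv (divr_ge0 (normr_ge0 x) (ltW px)).
  exists n => //=; apply/eqP => cx; apply: x0.
  have : cos (`|x| / n.+1%:R) = cos 0.
    rewrite cos0 -[RHS]cx mulrC; have [h|h] := ger0P x; first by [].
    by rewrite mulrN cosN.
  move=> /cos_inj; rewrite !in_itv/= lexx (ltW px) divr_ge0// hn => /(_ isT isT)/eqP.
  by rewrite mulf_eq0 invr_eq0 pnatr_eq0 orbF normr_eq0 => /eqP.
have h : mu (~` [set 0]) = 0%E by apply/negligibleP => //; exact: measurableC.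
have := probability_setC mu (measurableC (measurable_set1 (0 : R))).
by rewrite setCK h sube0.
Qed.

Lemma cvg_weakly_mean (mu_ : nat -> probability R R) mu (f : R -> R) K :
  cvg_weakly mu_ mu -> continuous f -> (forall x, `|f x| <= K) ->
  mean (mu_ n) f @[n --> \oo] --> mean mu f.
Proof.
move=> cm cf fK; have bf := cont_bmf cf fK.
have := cm f cf (ex_intro _ K fK).
by rewrite -(EFin_mean mu bf) => /fine_cvg.
Qed.

End char_fun.

(** * Growth of the norming constants *)

Lemma mean_eq_law d1 d2 (T1 : measurableType d1) (T2 : measurableType d2)
    (R : realType) (P1 : probability T1 R) (P2 : probability T2 R)
    (X1 : T1 -> R) (X2 : T2 -> R) (f : R -> R) :
  measurable_fun [set: T1] X1 -> measurable_fun [set: T2] X2 ->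
  (forall B, measurable B -> P1 (X1 @^-1` B) = P2 (X2 @^-1` B)) -> bmf f ->
  mean P1 (fun x => f (X1 x)) = mean P2 (fun x => f (X2 x)).
Proof.
move=> m1 m2 e bf.
pose Y1 : {RV P1 >-> R} := mfun_Sub (mem_set m1 : X1 \in mfun).
pose Y2 : {RV P2 >-> R} := mfun_Sub (mem_set m2 : X2 \in mfun).
rewrite -(mean_distribution Y1 bf) -(mean_distribution Y2 bf).
by rewrite /mean /Rintegral; congr fine; apply: eq_measure_integral => B mB _; exact: e.
Qed.

Section symmetric_cos.
Context {R : realType}.
Variable T : probability int R.
Hypothesis symT : symmetric T.

Lemma mean_sin_symmetric n (u : R) :
  mean (convolution_pow T n) (fun z => sin (u * z%:~R)) = 0.
Proof.
have b z : `|sin (u * z%:~R)| <= 1 :> R by exact: sin_max.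
have := pow_symmetric n symT b.
under eq_mean do rewrite rmorphN/= mulrN sinN -mulN1r.
by rewrite (imeanZ _ _ b) mulN1r => h; lra.
Qed.

Lemma mean_cos_double n (u : R) :
  mean (convolution_pow T (n + n)) (fun z => cos (u * z%:~R)) =
  mean (convolution_pow T n) (fun z => cos (u * z%:~R)) ^+ 2.
Proof.
rewrite (mean_powD _ _ _ (K := 1)); last by move=> z; exact: cos_max.
set m := mean _ (fun z => cos (u * z%:~R)).
transitivity (mean (convolution_pow T n) (fun x => m * cos (u * x%:~R))).
  apply: eq_mean => x.
  transitivity (mean (convolution_pow T n) (fun y =>
      cos (u * x%:~R) * cos (u * y%:~R) - sin (u * x%:~R) * sin (u * y%:~R))).
    by apply: eq_mean => y; rewrite rmorphD/= mulrDr cosD.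
  rewrite meanB.
  - rewrite (imeanZ _ _ (K := 1)); last by move=> y; exact: cos_max.
    rewrite (imeanZ _ _ (K := 1)); last by move=> y; exact: sin_max.
    by rewrite mean_sin_symmetric mulr0 subr0 mulrC.
  - by apply/bmfZ/(@int_bmf _ _ 1) => y; exact: cos_max.
  - by apply/bmfZ/(@int_bmf _ _ 1) => y; exact: sin_max.
by rewrite (imeanZ _ _ (K := 1)) ?expr2// => y; exact: cos_max.
Qed.

End symmetric_cos.

Section growth.
Context {R : realType}.
Variables (T : probability int R) (A : nat -> R) (beta : R) (mu : probability R R).
Hypothesis symT : symmetric T.
Hypothesis A_gt0 : forall n, 0 < A n.
Hypothesis beta_gt1 : 1 < beta.
Hypothesis mu_stable : stable_law beta mu.

Let mu_ n := rescale (A n) (convolution_pow T n).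

Hypothesis cvg_mu : cvg_weakly mu_ mu.

Lemma mean_rescale (a : R) (P : probability int R) (f : R -> R) :
  bmf f -> mean (rescale a P) f = mean P (fun z => f (z%:~R / a)).
Proof. by move=> bf; rewrite mean_distribution. Qed.

Let chf_double n t : chf (mu_ (n + n)) t = chf (mu_ n) (t * (A n / A (n + n))) ^+ 2.
Proof.
rewrite /chf !mean_rescale; [|exact: cos_bmf|exact: cos_bmf].
transitivity (mean (convolution_pow T (n + n)) (fun z => cos (t / A (n + n) * z%:~R))).
  by apply: eq_mean => z; congr cos; ring.
rewrite mean_cos_double//; congr (_ ^+ 2); apply: eq_mean => z; congr cos.
by field; rewrite !gt_eqF.
Qed.

Let chf_cvg t : chf (mu_ n) t @[n --> \oo] --> chf mu t.
Proof.
apply: (cvg_weakly_mean (K := 1) cvg_mu); first exact: cos_cont.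
by move=> x; exact: cos_max.
Qed.

Let mean_sin_mu t : mean mu (fun x => sin (t * x)) = 0.
Proof.
have := cvg_weakly_mean (K := 1) cvg_mu (@sin_cont _ t) (fun x => sin_max _).
have -> : (fun n => mean (mu_ n) (fun x => sin (t * x))) = (fun=> 0).
  apply/funext => n; rewrite mean_rescale; last exact: sin_bmf.
  rewrite -[RHS](mean_sin_symmetric symT n (t / A n)).
  by apply: eq_mean => z; congr sin; ring.
by move=> /(cvg_unique (@norm_hausdorff _ R^o) (cvg_cst (0 : R^o))) <-.
Qed.

Let c : R := 2 `^ beta^-1.

Let c_lt2 : c < 2.
Proof.
have e2 : 2 = expR (ln 2) :> R by rewrite lnK// posrE.
rewrite [X in _ < X]e2 /c /powR pnatr_eq0/= ltr_expR gtr_pMl ?ln_gt0 ?ltr1n//.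
by rewrite invf_lt1// (lt_trans ltr01).
Qed.

Let c_sqr : 2 <= c ^+ 2.
Proof.
have [/andP[b0 b2] _ _] := mu_stable.
rewrite -powR_mulrn ?powR_ge0// /c -powRrM.
rewrite -[X in X <= _](powRr1 (ler0n _ 2)).
by apply: ler_powR; rewrite ?ler1n// mulrC ler_pdivlMr// mul1r.
Qed.

Let c_gt0 : 0 < c.
Proof. by rewrite powR_gt0. Qed.

Let c_gt1 : 1 < c.
Proof.
rewrite ltNge; apply/negP => c1; have := c_sqr.
by rewrite leNgt (le_lt_trans (exprn_ile1 2 (ltW c_gt0) c1)) ?ltr1n.
Qed.

(** The possible centering [d] of the stable law only contributes a phase, which
    disappears from the modulus because the law is symmetric. *)
Let chf_stable t : chf mu (c * t) ^+ 2 = chf mu t ^+ 4.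
Proof.
have [_ _ /(_ 1 1 ltr01 ltr01)[d stab]] := mu_stable.
have mX1 : measurable_fun [set: R * R] (fun p : R * R => 1 * p.1 + 1 * p.2).
  apply: measurable_funD; apply: measurable_funM => //; exact: measurable_cst.
have mX2 : measurable_fun [set: R] (fun x : R => c * x + d).
  apply: measurable_funD; last exact: measurable_cst.
  by apply: measurable_funM => //; exact: measurable_cst.
have law B : measurable B ->
    (mu \x mu)%E ((fun p : R * R => 1 * p.1 + 1 * p.2) @^-1` B) =
    mu ((fun x : R => c * x + d) @^-1` B).
  by move=> mB; have := stab B mB; rewrite powR1 (_ : 1 + 1 = 2).
have L f : bmf f -> mean (mu \x mu)%E (fun p => f (1 * p.1 + 1 * p.2)) =
    mean mu (fun x => f (c * x + d)).
  by move=> bf; exact: (@mean_eq_law _ _ _ _ _ (mu \x mu)%E mu _ _ _ mX1 mX2 law bf).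
have bp (f : R -> R) : bmf f -> bmf (fun p : R * R => f (1 * p.1 + 1 * p.2)).
  by exact: bmf_comp.
have m0 f g a b : bmf f -> bmf g ->
    mean mu (fun x => a * f x - b * g x) = a * mean mu f - b * mean mu g.
  by move=> bf bg; rewrite meanB ?meanZ//; exact: bmfZ.
have m1 f g a b : bmf f -> bmf g ->
    mean mu (fun x => a * f x + b * g x) = a * mean mu f + b * mean mu g.
  by move=> bf bg; rewrite meanD ?meanZ//; exact: bmfZ.
have bc := @cos_bmf R; have bs := @sin_bmf R.
have eC : chf mu t ^+ 2 = cos (t * d) * chf mu (c * t).
  have := L _ (bc t); rewrite (mean_prod12 _ _ (bp _ (bc t))) /=.
  have -> : mean mu (fun x => mean mu (fun y => cos (t * (1 * x + 1 * y)))) =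
      chf mu t ^+ 2.
    transitivity (mean mu (fun x => chf mu t * cos (t * x) - 0 * sin (t * x))).
      apply: eq_mean => x; rewrite mul0r subr0.
      transitivity (mean mu (fun y => cos (t * x) * cos (t * y) - sin (t * x) * sin (t * y))).
        by apply: eq_mean => y; rewrite !mul1r mulrDr cosD.
      by rewrite m0// mean_sin_mu mulr0 subr0 mulrC.
    by rewrite m0// mul0r subr0 expr2.
  move=> ->; transitivity (mean mu (fun x =>
      cos (t * d) * cos (c * t * x) - sin (t * d) * sin (c * t * x))).
    apply: eq_mean => x; rewrite mulrDr cosD (_ : t * (c * x) = c * t * x); last by ring.
    by rewrite mulrC [X in _ - X]mulrC.
  by rewrite m0// mean_sin_mu mulr0 subr0.
have eS : 0 = sin (t * d) * chf mu (c * t).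
  have := L _ (bs t); rewrite (mean_prod12 _ _ (bp _ (bs t))) /=.
  have -> : mean mu (fun x => mean mu (fun y => sin (t * (1 * x + 1 * y)))) = 0.
    transitivity (mean mu (fun x => chf mu t * sin (t * x) + 0 * sin (t * x))).
      apply: eq_mean => x; rewrite mul0r addr0.
      transitivity (mean mu (fun y => sin (t * x) * cos (t * y) + cos (t * x) * sin (t * y))).
        by apply: eq_mean => y; rewrite !mul1r mulrDr sinD.
      by rewrite m1// mean_sin_mu mulr0 addr0 mulrC.
    by rewrite m1// mean_sin_mu !mulr0 addr0.
  move=> ->; transitivity (mean mu (fun x =>
      sin (t * d) * cos (c * t * x) + cos (t * d) * sin (c * t * x))).
    apply: eq_mean => x; rewrite mulrDr sinD (_ : t * (c * x) = c * t * x); last by ring.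
    by rewrite addrC mulrC [X in _ + X]mulrC.
  by rewrite m1// mean_sin_mu mulr0 addr0.
rewrite -[4%N]/(2 * 2)%N exprM eC -[LHS]mul1r -(cos2Dsin2 (t * d)) mulrDl -!exprMn.
by rewrite -eS expr0n addr0.
Qed.

Let chf_ge0 t : 0 <= chf mu t.
Proof.
apply/ler_addgt0Pr => e e0.
have /cvgrPdist_le /(_ e e0)[N _ /(_ (N + N)%N (leq_addr _ _))] := @chf_cvg t.
rewrite chf_double ler_norml => /andP[+ _].
have := sqr_ge0 (chf (mu_ N) (t * (A N / A (N + N)))).
by lra.
Qed.

Let chf_stable1 t : chf mu (c * t) = chf mu t ^+ 2.
Proof.
apply/eqP; rewrite -(@eqrXn2 _ 2) ?sqr_ge0//; apply/eqP.
by rewrite chf_stable -exprM.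
Qed.

Let chf_unif (L e : R) : 0 < e ->
  \forall n \near \oo, forall s, 0 <= s <= L -> `|chf (mu_ n) s - chf mu s| <= e.
Proof.
move=> e0; have e16 : 0 < e / 16 by rewrite divr_gt0.
have [h h0 hm] := trunc_small mu e16.
have near1 : \forall n \near \oo, mean (mu_ n) (trunc h) <= e / 8.
  have := cvg_weakly_mean (K := 1) cvg_mu (@trunc_cont _ h) (fun x => trunc_bd x (ltW h0)).
  move=> /cvgrPdist_le /(_ _ e16); apply: filterS => n.
  by rewrite ler_norml => /andP[+ _]; lra.
have near2 N : \forall n \near \oo, forall k, (k <= N)%N ->
    `|chf (mu_ n) (k%:R * h) - chf mu (k%:R * h)| <= e / 4.
  have e4 : 0 < e / 4 by rewrite divr_gt0.
  have ptw k : \forall n \near \oo, `|chf (mu_ n) (k%:R * h) - chf mu (k%:R * h)| <= e / 4.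
    have /cvgrPdist_le /(_ _ e4) := @chf_cvg (k%:R * h).
    by apply: filterS => n; rewrite distrC.
  elim: N => [|N IH].
    by apply: filterS (ptw 0%N) => n hn k; rewrite leqn0 => /eqP ->.
  apply: filterS2 IH (ptw N.+1) => n h1 h2 k; rewrite leq_eqVlt => /predU1P[->//|].
  exact: h1.
apply: filterS2 near1 (near2 (Num.truncn (L / h))) => n h1 h2 s /andP[s0 sL].
have sh0 : 0 <= s / h by rewrite divr_ge0// ltW.
have /andP[k1 k2] := Num.Theory.truncn_itv sh0.
set k := Num.truncn (s / h) in k1 k2.
have kN : (k <= Num.truncn (L / h))%N.
  by apply: Num.Theory.le_truncn; rewrite ler_pM2r ?invr_gt0.
have sk : `|s - k%:R * h| <= h.
  move: k1 k2; rewrite ler_pdivlMr// ltr_pdivrMr// -natr1 mulrDl mul1r => k1 k2.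
  by rewrite ler_norml; apply/andP; split; lra.
have := chf_lip (mu_ n) sk; have := chf_lip mu sk; have := h2 k kN.
set a := chf (mu_ n) s; set b := chf (mu_ n) (k%:R * h); set a' := chf mu s.
set b' := chf mu (k%:R * h); rewrite distrC => H1 H2 H3.
rewrite (_ : a - a' = (a - b) - (b' - b) - (a' - b')); last by ring.
rewrite (le_trans (ler_normB _ _))//.
have := ler_normB (a - b) (b' - b); have := normr_ge0 (a - b).
by lra.
Qed.

(** Were [A (2 n) > c' A n] for infinitely many [n], with [c < c'], then the
    characteristic function [phi] of the limit would satisfy, up to any error,
    [phi t = phi s ^ 2 = phi (c s)] for some [s <= t / c']. As [c s] is smaller
    than [t] by a fixed factor, iterating would bring it to [phi 0 = 1], so that
    the limit would be degenerate. *)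
Lemma norming_doubling (c' : R) : c < c' ->
  \forall n \near \oo, A (n + n)%N <= c' * A n.
Proof.
move=> cc'; have c'0 : 0 < c' by exact: lt_trans cc'.
apply: contrapT => nev.
have freq (P : set nat) : (\forall n \near \oo, P n) ->
    exists2 n, P n & A n / A (n + n)%N <= c'^-1.
  move=> nP; apply: contrapT => nex; apply: nev; apply: filterS nP => n Pn.
  apply/ltW; rewrite ltNge; apply/negP => h; apply: nex; exists n => //.
  by rewrite ler_pdivrMr// ler_pdivlMl.
pose q := c / c'.
have q0 : 0 < q by rewrite divr_gt0.
have q1 : q < 1 by rewrite ltr_pdivrMr// mul1r.
have step e L : (forall t, 0 <= t <= q * L -> 1 - chf mu t <= e) ->
    forall t, 0 <= t <= L -> 1 - chf mu t <= e.
  move=> He t /andP[t0 tL]; apply/ler_addgt0Pr => x x0.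
  have x4 : 0 < x / 4 by rewrite divr_gt0.
  have cv2 : \forall n \near \oo, `|chf (mu_ (n + n)%N) t - chf mu t| <= x / 4.
    have [N _ NP] := chf_unif L x4.
    exists N => // n /= Nn; apply: NP; first by rewrite /= (leq_trans Nn)// leq_addr.
    by rewrite t0.
  have [n [h1 h2] hq] := freq _ (filterI (chf_unif L x4) cv2).
  set s := t * (A n / A (n + n)%N) in h2.
  have s0 : 0 <= s by rewrite mulr_ge0// divr_ge0// ltW.
  have sL' : s <= t / c' by rewrite ler_wpM2l.
  have sL : s <= L.
    rewrite (le_trans sL')// (le_trans _ tL)// ler_pdivrMr// ler_peMr// ltW//.
    exact: lt_trans cc'.
  have := h1 s; rewrite s0 sL => /(_ isT) hs.
  have := He (c * s); rewrite mulr_ge0 ?(ltW c_gt0)//=.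
  have -> : c * s <= q * L.
    rewrite /q -mulrA ler_wpM2l ?(ltW c_gt0)// (le_trans sL')//.
    by rewrite mulrC ler_wpM2l// invr_ge0 ltW.
  move=> /(_ isT); rewrite chf_stable1.
  move: h2; rewrite chf_double -/s.
  have := chf_bd (mu_ n) s; have := chf_bd mu s; move: hs.
  set a := chf (mu_ n) s; set b := chf mu s; set f := chf mu t.
  move=> hab b1 a1 hf hb.
  have : `|b ^+ 2 - a ^+ 2| <= x / 4 * 2.
    rewrite subr_sqr normrM ler_pM// 1?distrC//.
    by rewrite (le_trans (ler_normD _ _))//; lra.
  move: hf; rewrite !ler_norml => /andP[u1 u2] /andP[u3 u4].
  by lra.
have one t : 0 <= t -> chf mu t = 1.
  move=> t0; apply/eqP; rewrite eq_le; apply/andP; split.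
    exact: le_trans (ler_norm _) (chf_bd mu t).
  rewrite -subr_le0; apply/ler_addgt0Pr => e e0; rewrite add0r.
  have e2 : 0 < e / 2 by rewrite divr_gt0.
  have [h h0 hm] := trunc_small mu e2.
  have base s : 0 <= s <= h -> 1 - chf mu s <= e.
    move=> /andP[s0 sh]; have := @chf_lip _ mu h 0 s.
    rewrite sub0r normrN ger0_norm// chf0 => /(_ sh).
    by rewrite ler_norml => /andP[_]; lra.
  have iter k : forall s, 0 <= s <= h / q ^+ k -> 1 - chf mu s <= e.
    elim: k => [|k IH]; first by rewrite expr0 divr1.
    apply: step; rewrite (_ : q * _ = h / q ^+ k)//.
    by rewrite exprS; field; rewrite expf_neq0 gt_eqF.
  have cq : (t * q ^+ k) @[k --> \oo] --> (t * 0 : R).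
    by apply: cvgMr; apply: cvg_expr; rewrite ger0_norm// ltW.
  move: cq; rewrite mulr0 => /cvgrPdist_le /(_ h h0)[k _ /(_ k (leqnn k))].
  rewrite sub0r normrN => hk; apply: (iter k); rewrite t0/=.
  rewrite ler_pdivlMr ?exprn_gt0//; exact: le_trans (ler_norm _) hk.
have [_ + _] := mu_stable; apply; exists 0; exact: chf1_degenerate.
Qed.

(** At time [n = 2 ^ k] the sums are of order [c' ^ k] at most, a power of [n] with
    an exponent in [1/2, 1). *)
Lemma sums_small : exists2 c' : R, [/\ 1 < c', c' < 2 & 2 <= c' ^+ 2] &
  forall e, 0 < e -> exists2 D, 0 < D & exists k0, forall k (K : R), (k0 <= k)%N ->
    D * c' ^+ k <= K -> mean (convolution_pow T (2 ^ k)) (tnm K) <= e.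
Proof.
pose c' := (c + 2) / 2.
have cc' : c < c' by have := c_lt2; rewrite /c'; move: (c) => x; lra.
have c'2 : 2 <= c' ^+ 2.
  by rewrite (le_trans c_sqr)// lerXn2r ?nnegrE ?ltW// (lt_trans c_gt0).
have c'1 : 1 < c'.
  exact: lt_trans cc'.
have c'0 : 0 < c' by exact: lt_trans c'1.
exists c'; first by split => //; have := c_lt2; rewrite /c'; move: (c) => x; lra.
move=> e e0; have e2 : 0 < e / 2 by rewrite divr_gt0.
have [N1 _ N1P] := norming_doubling cc'.
have [h h0 hm] := trunc_small mu e2.
have [N2 _ N2P] : \forall n \near \oo, mean (mu_ n) (trunc h) <= e.
  have := cvg_weakly_mean (K := 1) cvg_mu (@trunc_cont _ h) (fun x => trunc_bd x (ltW h0)).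
  move=> /cvgrPdist_le /(_ _ e2); apply: filterS => n.
  by rewrite ler_norml => /andP[+ _]; lra.
have A2 j : A (2 ^ (N1 + j)) <= c' ^+ j * A (2 ^ N1).
  elim: j => [|j IH]; first by rewrite addn0 mul1r.
  rewrite addnS expnS mul2n -addnn (le_trans (N1P _ _))//=.
    by rewrite (leq_trans _ (ltnW (ltn_expl _ _)))// leq_addr.
  by rewrite exprS -mulrA ler_pM2l.
exists (A (2 ^ N1) / h); first by rewrite divr_gt0.
exists (N1 + N2)%N => k K kN hK.
have K0 : 0 < K.
  by apply: lt_le_trans hK; rewrite mulr_gt0 ?exprn_gt0// divr_gt0.
have : mean (mu_ (2 ^ k)) (trunc h) <= e.
  apply: N2P => /=; rewrite (leq_trans _ (ltnW (ltn_expl _ _)))//.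
  by rewrite (leq_trans _ kN)// leq_addl.
rewrite mean_rescale; last by exact/trunc_bmf/ltW.
apply: le_trans; apply: (@le_imean _ _ _ _ 1) => [z|z|z]; first exact: tnm_bd.
  by apply/trunc_bd/ltW.
rewrite /tnm /trunc normrM normfV (gtr0_norm (A_gt0 _)).
have : `|z%:~R| / K <= h * (`|z%:~R| / A (2 ^ k)) :> R.
  rewrite mulrCA ler_wpM2l// -(invrK h) -invfM lef_pV2 ?posrE ?mulr_gt0 ?invr_gt0//.
  apply: le_trans hK; rewrite mulrC mulrAC ler_pM2r ?invr_gt0//.
  have kE : k = (N1 + (k - N1))%N by rewrite subnKC// (leq_trans _ kN)// leq_addr.
  rewrite {1}kE (le_trans (A2 _))// mulrC ler_pM2l//.
  by rewrite ler_weXn2l ?(ltW c'1)// leq_subr.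
by move=> hle; rewrite le_min !ge_min lexx/= hle orbT.
Qed.

End growth.

(** * Independence from a block of the environment *)

Section independence.
Context d (Omega : measurableType d) (R : realType) (P : probability Omega R).
Variable omega : int -> {RV P >-> R}.

(** A pi-system, so that independence extends from it to the sigma-algebra that it
    generates. *)
Definition cylinders (J : set int) : set (set Omega) :=
  [set E | exists (F : {fset int}) (B : int -> set R),
    [/\ forall i, i \in F -> J i, forall i, measurable (B i) &
        E = \bigcap_(i in [set` F]) (omega i @^-1` B i)]].

(** A type of its own, so that the closure properties of [bmf] apply to the bounded
    functions that depend only on the environment in [J]. *)
Definition block (J : set int) := g_sigma_algebraType (cylinders J).

Lemma cylinders_setI J : setI_closed (cylinders J).
Proof.
move=> _ _ [F [B [FJ mB ->]]] [G [C [GJ mC ->]]].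
exists (F `|` G)%fset.
exists (fun i => (if i \in F then B i else setT) `&` (if i \in G then C i else setT)).
split.
- by move=> i; rewrite inE => /orP[/FJ|/GJ].
- by move=> i; apply: measurableI; case: ifP.
- apply/seteqP; split => [t [h1 h2] i /=|t h].
    rewrite inE => _; split; case: ifP => // iF; [exact: h1|exact: h2].
  by split=> i /= iF; have := h i; rewrite /= inE iF ?orbT => /(_ isT)[].
Qed.

Lemma measurable_preimage (i : int) (B : set R) :
  measurable B -> measurable (omega i @^-1` B).
Proof. by move=> mB; exact: measurable_funPTI. Qed.

Lemma cylinders_measurable J : cylinders J `<=` measurable.
Proof.
move=> _ [F [B [_ mB ->]]]; apply: fin_bigcap_measurable.
  exact: finite_fset.
by move=> i _; exact: measurable_preimage.
Qed.

Lemma block_measurable J (A : set Omega) :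
  measurable (A : set (block J)) -> measurable A.
Proof.
move: A; apply: smallest_sub; last exact: cylinders_measurable.
exact: sigma_algebra_measurable.
Qed.

Lemma block_sub (J J' : set int) : J `<=` J' -> forall A : set Omega,
  measurable (A : set (block J)) -> measurable (A : set (block J')).
Proof.
move=> JJ'; apply: smallest_sub; first exact: smallest_sigma_algebra.
move=> A [F [B [FJ mB AE]]]; apply: sub_sigma_algebra.
by exists F, B; split => // i /FJ /JJ'.
Qed.

Lemma block_bmf J (f : Omega -> R) : @bmf _ (block J) R f -> bmf f.
Proof.
move=> [mf bf]; split => // _ B mB; apply: block_measurable.
exact: (mf measurableT B mB).
Qed.

Lemma block_bmf_sub (J J' : set int) (f : Omega -> R) : J `<=` J' ->
  @bmf _ (block J) R f -> @bmf _ (block J') R f.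
Proof.
move=> JJ' [mf bf]; split => // _ B mB; apply: (block_sub JJ').
exact: (mf measurableT B mB).
Qed.

Lemma block_coord J i (g : R -> R) : J i -> bmf g ->
  @bmf _ (block J) R (fun t => g (omega i t)).
Proof.
move=> Ji bg; apply: (@bmf_comp _ _ (block J) _ R (omega i)) => // _ B mB.
rewrite setTI; apply: sub_sigma_algebra; exists [fset i]%fset, (fun=> B); split => //.
  by move=> j; rewrite inE => /eqP ->.
apply/seteqP; split => [t h j /=|t h]; last by apply: (h i); rewrite /= inE.
by rewrite inE => /eqP ->.
Qed.

Hypothesis omega_indep : mutually_independent omega.

Lemma block_indep_set (J : set int) i (A : set Omega) (B : set R) :
  ~ J i -> measurable (A : set (block J)) -> measurable B ->
  P (A `&` omega i @^-1` B) = (P A * P (omega i @^-1` B))%E.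
Proof.
move=> Ji mA mB; set E := omega i @^-1` B.
have mE : measurable E by exact: measurable_preimage.
pose H := [set A : set Omega | measurable A /\ P (A `&` E) = (P A * P E)%E].
suff : <<s cylinders J >> `<=` H by move=> /(_ A mA)[].
apply: lambda_system_subset => //; first exact: cylinders_setI.
  apply/dynkin_lambda_system; split.
  - by split => //; rewrite setTI probability_setT mul1e.
  - move=> C [mC e]; split; first exact: measurableC.
    have eD : P (E `\` C) = (P E - P (E `&` C))%E.
      by rewrite measureD// ltey_eq fin_num_measure.
    have eC : P (~` C) = (1 - P C)%E by rewrite probability_setC.
    have [a ea] : exists a, P C = a%:E.
      by exists (fine (P C)); rewrite fineK// fin_num_measure.
    have [b eb] : exists b, P E = b%:E.
      by exists (fine (P E)); rewrite fineK// fin_num_measure.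
    rewrite setIC -setDE eD [E `&` C]setIC e eC ea eb.
    by rewrite -EFinM -!EFinB -EFinM; congr (_%:E); ring.
  - move=> F tF HF; have mF n : measurable (F n) by case: (HF n).
    split; first exact: bigcup_measurable.
    rewrite setI_bigcupl measure_bigcup//; first last.
    + by apply: trivIset_setIr.
    + by move=> n _; apply: measurableI.
    rewrite (@measure_bigcup _ _ _ P)//.
    have [b eb] : exists b, P E = b%:E.
      by exists (fine (P E)); rewrite fineK// fin_num_measure.
    rewrite eb muleC -nneseriesZl//.
    by apply: eq_eseriesr => n _; rewrite muleC -eb; case: (HF n).
move=> C [F [B' [FJ mB' CE]]]; split; first by apply: (@cylinders_measurable J); exists F, B'.
pose D j := if j == i then B else B' j.
have iF : i \notin F by apply/negP => /FJ.
have mD j : measurable (D j) by rewrite /D; case: ifP.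
have FD : C = \bigcap_(j in [set` F]) (omega j @^-1` D j).
  rewrite CE; apply: eq_bigcapr => j /= jF; rewrite /D ifF//.
  by apply: contraNF iF => /eqP <-.
rewrite {2}FD (omega_indep F mD).
have -> : C `&` E = \bigcap_(j in [set` (i |` F)%fset]) (omega j @^-1` D j).
  rewrite FD; apply/seteqP; split => [t [h1 h2] j /=|t h].
    rewrite !inE => /orP[/eqP ->|jF]; last exact: h1.
    by rewrite /D eqxx.
  split=> [j /= jF|]; first by apply: h; rewrite /= !inE jF orbT.
  by have := h i; rewrite /= !inE eqxx /D eqxx; exact.
rewrite (omega_indep (i |` F)%fset mD) big_fsetU1//= muleC.
by rewrite /D eqxx.
Qed.

(** A function of the block and a function of a coordinate out of the block have
    the product of their laws as joint law. *)
Lemma block_mean_indep (J : set int) i (f : Omega -> R) (g : R -> R) :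
  ~ J i -> @bmf _ (block J) R f -> bmf g ->
  mean P (fun t => f t * g (omega i t)) = mean P f * mean P (fun t => g (omega i t)).
Proof.
move=> Ji bf bg; have [mf' [K fK]] := bf; have [mf _] := block_bmf bf.
pose clip (x : R) := Num.max (- K) (Num.min K x).
have bclip : bmf clip.
  split; first by apply: measurable_maxr => //; apply: measurable_minr.
  exists `|K| => x; rewrite ler_norml /clip le_max lerN2 ler_norm/=.
  by rewrite ge_max ge_min ler_norm andbT -normrN ler_norm.
have clipf t : clip (f t) = f t.
  have := fK t; rewrite ler_norml => /andP[h1 h2].
  by rewrite /clip min_r// max_r.
pose F : {RV P >-> R} := mfun_Sub (mem_set mf : f \in mfun).
have mZ : measurable_fun [set: Omega] (fun t => (f t, omega i t)).
  exact: measurable_fun_pair.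
pose Z : {RV P >-> (R * R)%type} := mfun_Sub (mem_set mZ : _ \in mfun).
pose PF : probability R R := distribution P F.
pose Pi : probability R R := distribution P (omega i).
have law X : measurable X -> (PF \x Pi)%E X = distribution P Z X.
  apply: product_measure_unique => A B mA mB.
  transitivity (P (f @^-1` A `&` omega i @^-1` B)); first by [].
  rewrite (@block_indep_set J)//.
  by have := mf' measurableT A mA; rewrite setTI.
have bcg : bmf (fun p : R * R => clip p.1 * g p.2).
  by apply: bmfM; apply: bmf_comp.
have e1 : mean P (fun t => f t * g (omega i t)) =
    mean (distribution P Z) (fun p => clip p.1 * g p.2).
  by rewrite mean_distribution//; apply: eq_mean => t /=; rewrite clipf.
have e2 : mean (distribution P Z) (fun p => clip p.1 * g p.2) =
    mean (PF \x Pi)%E (fun p => clip p.1 * g p.2).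
  by rewrite /mean /Rintegral; congr fine; apply: eq_measure_integral => X mX _; exact/esym/law.
rewrite e1 e2 (mean_prod12 _ _ bcg) /=.
under eq_mean do rewrite meanZ//.
under eq_mean do rewrite mulrC.
rewrite meanZ// mulrC /PF /Pi !mean_distribution//.
by congr (_ * _); apply: eq_mean => t; exact: clipf.
Qed.

End independence.

(** * A gambler's ruin estimate *)

Section stopped_walk.
Context {R : realType}.
Implicit Types (y : nat -> R) (a b : R).

Definition inside a b (x : R) : R := (- a < x < b)%R%:R.

(** The walk with steps [y], frozen once it has left the interval (-a, b): freezing
    it makes its exit time superfluous, as it is inside at time [m] exactly when it
    has always been. *)
Fixpoint stopped a b y (m : nat) : R :=
  if m is m'.+1 then stopped a b y m' + inside a b (stopped a b y m') * y m' else 0.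

Definition psum y (n : nat) : R := \sum_(i < n) y i.

Lemma psumS y n : psum y n.+1 = psum y n + y n.
Proof. by rewrite /psum big_ord_recr. Qed.

Lemma psum_cat y m n : psum y (m + n) = psum y m + psum (fun i => y (m + i)%N) n.
Proof.
elim: n => [|n IH]; first by rewrite addn0 [X in _ + X]/psum big_ord0 addr0.
by rewrite addnS !psumS IH addrA.
Qed.

Lemma psum_norm_le y K n : (forall i, `|y i| <= K) -> `|psum y n| <= n%:R * K.
Proof.
move=> yK; elim: n => [|n IH]; first by rewrite /psum big_ord0 normr0 mul0r.
rewrite psumS (le_trans (ler_normD _ _))// -natr1 mulrDl mul1r.
exact: lerD.
Qed.

Lemma stopped_up a b y m : 0 < a -> 0 < b -> b <= stopped a b y m ->
  exists i, [/\ (i <= m)%N, b <= psum y i & forall j, (j <= i)%N -> - a <= psum y j].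
Proof.
move=> a0 b0.
suff [_] : (- a < stopped a b y m < b -> stopped a b y m = psum y m /\
    forall j, (j <= m)%N -> - a <= psum y j) /\
  (b <= stopped a b y m -> exists i, [/\ (i <= m)%N, b <= psum y i &
    forall j, (j <= i)%N -> - a <= psum y j]) by [].
elim: m => [|m [IH1 IH2]] /=.
  split; last by rewrite leNgt b0.
  move=> _; rewrite /psum big_ord0; split => // j.
  by rewrite leqn0 => /eqP ->; rewrite big_ord0 oppr_le0 ltW.
case al: (- a < stopped a b y m < b); rewrite /inside al /=; last first.
  rewrite mul0r addr0 al; split => // /IH2[i [im h1 h2]].
  by exists i; split => //; rewrite (leq_trans im).
have [e hj] := IH1 al; rewrite mul1r e -psumS; split => [/andP[h1 h2]|h].
  split => // j; rewrite leq_eqVlt => /predU1P[->|]; first exact: ltW.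
  exact: hj.
exists m.+1; split => // j; rewrite leq_eqVlt => /predU1P[->|]; last exact: hj.
by apply: le_trans h; lra.
Qed.

Lemma inside_bmf a b : bmf (inside a b).
Proof.
have -> : inside a b = \1_(`]- a, b[%classic).
  by apply/funext => x; rewrite indicE mem_setE in_itv.
exact: bmf_indic.
Qed.

Lemma inside_ge0 a b x : 0 <= inside a b x.
Proof. by rewrite ler0n. Qed.

Lemma stopped_inside_anti a b y m : inside a b (stopped a b y m.+1) <=
  inside a b (stopped a b y m).
Proof.
rewrite /=; set x := stopped a b y m.
have [e|e] : inside a b x = 1 \/ inside a b x = 0.
- by rewrite /inside; case: (_ < _ < _); [left|right].
- by rewrite e mul1r /inside lern1 leq_b1.
- by rewrite e mul0r addr0 e.
Qed.

Lemma stopped_bound a b y K m : 0 < a -> 0 < b -> (forall i, `|y i| <= K) ->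
  - (a + K) <= stopped a b y m <= b + K.
Proof.
move=> a0 b0 yK; have K0 : 0 <= K by exact: le_trans (yK 0%N).
elim: m => [|m /andP[h1 h2]] /=; first by apply/andP; split; lra.
rewrite /inside; case e: (- a < stopped a b y m < b); last by rewrite mul0r addr0 h1.
have /andP[h3 h4] := e.
have := yK m; rewrite ler_norml mul1r => /andP[? ?].
by apply/andP; split; lra.
Qed.

End stopped_walk.

Section ruin.
Context d (Omega : measurableType d) (R : realType) (P : probability Omega R).
Variable omega : int -> {RV P >-> R}.
Hypothesis omega_indep : mutually_independent omega.
Variables (sigma : nat -> int) (J : set int).
Hypothesis sigma_inj : injective sigma.
Hypothesis sigma_notin : forall k, ~ J (sigma k).
Variables (g : R -> R) (K s2 : R).
Hypothesis bg : bmf g.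
Hypothesis gK : forall x, `|g x| <= K.
Hypothesis g_mean : forall i, mean P (fun t => g (omega i t)) = 0.
Hypothesis g_var : forall i, mean P (fun t => g (omega i t) ^+ 2) = s2.

Definition range_block n : set int := J `|` [set sigma k | k in `I_n].

Let y t k := g (omega (sigma k) t).

Let range_sub n : range_block n `<=` range_block n.+1.
Proof. by move=> i [Ji|[k kn <-]]; [left|right; exists k => //=; rewrite ltnS ltnW]. Qed.

Let notin_range n : ~ range_block n (sigma n).
Proof.
case => [|[k /= kn /sigma_inj kE]]; first exact: sigma_notin.
by rewrite kE ltnn in kn.
Qed.

Lemma stopped_block a b n :
  @bmf _ (block omega (range_block n)) R (fun t => stopped a b (y t) n).
Proof.
elim: n => [|n IH] /=; first exact: bmf_cst.
have IH' := block_bmf_sub (@range_sub n) IH.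
apply: bmfD => //; apply: bmfM.
  by apply: (@bmf_comp _ _ _ _ _ _ (inside a b)); [case: IH'|exact: inside_bmf].
apply: block_coord => //; right; by exists n => /=.
Qed.

Variables (f : Omega -> R).
Hypothesis bf : @bmf _ (block omega J) R f.
Hypothesis f_ge0 : forall t, 0 <= f t.

Let bf' n : @bmf _ (block omega (range_block n)) R f.
Proof. by apply: block_bmf_sub bf => i; left. Qed.

Let step_mean n (h : R -> R) (u : Omega -> R) : bmf h ->
  @bmf _ (block omega (range_block n)) R u ->
  mean P (fun t => u t * h (omega (sigma n) t)) =
  mean P u * mean P (fun t => h (omega (sigma n) t)).
Proof. by move=> bh bu; apply: (block_mean_indep omega_indep (J := range_block n)). Qed.

Lemma stopped_mean a b n : mean P (fun t => f t * stopped a b (y t) n) = 0.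
Proof.
elim: n => [|n IH] /=.
  by rewrite -[RHS](mean_cst P); apply: eq_mean => t; rewrite mulr0.
have bW := stopped_block a b n.
have bI : @bmf _ (block omega (range_block n)) R
    (fun t => inside a b (stopped a b (y t) n)).
  by apply: (@bmf_comp _ _ _ _ _ _ (inside a b)); [case: bW|exact: inside_bmf].
transitivity (mean P (fun t => f t * stopped a b (y t) n +
    (f t * inside a b (stopped a b (y t) n)) * g (omega (sigma n) t))).
  by apply: eq_mean => t; rewrite /y; ring.
rewrite meanD.
- by rewrite IH add0r (step_mean bg) ?g_mean ?mulr0//; exact: bmfM.
- by apply: (@block_bmf _ _ _ _ omega (range_block n)); apply: bmfM.
- apply: (@block_bmf _ _ _ _ omega (range_block n.+1)); apply: bmfM.
    by apply: bmfM => //; exact: block_bmf_sub bI.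
  by apply: block_coord => //; right; exists n => /=.
Qed.

Lemma stopped_sqr_mean a b n : mean P (fun t => f t * stopped a b (y t) n.+1 ^+ 2) =
  mean P (fun t => f t * stopped a b (y t) n ^+ 2) +
  s2 * mean P (fun t => f t * inside a b (stopped a b (y t) n)).
Proof.
have bW := stopped_block a b n.
have bI : @bmf _ (block omega (range_block n)) R
    (fun t => inside a b (stopped a b (y t) n)).
  by apply: (@bmf_comp _ _ _ _ _ _ (inside a b)); [case: bW|exact: inside_bmf].
have by1 : @bmf _ (block omega (range_block n.+1)) R (fun t => y t n).
  by apply: block_coord => //; right; exists n => /=.
have b1 := block_bmf_sub (@range_sub n) bI.
have b2 := block_bmf_sub (@range_sub n) bW.
pose u1 t := 2 * (f t * inside a b (stopped a b (y t) n) * stopped a b (y t) n).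
pose u2 t := f t * inside a b (stopped a b (y t) n).
transitivity (mean P (fun t => f t * stopped a b (y t) n ^+ 2 +
    (u1 t * g (omega (sigma n) t) + u2 t * g (omega (sigma n) t) ^+ 2))).
  apply: eq_mean => t; rewrite /u1 /u2 /y /= /inside.
  by case: (_ < _ < _) => /=; ring.
have bu1 : @bmf _ (block omega (range_block n)) R u1.
  by apply: bmfZ; apply: bmfM => //; apply: bmfM.
have bu2 : @bmf _ (block omega (range_block n)) R u2 by apply: bmfM.
have bb (u : Omega -> R) : @bmf _ (block omega (range_block n)) R u ->
    @bmf _ (block omega (range_block n.+1)) R u by exact: block_bmf_sub.
have unb := @block_bmf _ _ _ _ omega (range_block n.+1).
rewrite meanD; first last.
- by apply: unb; apply: bmfD; apply: bmfM; try exact: bb; try exact: bmfX.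
- by apply: unb; apply: bmfM => //; apply: bmfX.
rewrite meanD; first last.
- by apply: unb; apply: bmfM; [exact: bb|exact: bmfX].
- by apply: unb; apply: bmfM => //; exact: bb.
rewrite (step_mean bg bu1) g_mean mulr0 add0r.
by rewrite (step_mean (bmfX 2 bg) bu2) g_var mulrC.
Qed.

(** Optional stopping: the mean of the stopped walk stays 0, and its second
    moment, which is at most of order [b ^ 2], bounds the time spent inside. Hence
    a walk that starts at 0 reaches [b] before [- theta b], within a time of order
    [b ^ 2], with a probability bounded below, whatever the past block. *)
Lemma ruin_ge (theta b : R) (m : nat) : 0 < theta <= 1 -> K <= b -> 0 < b -> 0 < s2 ->
  16 * b ^+ 2 / theta <= m%:R * s2 ->
  theta / 6 * mean P f <=
  mean P (fun t => f t * (b <= stopped (theta * b) b (y t) m)%R%:R).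
Proof.
move=> /andP[th0 th1] Kb b0 s20 hm; set a := theta * b.
have a0 : 0 < a by rewrite mulr_gt0.
have ab : a <= b by rewrite ler_piMl// ltW.
have unb n := @block_bmf _ _ _ _ omega (range_block n).
have bI n : @bmf _ (block omega (range_block n)) R
    (fun t => inside a b (stopped a b (y t) n)).
  apply: (@bmf_comp _ _ _ _ _ _ (inside a b)); last exact: inside_bmf.
  by case: (stopped_block a b n).
have bup : @bmf _ (block omega (range_block m)) R
    (fun t => (b <= stopped a b (y t) m)%R%:R).
  apply: (@bmf_comp _ _ _ _ _ _ (fun x => (b <= x)%R%:R)).
    by case: (stopped_block a b m).
  have -> : (fun x => (b <= x)%R%:R) = \1_(`[b, +oo[%classic) :> (R -> R).
    by apply/funext => x; rewrite indicE mem_setE in_itv /= andbT.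
  exact: bmf_indic.
have W2 t n : stopped a b (y t) n ^+ 2 <= 4 * b ^+ 2.
  have /andP[h1 h2] := stopped_bound n a0 b0 (fun i => gK _ : `|y t i| <= K).
  have -> : 4 * b ^+ 2 = (2 * b) ^+ 2 by ring.
  rewrite -real_normK ?num_real// lerXn2r// ?nnegrE ?mulr_ge0 ?(ltW b0)//.
  by rewrite ler_norml; apply/andP; split; lra.
have e0 : 0 <= mean P f by exact: mean_ge0.
have in_le : mean P (fun t => f t * inside a b (stopped a b (y t) m)) <=
    theta / 4 * mean P f.
  set q := mean P _.
  have sq n : (n <= m)%N -> n%:R * (s2 * q) <=
      mean P (fun t => f t * stopped a b (y t) n ^+ 2).
    elim: n => [_|n IH nm].
      rewrite mul0r; apply: mean_ge0 => t; rewrite mulr_ge0// ?f_ge0//; exact: sqr_ge0.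
    rewrite stopped_sqr_mean -natr1 mulrDl mul1r lerD ?IH ?(ltnW nm)//.
    rewrite ler_pM2l//; apply: le_mean.
    - by apply: (unb m); apply: bmfM.
    - by apply: (unb n); apply: bmfM.
    - move=> t; rewrite ler_wpM2l// -(subnKC (ltnW nm)).
      elim: (m - n)%N => [|k IHk]; first by rewrite addn0.
      by rewrite addnS (le_trans (stopped_inside_anti _ _ _ _)).
  have := sq m (leqnn m) => /le_trans /(_ (_ : _ <= 4 * b ^+ 2 * mean P f)).
  have -> : mean P (fun t => f t * stopped a b (y t) m ^+ 2) <= 4 * b ^+ 2 * mean P f.
    rewrite -meanZ; last exact: (unb 0%N).
    apply: le_mean.
    - by apply: (unb m); apply: bmfM => //; apply: bmfX; exact: stopped_block.
    - by apply: bmfZ; apply: (unb 0%N).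
    - by move=> t; rewrite mulrC ler_wpM2r.
  move=> /(_ isT) h.
  have q0 : 0 <= q by apply: mean_ge0 => t; rewrite mulr_ge0 ?f_ge0 ?inside_ge0.
  have : 16 * b ^+ 2 / theta * q <= 4 * b ^+ 2 * mean P f.
    by apply: le_trans h; rewrite mulrA ler_wpM2r.
  have b20 : 0 < 4 * b ^+ 2 by rewrite mulr_gt0// exprn_gt0.
  have -> : 16 * b ^+ 2 / theta * q = 4 * b ^+ 2 * (4 / theta * q).
    by field; rewrite gt_eqF.
  rewrite ler_pM2l// => h'.
  rewrite -(ler_pM2l (_ : 0 < 4 / theta)) ?divr_gt0//; apply: le_trans h' _.
  by rewrite le_eqVlt; apply/orP; left; apply/eqP; field; rewrite gt_eqF.
set u := mean P (fun t => f t * (_ <= _)%R%:R).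
set q := mean P _ in in_le.
have : 0 <= (a + b + K) * u + (a + b) * q - a * mean P f.
  rewrite -(stopped_mean a b m).
  have bfu : bmf (fun t => f t * (b <= stopped a b (y t) m)%R%:R).
    by apply: (unb m); apply: bmfM.
  have bfi : bmf (fun t => f t * inside a b (stopped a b (y t) m)).
    by apply: (unb m); apply: bmfM.
  have bff : bmf f by exact: (unb 0%N).
  rewrite -[(a + b + K) * u]meanZ// -[(a + b) * q]meanZ// -[a * mean P f]meanZ//.
  rewrite -meanD; [|exact: bmfZ|exact: bmfZ].
  rewrite -meanB; [|by apply: bmfD; exact: bmfZ|exact: bmfZ].
  apply: le_mean.
  - by apply: (unb m); apply: bmfM => //; exact: stopped_block.
  - by apply: bmfB; [apply: bmfD|]; exact: bmfZ.
  - move=> t.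
    have -> : (a + b + K) * (f t * (b <= stopped a b (y t) m)%R%:R) +
       (a + b) * (f t * inside a b (stopped a b (y t) m)) - a * f t =
       f t * ((a + b + K) * (b <= stopped a b (y t) m)%R%:R +
         (a + b) * inside a b (stopped a b (y t) m) - a) by ring.
    rewrite ler_wpM2l//.
    have /andP[h1 h2] := stopped_bound m a0 b0 (fun i => gK _ : `|y t i| <= K).
    rewrite /inside; case: (leP b (stopped a b (y t) m)) => h.
      by rewrite andbF /=; lra.
    rewrite andbT; case: (ltP (- a) (stopped a b (y t) m)) => h' /=; lra.
have q0 : 0 <= q by apply: mean_ge0 => t; rewrite mulr_ge0 ?f_ge0 ?inside_ge0.
have u0 : 0 <= u by apply: mean_ge0 => t; rewrite mulr_ge0 ?f_ge0// ler0n.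
have h1 : (a + b) * q <= 2 * b * (theta / 4 * mean P f).
  by apply: ler_pM => //; lra.
have h2 : (a + b + K) * u <= 3 * b * u by rewrite ler_wpM2r//; lra.
move=> h3; rewrite -(ler_pM2l b0).
have : a * mean P f = b * (theta * mean P f) by rewrite /a; ring.
move=> h4; move: h1 h2 h3; rewrite h4.
rewrite (_ : 2 * b * _ = b * (theta * mean P f) / 2); last by field.
rewrite (_ : b * (theta / 6 * _) = b * (theta * mean P f) / 6); last by field.
rewrite (_ : 3 * b * u = 3 * (b * u)); last by ring.
set v := b * (theta * _); set v' := b * u; set v1 := _ * q; set v2 := _ * u.
by move: v v' v1 v2 => v v' v1 v2; lra.
Qed.

End ruin.

(** * Valleys at all scales *)

Section scales.
Context d (Omega : measurableType d) (R : realType) (P : probability Omega R).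
Variable omega : int -> {RV P >-> R}.
Hypothesis omega_indep : mutually_independent omega.
Variables (h : R -> R) (K s2 theta kappa : R).
Hypothesis bh : bmf h.
Hypothesis hK : forall x, `|h x| <= K.
Hypothesis h_mean : forall i, mean P (fun t => h (omega i t)) = 0.
Hypothesis h_var : forall i, mean P (fun t => h (omega i t) ^+ 2) = s2.
Hypothesis s2_gt0 : 0 < s2.
Hypothesis theta01 : 0 < theta <= 1.
Hypothesis kappa_gt0 : 0 < kappa.
Hypothesis K_kappa : K <= kappa.

(** The increments of the potential away from the origin, to the right and to
    the left. *)
Definition right_step t (n : nat) : R := h (omega n.+1%:Z t).
Definition left_step t (n : nat) : R := - h (omega (- n%:Z) t).

(** What must be climbed from distance [r]: it dominates the potential that can
    have built up within that distance. *)
Definition height (r : nat) : R := kappa * r.+1%:R.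

(** The number of steps that [ruin_ge] asks for. *)
Definition duration (r : nat) : nat :=
  (Num.truncn (16 * height r ^+ 2 / theta / s2)).+1.

Definition climbs (r : nat) (y : nat -> R) : bool :=
  height r <= stopped (theta * height r) (height r) (fun i => y (r + i)%N) (duration r).

Definition central (r : nat) : set int := [set x | - r%:Z < x <= r%:Z].

Let height_gt0 r : 0 < height r.
Proof. by rewrite mulr_gt0. Qed.

Let K_height r : K <= height r.
Proof. by rewrite (le_trans K_kappa)// ler_peMr ?(ltW kappa_gt0)// ler1n. Qed.

Let duration_ge r : 16 * height r ^+ 2 / theta <= (duration r)%:R * s2.
Proof.
have /andP[th0 _] := theta01.
rewrite -ler_pdivrMr//; apply: ltW.
have h0 : 0 <= 16 * height r ^+ 2 / theta / s2.
  by rewrite divr_ge0 ?(ltW s2_gt0)// divr_ge0 ?(ltW th0)// mulr_ge0// sqr_ge0.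
by have /andP[] := Num.Theory.truncn_itv h0.
Qed.

Lemma climb_ge (sigma : nat -> int) (g : R -> R) (r : nat) (J : set int)
    (f : Omega -> R) (y := fun t k => g (omega (sigma k) t))
    (c := fun t => (height r <= stopped (theta * height r) (height r) (y t)
                      (duration r))%R%:R : R) :
  injective sigma -> (forall k, ~ J (sigma k)) -> bmf g -> (forall x, `|g x| <= K) ->
  (forall i, mean P (fun t => g (omega i t)) = 0) ->
  (forall i, mean P (fun t => g (omega i t) ^+ 2) = s2) ->
  @bmf _ (block omega J) R f -> (forall t, 0 <= f t) ->
  theta / 6 * mean P f <= mean P (fun t => f t * c t) /\
  @bmf _ (block omega (range_block sigma J (duration r))) R (fun t => f t * c t).
Proof.
move=> sinj nJ bg gK gm gv bf f0; split.
  exact: (@ruin_ge _ _ _ P omega omega_indep sigma J sinj nJ g K s2 bg gK gm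
    gv f bf f0 theta (height r) (duration r)).
apply: bmfM; first by apply: block_bmf_sub bf => x; left.
apply: (@bmf_comp _ _ _ _ _ _ (fun x => (height r <= x)%R%:R)).
  by case: (stopped_block omega sigma J bg (theta * height r) (height r) (duration r)).
have -> : (fun x => (height r <= x)%R%:R) = \1_(`[height r, +oo[%classic) :> (R -> R).
  by apply/funext => x; rewrite indicE mem_setE in_itv /= andbT.
exact: bmf_indic.
Qed.

Definition success r t : R :=
  (climbs r (right_step t))%:R * (climbs r (left_step t))%:R.

Lemma success_ge r (f : Omega -> R) :
  @bmf _ (block omega (central r)) R f -> (forall t, 0 <= f t) ->
  (theta / 6) ^+ 2 * mean P f <= mean P (fun t => f t * success r t) /\
  @bmf _ (block omega (central (r + duration r))) R (fun t => f t * success r t).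
Proof.
move=> bf f0.
pose sR k : int := (r + k).+1%:Z; pose sL k : int := - (r + k)%:Z.
have iR : injective sR by move=> k l; rewrite /sR; lia.
have iL : injective sL by move=> k l; rewrite /sL; lia.
have nR k : ~ central r (sR k) by rewrite /central /sR /= => /andP[]; lia.
have [geR bR] := climb_ge r iR nR bh hK h_mean h_var bf f0.
have nL k : ~ range_block sR (central r) (duration r) (sL k).
  by rewrite /sL; case => [/andP[]|[j _]]; rewrite /sR; lia.
have bh' : bmf (fun x => - h x) by exact: bmfN.
have hK' x : `|- h x| <= K by rewrite normrN.
have hm i : mean P (fun t => - h (omega i t)) = 0.
  under eq_mean do rewrite -mulN1r.
  by rewrite meanZ ?h_mean ?mulr0//; exact: bmf_comp.
have hv i : mean P (fun t => (- h (omega i t)) ^+ 2) = s2.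
  by under eq_mean do rewrite sqrrN; exact: h_var.
have fR0 t : 0 <= f t * (climbs r (right_step t))%:R by rewrite mulr_ge0// ler0n.
have [geL bL] := climb_ge r iL nL bh' hK' hm hv bR fR0.
have e t : f t * (climbs r (right_step t))%:R * (climbs r (left_step t))%:R =
    f t * success r t by rewrite /success mulrA.
rewrite -(_ : (fun t => f t * (climbs r (right_step t))%:R *
  (climbs r (left_step t))%:R) = fun t => f t * success r t); last exact/funext.
split.
  rewrite expr2 -mulrA.
  apply: le_trans geL; rewrite ler_wpM2l//.
  by have /andP[th0 _] := theta01; rewrite divr_ge0// ltW.
apply: block_bmf_sub bL => x; rewrite /central.
case=> [[/andP[h1 h2]|[k /= kd <-]]|[k /= kd <-]]; rewrite /sR /sL;
  by apply/andP; split; lia.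
Qed.

(** The attempts to climb at different scales use disjoint parts of the
    environment. *)
Fixpoint scale (k : nat) : nat :=
  if k is k'.+1 then (scale k' + duration (scale k'))%N else 0.

Lemma scale_ge k : (k <= scale k)%N.
Proof. by elim: k => [//|k IH] /=; rewrite /duration addnS ltnS (leq_trans IH)// leq_addr. Qed.

Fixpoint failure (k0 n : nat) t : R :=
  if n is n'.+1 then failure k0 n' t * (1 - success (scale (k0 + n')) t) else 1.

Let success01 r t : 0 <= success r t <= 1.
Proof. by rewrite /success; do 2 case: climbs; rewrite /= ?mulr0 ?mulr1 ?lexx ?ler01. Qed.

Let failure_ge0 k0 n t : 0 <= failure k0 n t.
Proof.
elim: n => [|n IH] //=; rewrite mulr_ge0// subr_ge0.
by case/andP: (success01 (scale (k0 + n)) t).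
Qed.

(** Each scale succeeds with a conditional probability bounded below, given all
    the smaller scales. *)
Lemma failure_le k0 n :
  @bmf _ (block omega (central (scale (k0 + n)))) R (failure k0 n) /\
  mean P (failure k0 n) <= (1 - (theta / 6) ^+ 2) ^+ n.
Proof.
elim: n => [|n [bF mF]] /=.
  by split; [exact: bmf_cst|rewrite expr0 mean_cst].
have [ge b] := success_ge bF (failure_ge0 k0 n).
have sub : central (scale (k0 + n)) `<=` central (scale (k0 + n.+1)).
  by rewrite addnS /= => x /andP[h1 h2]; apply/andP; split; lia.
have e t : failure k0 n t * (1 - success (scale (k0 + n)) t) =
  failure k0 n t - failure k0 n t * success (scale (k0 + n)) t by ring.
rewrite (_ : (fun t => failure k0 n t * (1 - success (scale (k0 + n)) t)) =
  fun t => failure k0 n t - failure k0 n t * success (scale (k0 + n)) t); last exact/funext.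
split; first by apply: bmfB; [exact: block_bmf_sub bF|rewrite addnS].
rewrite meanB; [|exact: block_bmf bF|exact: block_bmf b].
have /andP[th0 th1] := theta01.
apply: (@le_trans _ _ ((1 - (theta / 6) ^+ 2) * mean P (failure k0 n))).
  by rewrite mulrBl mul1r lerD2l lerN2.
by rewrite [_ ^+ n.+1]exprS ler_wpM2l// subr_ge0 exprn_ile1//; lra.
Qed.

Lemma ae_climbs : {ae P, forall t, forall k0, exists2 k, (k0 <= k)%N &
  climbs (scale k) (right_step t) && climbs (scale k) (left_step t)}.
Proof.
have /andP[th0 th1] := theta01.
pose c := 1 - (theta / 6) ^+ 2.
have c01 : 0 <= c < 1.
  rewrite /c subr_ge0 exprn_ile1//=; [|lra|lra].
  by rewrite ltrBlDr ltrDl exprn_gt0// divr_gt0.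
pose G k0 n : set Omega := failure k0 n @^-1` [set 1].
have mG k0 n : measurable (G k0 n).
  have [[mF _] _] := (block_bmf (failure_le k0 n).1, tt).
  by have := mF measurableT [set 1] (measurable_set1 1); rewrite setTI.
have PG k0 n : (P (G k0 n) <= (c ^+ n)%:E)%E.
  have [bF mF] := failure_le k0 n.
  rewrite -[leLHS]fineK ?fin_num_measure// lee_fin -mean_indic//.
  apply: le_trans mF; apply: le_mean => [||t].
  - exact: bmf_indic.
  - exact: block_bmf bF.
  - rewrite indicE; case: (boolP (t \in G k0 n)) => [|_]; last exact: failure_ge0.
    by rewrite inE /G /= => ->.
have null k0 : P.-negligible (\bigcap_n G k0 n).
  have mI : measurable (\bigcap_n G k0 n) by exact: bigcap_measurable.
  apply/negligibleP => //; apply/eqP; rewrite eq_le measure_ge0 andbT.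
  have le n : (P (\bigcap_n G k0 n) <= (c ^+ n)%:E)%E.
    by apply: le_trans (PG k0 n); apply: le_measure; rewrite ?inE// => t; exact.
  rewrite -[leLHS]fineK ?fin_num_measure// lee_fin.
  have cv : c ^+ n @[n --> \oo] --> (0 : R).
    by apply: cvg_expr; have /andP[? ?] := c01; rewrite ger0_norm.
  apply/ler_addgt0Pr => e e0; rewrite add0r.
  have /cvgrPdist_le /(_ e e0)[n _ /(_ n (leqnn n))] := cv.
  rewrite sub0r normrN => /(le_trans (ler_norm _)); apply: le_trans.
  by have := le n; rewrite -[leLHS]fineK ?fin_num_measure// lee_fin.
apply: negligibleS (negligible_bigcup null) => t /= nt.
have [k0 hk0] : exists k0, ~ exists2 k, (k0 <= k)%N &
    climbs (scale k) (right_step t) && climbs (scale k) (left_step t).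
  by apply/existsNP.
exists k0 => // n _; rewrite /G /=.
elim: n => [//|n IH] /=; rewrite IH mul1r.
have -> : success (scale (k0 + n)) t = 0; last by rewrite subr0.
have : ~~ (climbs (scale (k0 + n)) (right_step t) &&
           climbs (scale (k0 + n)) (left_step t)).
  by apply/negP => hc; apply: hk0; exists (k0 + n)%N => //; rewrite leq_addr.
by rewrite /success; do 2 case: climbs; rewrite //= ?mulr0 ?mul0r.
Qed.

End scales.

(** * Quenched return probabilities *)

Section potential.
Context {R : realType}.
Variables (w : int -> R) (yR yL : nat -> R) (K s2 theta kappa : R).
Hypothesis w01 : forall x, 0 < w x < 1.
Hypothesis yR_E : forall n, yR n = ln (rho (w n.+1%:Z)).
Hypothesis yL_E : forall n, yL n = - ln (rho (w (- n%:Z))).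
Hypothesis yR_K : forall n, `|yR n| <= K.
Hypothesis yL_K : forall n, `|yL n| <= K.
Hypothesis s2_gt0 : 0 < s2.
Hypothesis theta_bd : 0 < theta <= 4^-1.
Hypothesis kappa_gt0 : 0 < kappa.
Hypothesis K_le : K <= theta * kappa.

Lemma climbs_path r y : (forall n, `|y n| <= K) -> climbs s2 theta kappa r y ->
  exists n, [/\ (n <= r + duration s2 theta kappa r)%N,
    (1 - theta) * height kappa r <= psum y n &
    forall j, (j <= n)%N -> - (2 * theta * height kappa r) <= psum y j].
Proof.
have /andP[th0 th1] := theta_bd.
set H := height kappa r => yK; have H0 : 0 < H by rewrite mulr_gt0.
have aH : 0 < theta * H by rewrite mulr_gt0.
have rK (j : nat) : (j <= r)%N -> `|psum y j| <= theta * H.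
  move=> jr; apply: le_trans (psum_norm_le _ yK) _.
  apply: (@le_trans _ _ (j%:R * (theta * kappa))); first by rewrite ler_wpM2l.
  rewrite mulrC /H /height mulrA ler_wpM2l ?ler_nat ?(leq_trans jr)//.
  by rewrite mulr_ge0 ?ltW.
move=> /(stopped_up aH H0)[i [im hi hj]]; exists (r + i)%N; split.
- by rewrite leq_add2l.
- rewrite psum_cat; have := rK r (leqnn r); rewrite ler_norml => /andP[? _].
  by lra.
- move=> j ji; have [jr|rj] := leqP j r.
    by have := rK j jr; rewrite ler_norml => /andP[? _]; lra.
  rewrite -(subnKC (ltnW rj)) psum_cat.
  have := hj (j - r)%N; rewrite leq_subLR => /(_ ji).
  have := rK r (leqnn r); rewrite ler_norml => /andP[? _].
  by lra.
Qed.

(** The potential of the environment, whose increment at [x] is [ln (rho (w x))]. *)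
Definition potential (x : int) : R :=
  match x with Posz n => psum yR n | Negz n => psum yL n.+1 end.

Let C x := expR (- potential x).

Lemma potential_diff x : potential x - potential (x - 1) = ln (rho (w x)).
Proof.
case: x => [[|n]|n].
- rewrite (_ : 0%:Z - 1 = Negz 0)//= psumS /psum !big_ord0 yL_E oppr0.
  by ring.
- rewrite (_ : n.+1%:Z - 1 = n%:Z); last by lia.
  by rewrite /= psumS yR_E; ring.
- rewrite (_ : Negz n - 1 = Negz n.+1); last by lia.
  rewrite /= [psum yL n.+2]psumS yL_E (_ : - n.+1%:Z = Negz n); last by lia.
  by ring.
Qed.

Lemma potential_opp n : potential (- n%:Z) = psum yL n.
Proof.
case: n => [|n]; first by rewrite oppr0 /= /psum !big_ord0.
by [].
Qed.

Let C_w x : C x * (1 - w x) = C (x - 1) * w x.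
Proof.
have /andP[w0 w1] := w01 x; have w1' : 0 < 1 - w x by rewrite subr_gt0.
have e : expR (ln (rho (w x))) = rho (w x) by rewrite lnK// posrE divr_gt0.
rewrite /C (_ : potential x = potential (x - 1) + ln (rho (w x))); last first.
  by rewrite -potential_diff; ring.
rewrite opprD expRD [expR (- ln _)]expRN e /rho -mulrA invf_div mulfVK//.
by rewrite gt_eqF.
Qed.

(** The ends of the two climbs bound a valley of width at most twice
    [r + duration r]; the hypothesis on this number absorbs the width in the
    roughness [exp (2 theta H)] of the valley. *)
Lemma climbs_return r n : 16 <= height kappa r ->
  16 * (r + duration s2 theta kappa r)%:R <= expR (2 * theta * height kappa r) ->
  climbs s2 theta kappa r yR -> climbs s2 theta kappa r yL ->
  n%:R <= expR (height kappa r / 2) ->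
  expR (- (4 * theta * height kappa r)) <= rwre w (n + n) 0.
Proof.
have /andP[th0 th1] := theta_bd.
set H := height kappa r; set D := (r + _)%N => H16 DH cR cL nH.
have [nR [nRD hR bR]] := climbs_path yR_K cR.
have [nL [nLD hL bL]] := climbs_path yL_K cL.
rewrite -/H in hR bR hL bL.
have H0 : 0 < H by lra.
have nL0 : (0 < nL)%N.
  case: nL hL {nLD bL} => //; rewrite /psum big_ord0.
  by rewrite leNgt mulr_gt0//; lra.
pose G := 2 * expR (2 * theta * H).
have G0 : 0 < G by rewrite mulr_gt0// expR_gt0.
have C_ge0 x : 0 < C x by exact: expR_gt0.
have rm0 : 1 <= rmeas C 0.
  rewrite /rmeas ler_wpDl// ?(ltW (C_ge0 _))//.
  have := potential_opp 0; rewrite oppr0 /psum big_ord0 /C => ->.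
  by rewrite oppr0 expR0.
have Cle x : - nL%:Z <= x <= nR%:Z -> C x <= expR (2 * theta * H).
  move=> /andP[x1 x2]; rewrite ler_expR lerNl.
  case: x x1 x2 => m x1 x2 /=; first by apply: bR; move: x2; clear; lia.
  by apply: bL; move: x1; clear; lia.
have Cend : C nR%:Z + C (- (nL.-1)%:Z - 1) <= 2 * expR (- ((1 - theta) * H)).
  rewrite (_ : - (nL.-1)%:Z - 1 = - nL%:Z); last by move: nL0; clear; lia.
  rewrite /C potential_opp /= mulrDl mul1r; apply: lerD; by rewrite ler_expR lerN2.
have := @valley_return R w C w01 C_ge0 C_w nL.-1 nR G n G0.
rewrite -addnS; have -> : (nL.-1 + nR.+1 = nL + nR)%N by move: nL0; clear; lia.
move=> vr; apply: le_trans (vr _ _).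
- have Dpos : 0 < (nL + nR)%:R :> R by rewrite ltr0n addn_gt0 nL0.
  have GD : 0 < 4 * G * (nL + nR)%:R by rewrite mulr_gt0// mulr_gt0.
  rewrite expRN lef_pV2 ?posrE ?expR_gt0//.
  rewrite (_ : 4 * theta * H = 2 * theta * H + 2 * theta * H); last by ring.
  rewrite expRD /G.
  have h1 : (nL + nR)%:R <= 2 * D%:R :> R.
    by rewrite -natrM ler_nat mul2n -addnn leq_add.
  have h2 : 4 * (2 * expR (2 * theta * H)) * (nL + nR)%:R <=
      4 * (2 * expR (2 * theta * H)) * (2 * D%:R).
    by rewrite ler_wpM2l// !mulr_ge0 ?expR_ge0.
  apply: le_trans h2 _.
  rewrite (_ : _ * (2 * D%:R) = expR (2 * theta * H) * (16 * D%:R)); last by ring.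
  by rewrite ler_wpM2l ?expR_ge0.
- move=> x /andP[x1 x2]; apply: (@le_trans _ _ G); last by rewrite ler_peMr// ltW.
  rewrite /rmeas /G mulrDl mul1r; apply: lerD; apply: Cle;
    by move: nL0 x1 x2; clear; lia.
- apply: (@le_trans _ _ (expR (H / 2) * (2 * expR (- ((1 - theta) * H))))).
    by apply: ler_pM => //; rewrite addr_ge0// ltW.
  rewrite mulrCA -expRD.
  have : expR (H / 2 + - ((1 - theta) * H)) <= expR (- 4).
    rewrite ler_expR; have : theta * H <= 4^-1 * H by rewrite ler_wpM2r// ltW.
    by lra.
  have : expR (-4) <= 4^-1 :> R.
    rewrite expRN lef_pV2 ?posrE ?expR_gt0//.
    by apply: le_trans (expR_ge1Dx _); lra.
  by lra.
Qed.

End potential.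

Section quenched_returns.
Context d (Omega : measurableType d) (R : realType) (P : probability Omega R).
Variable omega : int -> {RV P >-> R}.
Hypothesis omega_indep : mutually_independent omega.
Hypothesis omega01 : forall x t, 0 < omega x t < 1.
Variables (h : R -> R) (K s2 : R).
Hypothesis bh : bmf h.
Hypothesis hK : forall x, `|h x| <= K.
Hypothesis h_mean : forall i, mean P (fun t => h (omega i t)) = 0.
Hypothesis h_var : forall i, mean P (fun t => h (omega i t) ^+ 2) = s2.
Hypothesis s2_gt0 : 0 < s2.
Hypothesis h_ln : {ae P, forall t, forall x, h (omega x t) = ln (rho (omega x t))}.

(** Almost surely, the environment has, at infinitely many scales, a valley
    around the origin that is deep on both sides compared with its own
    roughness: during a time exponential in its depth [L], the return
    probability stays above [exp (- eps L)]. *)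
Lemma valley_estimate (eps : R) : 0 < eps <= 2 ->
  {ae P, forall t, forall L0, exists2 L, L0 <= L & forall n, n%:R <= expR L ->
     expR (- (eps * L)) <= rwre (omega^~ t) (n + n) 0}.
Proof.
move=> /andP[e0 e2].
pose theta := eps / 8; pose kappa := (K + 1) / theta.
have K0 : 0 <= K by exact: le_trans (hK 0).
have th0 : 0 < theta by rewrite divr_gt0.
have th4 : theta <= 4^-1 by rewrite /theta; lra.
have kap0 : 0 < kappa by rewrite divr_gt0//; lra.
have Kk : K <= theta * kappa.
  by rewrite /kappa mulrC divfK ?gt_eqF// lerDl.
have Kk' : K <= kappa by apply: (le_trans Kk); rewrite ler_piMl ?(ltW kap0)//; lra.
have th01 : 0 < theta <= 1 by rewrite th0/=; lra.
have := ae_climbs omega_indep bh hK h_mean h_var s2_gt0 th01 kap0 Kk'.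
move=> ae1; apply: filterS2 ae1 h_ln => t ht hl L0.
pose Dc := 16 * (kappa^-1 + 16 / (theta * s2) + 1).
have Dc0 : 0 < Dc.
  have k1 : 0 < kappa^-1 by rewrite invr_gt0.
  have k2 : 0 < 16 / (theta * s2) by rewrite divr_gt0// mulr_gt0.
  by rewrite /Dc; lra.
pose H0 := Num.max (Num.max 16 (2 * L0)) (Dc * (3 / (2 * theta)) ^+ 3).
have [k kk0 /andP[cR cL]] := ht (Num.truncn (H0 / kappa)).+1.
set r := scale s2 theta kappa k in cR cL.
set H := height kappa r.
have HH0 : H0 <= H.
  rewrite /H /height mulrC -ler_pdivrMr//; apply/ltW.
  have H00 : 0 <= H0 / kappa by rewrite divr_ge0 ?(ltW kap0)// /H0 !le_max ler0n.
  have /andP[_ h1] := Num.Theory.truncn_itv H00.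
  apply: (lt_le_trans h1); rewrite ler_nat (leq_trans kk0)//.
  exact: (leq_trans (scale_ge s2 theta kappa k)).
have [h16 hL hD] : [/\ 16 <= H, 2 * L0 <= H & Dc * (3 / (2 * theta)) ^+ 3 <= H].
  by split; apply: le_trans HH0; rewrite /H0 !le_max lexx ?orbT.
exists (H / 2); first by lra.
move=> n hn.
rewrite (_ : eps * (H / 2) = 4 * theta * H); last by rewrite /theta; field.
apply: (@climbs_return R (omega^~ t) (right_step omega h t) (left_step omega h t)
  K s2 theta kappa) => //.
- by move=> m; rewrite /right_step hl.
- by move=> m; rewrite /left_step hl.
- by move=> m; exact: hK.
- by move=> m; rewrite normrN; exact: hK.
- by rewrite th0.
rewrite -/H.
have Hpos : 0 < H by lra.
have bound : 16 * (r + duration s2 theta kappa r)%:R <= Dc * H ^+ 2.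
  have r1 : r%:R <= H / kappa.
    by rewrite ler_pdivlMr// mulrC /H /height ler_wpM2l ?(ltW kap0)// ler_nat.
  have d1 : (duration s2 theta kappa r)%:R <= 16 * H ^+ 2 / theta / s2 + 1.
    rewrite /duration -natr1 lerD2r -/H.
    have h0 : 0 <= 16 * H ^+ 2 / theta / s2.
      by rewrite divr_ge0 ?(ltW s2_gt0)// divr_ge0 ?(ltW th0)// mulr_ge0// sqr_ge0.
    by have /andP[] := Num.Theory.truncn_itv h0.
  have H1 : H <= H ^+ 2 by rewrite ler_eXnr//; lra.
  have H2 : 1 <= H ^+ 2 by lra.
  have k1 : 0 < kappa^-1 by rewrite invr_gt0.
  have r2 : H / kappa <= H ^+ 2 * kappa^-1 by rewrite ler_wpM2r// ltW.
  rewrite natrD /Dc; move: d1.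
  rewrite (_ : 16 * H ^+ 2 / theta / s2 = 16 / (theta * s2) * H ^+ 2); last first.
    by field; rewrite !gt_eqF.
  by lra.
apply: (le_trans bound).
have e3 : (2 * theta / 3 * H) ^+ 3 <= expR (2 * theta * H).
  rewrite (_ : 2 * theta * H = 3%:R * (2 * theta / 3 * H)); last by field.
  rewrite expRM_natl lerXn2r// ?nnegrE ?expR_ge0//.
    by rewrite mulr_ge0 ?(ltW Hpos)// divr_ge0// mulr_ge0// ltW.
  by apply: le_trans (expR_ge1Dx _); rewrite lerDr.
apply: le_trans e3.
have -> : (2 * theta / 3 * H) ^+ 3 = ((2 * theta / 3) ^+ 3 * H) * H ^+ 2 by ring.
rewrite ler_wpM2r ?sqr_ge0//.
rewrite -ler_pdivrMl ?exprn_gt0// ?divr_gt0 ?mulr_gt0//.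
have -> : ((2 * theta / 3) ^+ 3)^-1 = (3 / (2 * theta)) ^+ 3.
  by rewrite -exprVn invf_div.
by rewrite mulrC.
Qed.

End quenched_returns.

Section random_environment.
Context d (Omega : measurableType d) (R : realType) (P : probability Omega R).
Variable omega : int -> {RV P >-> R}.
Hypothesis omega01 : forall x w, 0 < omega x w < 1.
Hypothesis omega_indep : mutually_independent omega.
Hypothesis omega_id : identically_distributed omega.
Hypothesis log_rho_mean : 'E_P[fun w => ln (rho (omega 0%R w))]%E = 0%E.
Hypothesis log_rho_var : (0 < 'V_P[fun w => ln (rho (omega 0%R w))])%E.
Hypothesis elliptic : exists2 eps : R, 0 < eps < 2^-1 &
  P [set w | eps <= omega 0 w <= 1 - eps] = 1%E.

Lemma ae_return (eps : R) : 0 < eps <= 2 ->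
  {ae P, forall t, forall L0, exists2 L, L0 <= L & forall n, n%:R <= expR L ->
     expR (- (eps * L)) <= rwre (omega^~ t) (n + n) 0}.
Proof.
move=> eps02; have [e /andP[e0 e2] Pe] := elliptic.
pose I : set R := `[e, 1 - e]%classic.
pose g (u : R) : R := ln (1 - u) - ln u.
pose h (u : R) : R := \1_I u * g u.
have ln_rho u : 0 < u < 1 -> ln (rho u) = g u.
  by move=> /andP[u0 u1]; rewrite /rho ln_div// posrE subr_gt0.
have mg : measurable_fun [set: R] g.
  apply: measurable_funB => //.
  have m1 : measurable_fun [set: R] (fun u : R => 1 - u).
    by apply: measurable_funB => //; exact: measurable_cst.
  exact: (measurableT_comp (@measurable_ln R) m1).
have hK u : `|h u| <= 2 * - ln e.
  have le0 : ln e <= 0 by apply: ln_le0; lra.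
  rewrite /h indicE; case: (boolP (u \in I)) => [|_]; last by rewrite mul0r normr0; lra.
  rewrite inE /I /= in_itv /= mul1r => /andP[u1 u2].
  have h1 : ln e <= ln u by rewrite ler_ln ?posrE//; lra.
  have h2 : ln e <= ln (1 - u) by rewrite ler_ln ?posrE//; lra.
  have h3 : ln u <= 0 by apply: ln_le0; lra.
  have h4 : ln (1 - u) <= 0 by apply: ln_le0; lra.
  by rewrite /g ler_norml; apply/andP; split; lra.
have bh : bmf h.
  split; last by exists (2 * - ln e).
  by apply: measurable_funM => //; apply: measurable_indic; exact: measurable_itv.
have hE u : e <= u <= 1 - e -> h u = ln (rho u).
  move=> ue; rewrite ln_rho; last by move: ue => /andP[? ?]; apply/andP; split; lra.
  by rewrite /h indicE mem_set ?mul1r// /I /= in_itv.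
(* ellipticity makes [ln (rho _)] almost surely equal to the bounded [h] *)
have ae_ell i : {ae P, forall w, e <= omega i w <= 1 - e}.
  have mI : measurable (omega i @^-1` I) by apply: measurable_preimage; exact: measurable_itv.
  suff N : P.-negligible (~` (omega i @^-1` I)).
    by apply: negligibleS N => w /=; rewrite /I /= in_itv.
  apply/negligibleP; first exact: measurableC.
  rewrite [LHS]probability_setC//.
  have -> : P (omega i @^-1` I) = P (omega 0 @^-1` I) by apply: omega_id; exact: measurable_itv.
  have -> : P (omega 0 @^-1` I) = 1%E.
    by rewrite -Pe; congr (P _); apply/seteqP; split => w /=; rewrite in_itv.
  by rewrite subee.
have ae_all : {ae P, forall w, forall i, e <= omega i w <= 1 - e}.
  have := ae_foralln (fun n => ae_ell (Posz n)).
  have := ae_foralln (fun n => ae_ell (Negz n)).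
  by apply: filterS2 => w h1 h2 [n|n].
have h_same (k : R -> R) i : bmf k ->
    mean P (fun t => k (omega i t)) = mean P (fun t => k (omega 0 t)).
  move=> bk; apply: (mean_eq_law (X1 := omega i) (X2 := omega 0)) => // B mB.
  exact: omega_id.
pose X w := ln (rho (omega 0 w)).
have XE : X = fun w => g (omega 0 w) by apply/funext => w; rewrite /X ln_rho.
have mX : measurable_fun [set: Omega] X by rewrite XE; exact: measurableT_comp.
have bh0 : bmf (fun t => h (omega 0 t)) by exact: bmf_comp.
have hX (f : R -> R) : measurable_fun [set: R] f -> bmf (fun t => f (h (omega 0 t))) ->
    (\int[P]_w (f (X w))%:E)%E = (mean P (fun t => f (h (omega 0 t))))%:E.
  move=> mf bfh; rewrite EFin_mean//; apply: ae_eq_integral => //.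
  - by apply/measurable_EFinP; exact: measurableT_comp.
  - by apply/measurable_EFinP; case: bfh.
  - by apply: filterS (ae_ell 0) => w ew _; rewrite /X hE.
have mean0 : mean P (fun t => h (omega 0 t)) = 0.
  apply: EFin_inj; rewrite -(hX id)//.
  by move: log_rho_mean; rewrite unlock.
pose s2 := mean P (fun t => h (omega 0 t) ^+ 2).
have s20 : 0 < s2.
  rewrite -lte_fin /s2 -(hX (fun x => x ^+ 2)); last exact: bmfX.
    move: log_rho_var; rewrite /variance covariance.unlock log_rho_mean /=.
    rewrite unlock; congr (_ < _)%E; apply: eq_integral => w _.
    by transitivity (((X w - 0) * (X w - 0))%:E) => //; rewrite subr0 expr2.
  exact: exprn_measurable.
apply: (@valley_estimate _ _ _ P omega omega_indep omega01 h (2 * - ln e) s2) => //.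
- by move=> i; rewrite h_same.
- by move=> i; rewrite (h_same (fun x => h x ^+ 2))//; exact: bmfX.
- by apply: filterS ae_all => t et x; rewrite hE.
Qed.

End random_environment.

(** * Recurrence of a homogeneous Markov chain *)

Lemma sum_disjoint_le d (T : measurableType d) (R : realType)
    (Q : probability T R) (I : eqType) (r : seq I) (F : I -> set T) (A : set T) :
  uniq r -> measurable A -> (forall i, measurable (F i)) ->
  (forall i, i \in r -> F i `<=` A) ->
  (forall i j, i != j -> F i `&` F j = set0) ->
  \sum_(i <- r) fine (Q (F i)) <= fine (Q A).
Proof.
move=> + + mF + dF; elim: r A => [|i r IH] A; first by rewrite big_nil fine_ge0.
move=> /= /andP[ir ur] mA FA; rewrite big_cons.
have mD : measurable (A `\` F i) by exact: measurableD.
have -> : fine (Q A) = fine (Q (F i)) + fine (Q (A `\` F i)).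
  rewrite -fineD ?fin_num_measure// -measureU//; last by rewrite setDIK.
  by rewrite setDUK//; apply: FA; rewrite mem_head.
rewrite lerD2l; apply: IH => // j jr t Fjt; split; first by apply: FA Fjt; rewrite inE jr orbT.
move=> Fit; have : (F i `&` F j) t by [].
by rewrite dF//; apply: contraNneq ir => ->.
Qed.

Section countable_sums.
Context {R : realType} {S : countType}.
Local Open Scope ereal_scope.

(** A series over an enumeration of [S], to which the theory of series applies. *)
Definition csum (g : S -> \bar R) : \bar R :=
  \sum_(0 <= n <oo) oapp g 0 (@pickle_inv S n).

Lemma eq_csum (f g : S -> \bar R) : f =1 g -> csum f = csum g.
Proof.
by move=> fg; apply: eq_eseriesr => n _; case: pickle_inv => //= y; rewrite fg.
Qed.

Lemma csumZ (x : R) (g : S -> \bar R) : (forall y, 0 <= g y) ->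
  csum (fun y => x%:E * g y) = x%:E * csum g.
Proof.
move=> g0; rewrite /csum -nneseriesZl; last by move=> n _; case: pickle_inv => //=.
by apply: eq_eseriesr => n _; case: pickle_inv => //=; rewrite mule0.
Qed.

Lemma csum_ge0 (g : S -> \bar R) : (forall y, 0 <= g y) -> 0 <= csum g.
Proof. by move=> g0; apply: nneseries_ge0 => n _ _; case: pickle_inv => //=. Qed.

Lemma csum_fibers d (T : measurableType d) (Q : probability T R) (f : T -> S)
    (A : set T) : measurable A -> (forall y, measurable [set t | f t = y]) ->
  Q A = csum (fun y => Q (A `&` [set t | f t = y])).
Proof.
move=> mA mf.
pose F n := oapp (fun y => A `&` [set t | f t = y]) set0 (@pickle_inv S n).
have -> : A = \bigcup_n F n.
  apply/seteqP; split => [t At|t [n _]].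
    by exists (choice.pickle (f t)) => //; rewrite /F choice.pickleK_inv.
  by rewrite /F; case: pickle_inv => //= y [].
rewrite measure_bigcup//=.
- rewrite /csum; under eq_eseriesl do rewrite in_setT.
  apply: eq_eseriesr => n _; rewrite {1}/F.
  case e : (@pickle_inv S n) => [y|] /=; last exact: measure0.
  congr (Q _); apply/seteqP; split => t [h1 h2]; split => //.
    by exists n => //; rewrite /F e.
  by case: h1 => m _; rewrite /F; case: pickle_inv => //= z [].
- by move=> n _; rewrite /F; case: pickle_inv => //= y; apply: measurableI.
- apply/trivIsetP => i j _ _; apply: contra_neqP => /eqP/set0P[t []]; rewrite /F.
  have := @choice.pickle_invK S i; have := @choice.pickle_invK S j.
  by case: pickle_inv => //= y <-; case: pickle_inv => //= z <- [_ <-] [_ <-].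
Qed.

End countable_sums.

Section homogeneous_chain.
Context d (T : measurableType d) (R : realType) (Q : probability T R).
Context (S : countType).
Variables (M : nat -> T -> S) (kernel : S -> S -> R) (o : S).
Hypothesis mM : forall n s, measurable [set t | M n t = s].
Hypothesis markov : markov_property Q M.
Hypothesis kernel_ge0 : forall s y, 0 <= kernel s y.
Hypothesis kernelE : forall n s y, Q [set t | M n t = s] != 0%E ->
  cond_prob Q [set t | M n.+1 t = y] [set t | M n t = s] = kernel s y.
Hypothesis M0 : Q [set t | M 0%N t = o] = 1%E.

Definition adapted n (A : set T) :=
  forall t t', (forall k, (k <= n)%N -> M k t = M k t') -> A t -> A t'.

Let hist n t := [seq M k t | k <- iota 0 n.+1].

Let histE n t t' : hist n t = hist n t' <-> forall k, (k <= n)%N -> M k t = M k t'.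
Proof.
split=> [h k kn|h]; last first.
  by apply/eq_in_map => k; rewrite mem_iota => /andP[_]; rewrite ltnS; exact: h.
have kn' : (k < size (iota 0 n.+1))%N by rewrite size_iota ltnS.
have := congr1 (fun s => nth o s k) h.
by rewrite !(nth_map 0%N)// nth_iota.
Qed.

Let m_hist n c : measurable [set t | hist n t = c].
Proof.
have [[t0 ht0]|no] := pselect (exists t, hist n t = c); last first.
  rewrite (_ : [set _ | _] = set0)//; apply/seteqP; split => // t ht.
  by apply: no; exists t.
rewrite (_ : [set _ | _] = \bigcap_(k in `I_n.+1) [set t | M k t = M k t0]).
  by apply: fin_bigcap_measurable => // k _; exact: mM.
apply/seteqP; split => t /=; rewrite -ht0.
  by move/histE => h k /= kn; apply: h.
by move=> h; apply/histE => k kn; apply: h.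
Qed.

Lemma adapted_measurable n A : adapted n A -> measurable A.
Proof.
move=> adA; rewrite (_ : A = \bigcup_(c in [set: seq S])
   (if pselect (exists2 t, A t & hist n t = c) then [set t | hist n t = c] else set0)).
  apply: countable_bigcupT_measurable; first exact: countableP.
  by move=> c; case: pselect => h //=; exact: m_hist.
apply/seteqP; split => [t At|t [c _]].
  by exists (hist n t) => //; case: pselect => [//|ne]; case: ne; exists t.
case: pselect => [h|//]; case: h => t' At' e /=; rewrite -e => /histE h.
  by apply: adA At' => k /h ->.
Qed.

Lemma adapted_now n A s : adapted n A -> adapted n (A `&` [set t | M n t = s]).
Proof. by move=> adA t t' h [At <-]; split; [exact: adA h At|rewrite /= h]. Qed.

Lemma adaptedS n A : adapted n A -> adapted n.+1 A.
Proof. by move=> adA t t' h; apply: adA => k kn; apply: h; exact: leqW. Qed.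

Local Open Scope ereal_scope.

Let finQ A : measurable A -> Q A = (fine (Q A))%:E.
Proof. by move=> mA; rewrite fineK// fin_num_measure. Qed.

Lemma markov_adapted n A s y : adapted n A ->
  Q (A `&` [set t | M n t = s] `&` [set t | M n.+1 t = y]) =
  (kernel s y)%:E * Q (A `&` [set t | M n t = s]).
Proof.
move=> adA; have adB := @adapted_now n A s adA.
set B := A `&` _ in adB *.
have mB := adapted_measurable adB.
have mBy : measurable (B `&` [set t | M n.+1 t = y]) by exact: measurableI.
rewrite (csum_fibers Q mBy (m_hist n)) (csum_fibers Q mB (m_hist n)).
rewrite -csumZ//; apply: eq_csum => c.
have [[t0 [Bt0 ht0]]|no] := pselect (exists t0, B t0 /\ hist n t0 = c); last first.
  rewrite (_ : _ `&` [set t | hist n t = c] = set0); last first.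
    by apply/seteqP; split => // t [[h1 _] h2]; apply: no; exists t.
  rewrite (_ : B `&` [set t | hist n t = c] = set0) ?measure0 ?mule0//.
  by apply/seteqP; split => // t [h1 h2]; apply: no; exists t.
pose past := [set t | forall k, (k <= n)%N -> M k t = M k t0].
have pastE : past = [set t | hist n t = c].
  by apply/seteqP; split => t; rewrite /past /= -ht0 => /histE.
have mpast : measurable past by rewrite pastE.
have pB : past `<=` B by move=> t pt; apply: adB Bt0 => k /pt ->.
have -> : B `&` [set t | hist n t = c] = past.
  by rewrite -pastE; apply/seteqP; split => [t []//|t pt]; split => //; exact: pB.
have -> : B `&` [set t | M n.+1 t = y] `&` [set t | hist n t = c] =
    [set t | M n.+1 t = y] `&` past.
  rewrite -pastE; apply/seteqP; split => [t [[_ h1] h2]|t [h1 h2]]; first by split.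
  by split => //; split => //; exact: pB.
have mpy : measurable ([set t | M n.+1 t = y] `&` past) by exact: measurableI.
have [p0|p0] := eqVneq (Q past) 0.
  rewrite p0 mule0; apply/eqP; rewrite eq_le measure_ge0 andbT -p0.
  by apply: le_measure; rewrite ?inE// => t [].
have nows : past `<=` [set t | M n t = s] by move=> t /pB[].
have now0 : Q [set t | M n t = s] != 0.
  apply: contraNneq p0 => e0; rewrite eq_le measure_ge0 andbT -e0.
  by apply: le_measure; rewrite ?inE//; exact: mM.
have := markov y p0.
have -> : [set t | M n t = M n t0] = [set t | M n t = s] by case: Bt0 => _ /= ->.
rewrite (kernelE y now0) /cond_prob => <-.
rewrite (finQ mpast) (finQ mpy) -EFinM divfK//.
by rewrite -eqe -finQ.
Qed.

Definition avoids k n : set T :=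
  [set t | forall j, (0 < j <= k)%N -> M (n + j)%N t != o].

Fixpoint avoid_prob (k : nat) (s : S) : \bar R :=
  if k is k'.+1 then
    csum (fun y => if y == o then 0 else (kernel s y)%:E * avoid_prob k' y)
  else 1.

Lemma avoid_prob_ge0 k s : 0 <= avoid_prob k s.
Proof.
elim: k s => [|k IH] s //=; apply: csum_ge0 => y; case: ifP => // _.
by rewrite mule_ge0// lee_fin.
Qed.

Lemma avoids_measurable k n : measurable (avoids k n).
Proof.
rewrite (_ : avoids k n = \bigcap_(j in [set j | (0 < j <= k)%N])
   ~` [set t | M (n + j)%N t = o]).
  apply: fin_bigcap_measurable; last by move=> j _; apply/measurableC/mM.
  by apply: (@sub_finite_set _ _ `I_k.+1) => // j /= /andP[_]; rewrite ltnS.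
by apply/seteqP; split => t h j /h => [/eqP|] //; move=> /eqP.
Qed.

Lemma avoid_adapted k n A s : adapted n A ->
  Q (A `&` [set t | M n t = s] `&` avoids k n) =
  Q (A `&` [set t | M n t = s]) * avoid_prob k s.
Proof.
elim: k n A s => [|k IH] n A s adA.
  rewrite /= mule1; congr (Q _); apply/seteqP; split => [t []//|t h]; split => // j.
  by case: j.
have adB := @adapted_now n A s adA.
rewrite /=; set B := A `&` _ in adB *.
have mB := adapted_measurable adB.
have mBa : measurable (B `&` avoids k.+1 n).
  by apply: measurableI => //; exact: avoids_measurable.
rewrite (csum_fibers Q mBa (mM n.+1)) (finQ mB) -csumZ; last first.
  by move=> y; case: ifP => // _; rewrite mule_ge0 ?lee_fin ?avoid_prob_ge0.
apply: eq_csum => y; case: eqP => [->|yo].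
  rewrite mule0 (_ : _ `&` _ = set0) ?measure0//; apply/seteqP; split => // t [[_ h] ho].
  by have := h 1%N isT; rewrite addn1 ho eqxx.
rewrite muleA [_ * (kernel s y)%:E]muleC -finQ// -markov_adapted//.
rewrite -/B -(IH n.+1 B y (adaptedS adB)); congr (Q _).
apply/seteqP; split => t /=.
  move=> [[h1 h2] h3]; split => // j jk.
  by rewrite addSnnS; apply: h2; rewrite ltnS; case/andP: jk.
move=> [[h1 h2] h3]; split => //; split => // -[//|[_|j jk]].
  by rewrite addn1 h2; apply/eqP.
by rewrite -addSnnS; apply: h3.
Qed.

Definition green (N : nat) : R := (\sum_(n <- iota 0 N.+1) fine (Q [set t | M n t = o]))%R.

(** For [n <= N], the events that the chain is at [o] at time [n] and then avoids
    it for [N] steps are disjoint, hence [green N * avoid_prob N o <= 1]. If the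
    Green function diverges, the chain cannot avoid [o] forever, so that no visit
    is the last one. *)
Lemma green_recurrent : (forall B, exists N, (B <= green N)%R) -> recurrent Q o M.
Proof.
move=> greenoo.
have adT n : adapted n setT by [].
have av_now k n : Q ([set t | M n t = o] `&` avoids k n) =
    Q [set t | M n t = o] * avoid_prob k o.
  by have := @avoid_adapted k n setT o (adT n); rewrite !setTI.
have avE k : avoid_prob k o = Q ([set t | M 0%N t = o] `&` avoids k 0).
  by rewrite av_now M0 mul1e.
have mD k n : measurable ([set t | M n t = o] `&` avoids k n).
  by apply: measurableI; [exact: mM|exact: avoids_measurable].
pose a k := fine (avoid_prob k o).
have aE k : avoid_prob k o = (a k)%:E by rewrite /a avE -finQ.
have a0 k : (0 <= a k)%R by rewrite -lee_fin -aE avoid_prob_ge0.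
have ga N : (green N * a N <= 1)%R.
  rewrite /green mulr_suml.
  rewrite (eq_bigr (fun n => fine (Q ([set t | M n t = o] `&` avoids N n)))); last first.
    by move=> n _; rewrite av_now aE (finQ (mM n o)).
  rewrite [leRHS](_ : _ = fine (Q setT)); last by rewrite probability_setT.
  pose D n := if (n <= N)%N then [set t | M n t = o] `&` avoids N n else set0.
  rewrite big_seq (eq_bigr (fun n => fine (Q (D n)))); last first.
    by move=> n; rewrite mem_iota ltnS /D /= => ->.
  rewrite -big_seq; apply: sum_disjoint_le => //.
  - exact: iota_uniq.
  - by move=> n; rewrite /D; case: ifP.
  - have dis i j : (i < j)%N -> D i `&` D j = set0.
      move=> ij; apply/seteqP; split => // t; rewrite /D.
      case: ifP => [_|_ []//]; case: ifP => [jN|_ []//] [[_ h] [hj _]].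
      have := h (j - i)%N; rewrite subnKC ?(ltnW ij)// subn_gt0 ij.
      by rewrite (leq_trans (leq_subr _ _) jN) hj eqxx => /(_ isT).
    by move=> i j; rewrite neq_ltn => /orP[/dis//|/dis]; rewrite setIC.
have last_visit n :
    Q.-negligible [set t | M n t = o /\ forall j, (0 < j)%N -> M (n + j)%N t <> o].
  have le N : [set t | M n t = o /\ forall j, (0 < j)%N -> M (n + j)%N t <> o] `<=`
      [set t | M n t = o] `&` avoids N n.
    by move=> t [h1 h2]; split => // j /andP[j0 _]; apply/eqP/h2.
  have mI : measurable (\bigcap_N ([set t | M n t = o] `&` avoids N n)).
    by apply: bigcap_measurable => // N _; exact: mD.
  apply: (@negligibleS _ _ _ Q (\bigcap_N ([set t | M n t = o] `&` avoids N n))).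
    by move=> t ht N _; exact: le.
  suff Q0 : Q (\bigcap_N ([set t | M n t = o] `&` avoids N n)) = 0.
    by apply/negligibleP.
  apply/eqP; rewrite eq_le measure_ge0 andbT (finQ mI) lee_fin.
  apply/ler_addgt0Pr => e e0; rewrite add0r.
  have [N hN] := greenoo e^-1%R.
  have : (a N <= e)%R.
    have g0 : (0 < green N)%R by apply: lt_le_trans hN; rewrite invr_gt0.
    have h1 : (a N <= (green N)^-1)%R by rewrite -[leRHS]div1r ler_pdivlMr// mulrC.
    by apply: (le_trans h1); rewrite -[leRHS]invrK lef_pV2// posrE invr_gt0.
  apply: le_trans; rewrite -lee_fin -finQ// -aE.
  apply: (@le_trans _ _ (Q ([set t | M n t = o] `&` avoids N n))).
    by apply: le_measure; rewrite ?inE// => t; exact.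
  rewrite av_now -[leRHS]mul1e lee_wpmul2r ?avoid_prob_ge0//.
  exact: probability_le1.
have neg0 : Q.-negligible [set t | M 0%N t <> o].
  have Z : Q (~` [set t | M 0%N t = o]) = 0 by rewrite probability_setC// M0 subee.
  by apply/negligibleP => //; exact/measurableC/mM.
apply: negligibleS (negligibleU neg0 (negligible_bigcup last_visit)) => t /= nrec.
have [h0|] := pselect (M 0%N t = o); last by left.
right; have [N hN] : exists N, ~ exists2 n, (N <= n)%N & M n t = o by apply/existsNP.
have N0 : forall n, (N <= n)%N -> M n t <> o by move=> n Nn e; apply: hN; exists n.
(* the last visit before time [N] *)
have bnd n : M n t == o -> (n <= N)%N.
  by move=> /eqP e; rewrite leqNgt; apply/negP => /ltnW /N0.
have ex : exists n, M n t == o by exists 0%N; rewrite h0.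
have [m /eqP mo mmax] := ex_maxnP ex bnd.
exists m => //=; split => // j j0 e; have := mmax (m + j)%N.
rewrite e eqxx => /(_ isT); rewrite -[leqRHS]addn0 leq_add2l leqNgt j0.
by [].
Qed.

End homogeneous_chain.

(** * Recurrence of the planar chain *)

Lemma sgz_flip (x z : int) : (-1 : int) ^ x * z = flip (odd (absz x)) z.
Proof.
have e n : (-1 : int) ^+ n * z = flip (odd n) z.
  by rewrite -signr_odd; case: odd; rewrite /flip ?expr1 ?expr0 ?mulN1r ?mul1r.
case: x => n; first by rewrite -exprnP e.
by rewrite NegzE -exprnN -(@signr_odd _ n.+1) invr_sign signr_odd e.
Qed.

Lemma flipK b : involutive (flip b).
Proof. by case: b => z; rewrite /flip ?opprK. Qed.

Lemma tnm_first_moment (R : realType) (nu : probability int R) :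
  nu.-integrable [set: int] (fun z : int => (z%:~R : R)%:E) ->
  exists2 m1 : R, 0 <= m1 & forall K, 0 < K -> mean nu (tnm K) <= m1 / K.
Proof.
move=> inu.
have iabs : nu.-integrable [set: int] (EFin \o (fun z : int => `|z%:~R| : R)).
  exact: integrable_norm inu.
exists (\int[nu]_z `|z%:~R|); first by apply: Rintegral_ge0.
move=> K K0; rewrite -RintegralZr//; apply: le_Rintegral => //.
- by apply: bmf_integrable; apply: (@int_bmf _ _ 1) => z; exact: tnm_bd.
- have := integrableZl measurableT K^-1 iabs.
  by apply: eq_integrable => // z _ /=; rewrite -EFinM mulrC.
- by move=> z _; rewrite /tnm ge_min lexx orbT.
Qed.

Section planar_chain.
Context {R : realType}.
Variables (delta : R) (nu : probability int R) (w : int -> R).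
Hypothesis delta01 : 0 < delta < 1.
Hypothesis w01 : forall x, 0 < w x < 1.
Variable m1 : R.
Hypothesis nu_tnm : forall K, 0 < K -> mean nu (tnm K) <= m1 / K.
Context d (T : measurableType d) (Q : probability T R).
Variable M : nat -> {RV Q >-> (int * int)%type}.
Hypothesis chain : quenched_chain delta nu w M.

Let m1_ge0 : 0 <= m1.
Proof.
have := nu_tnm ltr01; rewrite divr1; apply: le_trans.
by apply: mean_ge0 => z; exact: tnm_ge0.
Qed.

Let m1_small (e : R) : 0 < e -> exists2 K : nat, (0 < K)%N & mean nu (tnm K%:R) <= e.
Proof.
move=> e0; exists (Num.truncn (m1 / e)).+1 => //; apply: le_trans (nu_tnm _) _ => //.
rewrite ler_pdivrMr// mulrC -ler_pdivrMr//; apply/ltW.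
by have /andP[] := Num.Theory.truncn_itv (divr_ge0 m1_ge0 (ltW e0)).
Qed.

Definition kernel2 (s y : int * int) : R :=
  if y.1 == s.1 then (1 - delta) * pm nu (flip (odd (absz s.1)) (y.2 - s.2))
  else if y.2 == s.2 then
    if y.1 == s.1 + 1 then delta * w s.1
    else if y.1 == s.1 - 1 then delta * (1 - w s.1) else 0
  else 0.

Lemma kernel2_ge0 s y : 0 <= kernel2 s y.
Proof.
have /andP[d0 d1] := delta01; have /andP[w0 w1] := w01 s.1.
rewrite /kernel2; repeat case: ifP => _ //; rewrite mulr_ge0 ?pm_ge0 ?subr_ge0// ltW//.
Qed.

Let mM n s : measurable [set t | M n t = s].
Proof.
have -> : [set t | M n t = s] = M n @^-1` [set s] by [].
by apply: measurable_funPTI; exact: measurable_int_prod.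
Qed.

Let kernel2_vert x y z : kernel2 (x, y) (x, y + flip (odd (absz x)) z) = (1 - delta) * pm nu z.
Proof. by rewrite /kernel2 /= eqxx addrAC subrr add0r flipK. Qed.

(** The listed transitions have total mass 1, hence there is no other one. *)
Lemma kernel2E n s y : Q [set t | M n t = s] != 0%E ->
  cond_prob Q [set t | M n.+1 t = y] [set t | M n t = s] = kernel2 s y.
Proof.
have [_ _ tr] := chain; have /andP[d0 d1] := delta01.
case: s => [x b] now0; have [tr1 tr2 tr3] := tr n x b now0.
set now := [set t | M n t = (x, b)] in now0 tr1 tr2 tr3 *.
have trv z : cond_prob Q [set t | M n.+1 t = (x, b + flip (odd (absz x)) z)] now =
    (1 - delta) * pm nu z.
  by rewrite tr3 sgz_flip flipK.
have x1 : x + 1 != x by rewrite -subr_eq0 addrAC subrr.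
have x2 : x - 1 != x by rewrite -subr_eq0 addrAC subrr.
have x3 : x - 1 != x + 1 by apply/eqP; lia.
case: y => [u v]; rewrite /kernel2 /=.
case: (u =P x) => [->|ux].
  by rewrite -trv flipK addrC subrK.
have [[-> ->]|good1] := pselect ((u, v) = (x + 1, b)); first by rewrite !eqxx.
have [[-> ->]|good2] := pselect ((u, v) = (x - 1, b)).
  by rewrite !eqxx (negbTE x3).
transitivity (0 : R); last first.
  case: (v =P b) => // vb; case: (u =P x + 1) => [ue|_]; first by rewrite ue vb in good1.
  by case: (u =P x - 1) => [ue|//]; rewrite ue vb in good2.
have mnow : measurable now by exact: mM.
have q0 : 0 < fine (Q now).
  by rewrite lt_neqAle eq_sym fine_ge0// andbT -eqe fineK// fin_num_measure.
apply/eqP; rewrite eq_le; apply/andP; split; last first.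
  by rewrite /cond_prob divr_ge0// fine_ge0.
apply/ler_addgt0Pr => e e0; rewrite add0r.
have [K K0 hK] := m1_small e0.
pose F (y : int * int) := [set t | M n.+1 t = y] `&` now.
pose r := (u, v) :: (x + 1, b) :: (x - 1, b) ::
  [seq (x, b + flip (odd (absz x)) z) | z <- window K].
have ur : uniq r.
  have nv y : y.1 != x -> y \notin [seq (x, b + flip (odd (absz x)) z) | z <- window K].
    by move=> yx; apply: contra yx => /mapP[z _ ->].
  have uV : uniq [seq (x, b + flip (odd (absz x)) z) | z <- window K].
    rewrite map_inj_uniq ?window_uniq// => z z' [].
    by move=> /addrI/(inv_inj (flipK _)).
  rewrite /r; move: uV nv; move: [seq _ | _ <- _] => V uV nv.
  rewrite /= !inE !negb_or uV !nv//; last exact/eqP.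
  have -> /= : (u, v) != (x + 1, b) by apply/eqP.
  have -> /= : (u, v) != (x - 1, b) by apply/eqP.
  by rewrite !andbT; apply/eqP => -[]; lia.
have := @sum_disjoint_le _ _ _ Q _ r F now ur mnow.
have mF y : measurable (F y) by apply: measurableI => //; exact: mM.
move=> /(_ mF) /(_ (fun y _ => @subIsetr _ _ _)) H.
have {}H : \sum_(y <- r) fine (Q (F y)) <= fine (Q now).
  apply: H => y y' yy'; apply/seteqP; split => // t [[/= h1 _] [/= h2 _]].
  by move: yy'; rewrite -h1 -h2 eqxx.
have H' : \sum_(y <- r) cond_prob Q [set t | M n.+1 t = y] now <= 1.
  by rewrite /cond_prob -mulr_suml ler_pdivrMr// mul1r.
rewrite /r 3!big_cons big_map tr1 tr2 in H'.
rewrite (eq_bigr (fun z => (1 - delta) * pm nu z)) in H'; last by move=> z _; exact: trv.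
rewrite -mulr_sumr in H'.
have := window_mass nu K0; set S := \sum_(z <- window K) pm nu z in H' *.
set p := cond_prob _ _ _ in H' *.
move=> hS; have : (1 - delta) * (1 - e) <= (1 - delta) * S.
  by rewrite ler_wpM2l ?subr_ge0 ?(ltW d1)//; lra.
have : 0 <= delta * e by rewrite mulr_ge0// ltW.
by lra.
Qed.

Let p n x y := fine (Q [set t | M n t = (x, y)]).

Let p01 n x y : 0 <= p n x y <= 1.
Proof.
rewrite /p fine_ge0//= -lee_fin fineK ?fin_num_measure//.
exact: probability_le1.
Qed.

Let joint n s y : fine (Q ([set t | M n t = s] `&` [set t | M n.+1 t = y])) =
  fine (Q [set t | M n t = s]) * kernel2 s y.
Proof.
have [e0|n0] := eqVneq (Q [set t | M n t = s]) 0%E.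
  rewrite e0 mul0r; suff -> : Q ([set t | M n t = s] `&` [set t | M n.+1 t = y]) = 0%E by [].
  apply/eqP; rewrite eq_le measure_ge0 andbT -e0.
  have m2 : measurable ([set t | M n t = s] `&` [set t | M n.+1 t = y]).
    by apply: measurableI; exact: mM.
  by apply: le_measure; rewrite ?inE// => t [].
have q0 : fine (Q [set t | M n t = s]) != 0.
  by rewrite -eqe fineK// fin_num_measure.
by rewrite -(kernel2E y n0) /cond_prob mulrC divfK// setIC.
Qed.

Lemma planar_words n x y :
  wsum delta n (fun s => rwre w (nh s) x * pm (wlaw nu s) y) <= p n x y.
Proof.
have /andP[d0 d1] := delta01.
apply: wsum_le_chain => //.
  by have [_ M0 _] := chain; rewrite /p M0.
move=> {}n {}x {}y; set o := odd (absz x).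
apply/ler_addgt0Pr => e e0; have [K K0 hK] := m1_small e0.
have fb z : 0 <= p n x (y - flip o z) <= 1 by exact: p01.
have hm := mean_le_window nu K0 fb.
pose F (s : int * int) := [set t | M n t = s] `&` [set t | M n.+1 t = (x, y)].
pose r := (x - 1, y) :: (x + 1, y) :: [seq (x, y - flip o z) | z <- window K].
have ur : uniq r.
  have nv s : s.1 != x -> s \notin [seq (x, y - flip o z) | z <- window K].
    by move=> yx; apply: contra yx => /mapP[z _ ->].
  have uV : uniq [seq (x, y - flip o z) | z <- window K].
    rewrite map_inj_uniq ?window_uniq// => z z' [].
    by move=> /addrI/oppr_inj/(inv_inj (flipK _)).
  rewrite /r; move: uV nv; move: [seq _ | _ <- _] => V uV nv.
  rewrite /= !inE !negb_or uV !nv /=; last 2 first.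
  - by rewrite -subr_eq0 addrAC subrr.
  - by rewrite -subr_eq0 addrAC subrr.
  by rewrite !andbT; apply/eqP => -[]; lia.
have H : \sum_(s <- r) fine (Q (F s)) <= p n.+1 x y.
  apply: sum_disjoint_le => //.
  - by move=> s; apply: measurableI; exact: mM.
  - by move=> s _; exact: subIsetr.
  - move=> s s' ss'; apply/seteqP; split => // t [[/= h1 _] [/= h2 _]].
    by move: ss'; rewrite -h1 -h2 eqxx.
rewrite (eq_bigr (fun s => fine (Q [set t | M n t = s]) * kernel2 s (x, y))) in H; last first.
  by move=> s _; exact: joint.
rewrite /r 2!big_cons big_map in H.
rewrite (eq_bigr (fun z => (1 - delta) * (p n x (y - flip o z) * pm nu z))) in H; last first.
  by move=> z _; rewrite -[y in kernel2 _ (x, y)](subrK (flip o z)) kernel2_vert /p; ring.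
rewrite -mulr_sumr in H.
have e1 : kernel2 (x - 1, y) (x, y) = delta * w (x - 1).
  rewrite /kernel2 /= eqxx subrK eqxx ifF//.
  by apply/negbTE; rewrite eq_sym -subr_eq0 addrAC subrr.
have e2 : kernel2 (x + 1, y) (x, y) = delta * (1 - w (x + 1)).
  rewrite /kernel2 /= eqxx addrK eqxx ifF; last first.
    by apply/negbTE; rewrite eq_sym -subr_eq0 addrAC subrr.
  by rewrite ifF//; apply/eqP; lia.
rewrite e1 e2 -!/(p _ _ _) in H.
set S := \sum_(z <- window K) _ in hm H; set mn := mean _ _ in hm *.
have : (1 - delta) * mn <= (1 - delta) * S + e.
  have h1 : (1 - delta) * mn <= (1 - delta) * (S + e).
    by rewrite ler_wpM2l ?subr_ge0 ?(ltW d1)//; lra.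
  have h2 : (1 - delta) * e <= e by rewrite ler_piMl ?(ltW e0)//; lra.
  by lra.
by lra.
Qed.

(** Only the words with an even number of horizontal letters are kept: for them the
    two coordinates can return together. *)
Lemma planar_return_ge n K c : 0 <= c ->
  (forall m, (m <= n)%N -> c <= rwre w (m + m) 0) ->
  c * ((\sum_(z <- window K) odd_mass nu delta n z) ^+ 2 / (K + K).+1%:R) <= p (n + n) 0 0.
Proof.
move=> c0 hc; apply: le_trans (planar_words _ _ _).
apply: (@le_trans _ _ (c * wsum delta (n + n)
    (fun s => (~~ odd (nh s))%:R * pm (wlaw nu s) 0))).
  by rewrite ler_wpM2l//; exact: even_return_ge.
rewrite -wsumZ; apply: le_wsum => // s sn.
case os: (odd (nh s)); rewrite /= ?mul0r ?mulr0 ?mul1r.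
  by rewrite mulr_ge0 ?pm_ge0 ?rwre_ge0.
rewrite ler_wpM2r ?pm_ge0//.
have e : nh s = ((nh s)./2 + (nh s)./2)%N.
  by rewrite addnn -[LHS](odd_double_half (nh s)) os.
rewrite e; apply: hc; have : (nh s <= n + n)%N by rewrite -sn; exact: count_size.
by rewrite [X in (X <= _)%N]e; lia.
Qed.

Lemma planar_green_recurrent :
  (forall B, exists N, B <= \sum_(n <- iota 1 N) p (n + n) 0 0) ->
  recurrent Q (0, 0) (fun n => M n).
Proof.
move=> H; have [mk M0 _] := chain.
apply: (@green_recurrent _ _ _ Q _ (fun n => M n) kernel2 (0, 0)) => //.
- exact: kernel2_ge0.
- exact: kernel2E.
move=> B; have [N hN] := H B; exists (N + N)%N; apply: le_trans hN _.
elim: N => [|N IH]; first by rewrite big_nil /green sumr_ge0// => n _; exact: fine_ge0.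
rewrite -{1}[N.+1]addn1 iotaD big_cat big_seq1 add1n.
have -> : green Q (fun n => M n) (0, 0) (N.+1 + N.+1) =
    green Q (fun n => M n) (0, 0) (N + N) + (p (N + N).+1 0 0 + p (N + N).+2 0 0).
  rewrite /green addnS addSn -[(N + N).+3]addn2 iotaD big_cat; congr (_ + _).
  by rewrite /= !big_cons big_nil add0n addr0.
apply: lerD; first exact: IH.
by rewrite addnS addSn lerDr fine_ge0.
Qed.

End planar_chain.

Section vertical_returns.
Context {R : realType}.
Variables (delta : R) (nu : probability int R) (m1 c : R).
Hypothesis delta01 : 0 < delta < 1.
Hypothesis m1_ge0 : 0 <= m1.
Hypothesis nu_tnm : forall K, 0 < K -> mean nu (tnm K) <= m1 / K.
Hypothesis c_gt1 : 1 < c.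
Hypothesis c_sqr : 2 <= c ^+ 2.
Hypothesis small : forall e, 0 < e -> exists2 D, 0 < D & exists k0,
  forall k (K : R), (k0 <= k)%N -> D * c ^+ k <= K ->
  mean (convolution_pow (symmetrized nu) (2 ^ k)) (tnm K) <= e.

(** Both the symmetrized part and the unpaired part of the vertical displacement
    at time [n <= 2 ^ k] are of order at most [c ^ k], the latter because
    [c ^ 2 >= 2]. *)
Lemma vertical_return_ge : exists2 c2, 0 < c2 & exists k1, forall k n,
  (k1 <= k)%N -> (0 < n <= 2 ^ k)%N -> exists K,
  c2 / c ^+ k <= (\sum_(z <- window K) odd_mass nu delta n z) ^+ 2 / (K + K).+1%:R.
Proof.
have /andP[d0 d1] := delta01.
pose c0 := Num.min delta (1 - delta).
have c00 : 0 < c0 by rewrite /c0 lt_min d0 subr_gt0.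
have e0 : 0 < c0 / 8 by rewrite divr_gt0.
have [D D0 [k0 hD]] := small e0.
pose C := excess_cst delta.
have C0 : 0 < C.
  rewrite /C /excess_cst ltr_wpDr// divr_ge0// subr_ge0.
  by rewrite ler_norml; apply/andP; split; lra.
pose D2 := 2 * (C + 1) * m1 / c0.
have D20 : 0 <= D2 by rewrite divr_ge0 ?(ltW c00)// mulr_ge0// mulr_ge0//; lra.
pose D3 := 2 * (D + D2) + 3.
have D30 : 0 < D3 by rewrite /D3; lra.
exists ((c0 / 2) ^+ 2 / D3); first by rewrite divr_gt0// exprn_gt0// divr_gt0.
exists k0 => k n kk nk.
pose u := c ^+ k.
have u1 : 1 <= u by rewrite exprn_ege1// ltW.
have u0 : 0 < u by lra.
have [K [K0 K2 K1]] : exists K, [/\ (0 < K)%N, (D + D2) * u <= K%:R &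
    K%:R <= (D + D2) * u + 1].
  exists (Num.truncn ((D + D2) * u)).+1; have DD : 0 <= (D + D2) * u.
    by rewrite mulr_ge0 ?(ltW u0)//; lra.
  have /andP[h1 h2] := Num.Theory.truncn_itv DD.
  by split => //; [exact: ltW|rewrite -natr1 lerD2r].
have KD : D * u <= K%:R.
  by apply: le_trans K2; rewrite ler_wpM2r ?(ltW u0)//; lra.
have KD2 : D2 * u <= K%:R.
  by apply: le_trans K2; rewrite ler_wpM2r ?(ltW u0)//; lra.
have K0' : 0 < K%:R :> R by rewrite ltr0n.
exists K.
have := odd_mass_ge delta01 nk K0 u0 (nu_tnm K0').
have h1 := hD k K%:R kk KD.
have nu2 : n%:R <= u ^+ 2 :> R.
  rewrite /u -exprM mulnC exprM; apply: (@le_trans _ _ (2 ^+ k)).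
    by rewrite -natrX ler_nat; case/andP: nk.
  by rewrite lerXn2r// nnegrE ?exprn_ge0// ltW// (lt_trans ltr01).
have h2 : (C * n%:R / u + u) / 2 * (m1 / K%:R) <= c0 / 4.
  have h3 : C * n%:R / u + u <= (C + 1) * u.
    have : C * n%:R / u <= C * u.
      by rewrite ler_pdivrMr// -mulrA ler_wpM2l ?(ltW C0)// -expr2.
    by lra.
  have h4 : (C + 1) * u * m1 * 2 <= c0 * K%:R.
    apply: (@le_trans _ _ (c0 * (D2 * u))); last by rewrite ler_wpM2l// ltW.
    by rewrite /D2 le_eqVlt; apply/orP; left; apply/eqP; field; rewrite gt_eqF.
  rewrite mulrA ler_pdivrMr//.
  have h5 : (C * n%:R / u + u) * m1 <= (C + 1) * u * m1 by rewrite ler_wpM2r.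
  by lra.
rewrite -/C -/c0; set e := mean _ _ in h1 *; set S := \sum_(z <- _) _ => hS.
have S0 : c0 / 2 <= S by lra.
have KD3 : (K + K).+1%:R <= D3 * u.
  by rewrite -natr1 natrD /D3; lra.
apply: (@le_trans _ _ ((c0 / 2) ^+ 2 / (K + K).+1%:R)); last first.
  rewrite ler_wpM2r ?invr_ge0 ?ler0n// lerXn2r ?nnegrE//; lra.
rewrite -mulrA ler_wpM2l ?sqr_ge0// -invfM lef_pV2 ?posrE ?ltr0n//.
by rewrite mulr_gt0.
Qed.

End vertical_returns.

Lemma expr_unbounded (R : realType) (q B : R) : 1 < q ->
  exists k0, forall k, (k0 <= k)%N -> B <= q ^+ k.
Proof.
move=> q1; have [n nB] : exists n : nat, B <= 1 + n%:R * (q - 1).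
  exists (Num.truncn (`|B| / (q - 1))).+1; apply: le_trans (ler_norm B) _.
  apply: (@le_trans _ _ (1 + `|B|)); first by rewrite lerDr.
  rewrite lerD2l -ler_pdivrMr ?subr_gt0//; apply/ltW.
  have h : 0 <= `|B| / (q - 1) by rewrite divr_ge0// subr_ge0 ltW.
  by have /andP[] := Num.Theory.truncn_itv h.
exists n => k nk; apply: (le_trans nB).
apply: (@le_trans _ _ (1 + k%:R * (q - 1))).
  by rewrite lerD2l ler_wpM2r ?ler_nat// subr_ge0 ltW.
elim: k {nk} => [|k IH]; first by rewrite mul0r addr0 expr0.
rewrite exprS -natr1; have : 0 <= k%:R * (q - 1) by rewrite mulr_ge0// subr_ge0 ltW.
have : (q - 1) * (1 + k%:R * (q - 1)) <= (q - 1) * q ^+ k.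
  by rewrite ler_wpM2l// subr_ge0 ltW.
set x := q ^+ k in IH *; set y := k%:R * _ in IH *.
by have : 0 <= (q - 1) ^+ 2 * k%:R; [rewrite mulr_ge0 ?sqr_ge0|rewrite /y in IH *; nra].
Qed.

Theorem proposition4p3 (R : realType) (d : measure_display)
    (Omega : measurableType d) (P : probability Omega R)
    (omega : int -> {RV P >-> R})
    (delta : R) (nu : probability int R)
    (A : nat -> R) (beta : R) (mu : probability R R)
    (delta01 : 0 < delta < 1)
    (omega01 : forall x w, 0 < omega x w < 1)
    (omega_indep : mutually_independent omega)
    (omega_id : identically_distributed omega)
    (log_rho_mean : 'E_P[fun w => ln (rho (omega 0%R w))]%E = 0%E)
    (log_rho_var : (0 < 'V_P[fun w => ln (rho (omega 0%R w))])%E)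
    (elliptic : exists2 eps : R, 0 < eps < 2^-1 &
      P [set w | eps <= omega 0 w <= 1 - eps] = 1%E)
    (nu_moment : nu.-integrable [set: int] (fun z : int => (z%:~R : R)%:E))
    (A_gt0 : forall n, 0 < A n)
    (A_nondecreasing : nondecreasing_seq A)
    (beta_gt1 : 1 < beta)
    (mu_stable : stable_law beta mu)
    (cvg_mu : cvg_weakly
      (fun n => rescale (A n) (convolution_pow (symmetrized nu) n)) mu) :
  {ae P, forall w : Omega,
    forall (d' : measure_display) (T : measurableType d')
      (Q : probability T R) (M : nat -> {RV Q >-> (int * int)%type}),
      quenched_chain delta nu (fun x => omega x w) M ->
      recurrent Q (0, 0) (fun n => M n)}.
Proof.
have [m1 m10 nu_tnm] := tnm_first_moment nu_moment.
have [c [c1 c2 csq] small] := sums_small (symmetrized_symmetric nu) A_gt0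
  beta_gt1 mu_stable cvg_mu.
have [v v0 [k1 hv]] := vertical_return_ge delta01 m10 nu_tnm c1 csq small.
have c0 : 0 < c by lra.
pose g := 2 / c.
have g1 : 1 < g by rewrite /g ltr_pdivlMr// mul1r.
have lng : 0 < ln g by rewrite ln_gt0.
pose eps := Num.min 2 (ln g / 2).
have eps02 : 0 < eps <= 2.
  by rewrite /eps lt_min ltr0n divr_gt0//= ge_min lexx.
have eg : expR eps < g.
  have -> : g = expR (ln g) by rewrite lnK// posrE; lra.
  rewrite ltr_expR; have : eps <= ln g / 2 by rewrite /eps ge_min lexx orbT.
  by lra.
(* [2 ^ k] times contribute [exp (- eps (k + 1)) v / c ^ k] each *)
pose q := g / expR eps.
have q1 : 1 < q by rewrite /q ltr_pdivlMr ?expR_gt0// mul1r.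
have := ae_return omega01 omega_indep omega_id log_rho_mean log_rho_var elliptic eps02.
apply: filterS => t ht d' T Q M chain.
have w01 x : 0 < omega x t < 1 by exact: omega01.
apply: (planar_green_recurrent delta01 w01 nu_tnm chain) => B.
have [k0 hk0] := expr_unbounded (B * expR eps / v) q1.
have [L L0 hL] := ht (k0 + k1)%:R.
pose k := Num.truncn L.
have L0' : 0 <= L by exact: le_trans L0.
have /andP[kL Lk] := Num.Theory.truncn_itv L0'.
have kk : (k0 + k1 <= k)%N by rewrite Num.Theory.truncn_ge_nat.
exists (2 ^ k)%N.
pose b := expR (- (eps * L)) * (v / c ^+ k).
apply: (@le_trans _ _ (\sum_(n <- iota 1 (2 ^ k)) b)); last first.
  rewrite big_seq [leRHS]big_seq; apply: ler_sum => n.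
  rewrite mem_iota add1n ltnS => nk.
  have [K hK] := hv k n (leq_trans (leq_addl _ _) kk) nk.
  apply: le_trans (planar_return_ge delta01 w01 nu_tnm chain K
    (c := expR (- (eps * L))) _ _) => [||m mn].
  - by rewrite ler_wpM2l ?expR_ge0.
  - exact: expR_ge0.
  - apply: hL; apply: (@le_trans _ _ (2 ^ k)%:R).
      by rewrite ler_nat (leq_trans mn)//; case/andP: nk.
    apply: (@le_trans _ _ (expR k%:R)); last by rewrite ler_expR.
    rewrite -[k%:R]mulr1 expRM_natl natrX lerXn2r ?nnegrE ?expR_ge0//.
    by apply: le_trans (expR_ge1Dx _); lra.
rewrite big_const_seq count_predT size_iota iter_addr_0 -mulr_natl natrX.
have := hk0 k (leq_trans (leq_addr _ _) kk).
rewrite ler_pdivrMr// => h.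
have x0 : 0 < expR eps by exact: expR_gt0.
have eL : (expR eps ^+ k * expR eps)^-1 <= expR (- (eps * L)).
  rewrite -expRM_natl -expRD -expRN ler_expR lerN2.
  rewrite (_ : k%:R * eps + eps = eps * k.+1%:R); last by rewrite -natr1; ring.
  by have /andP[e0 _] := eps02; rewrite ler_wpM2l ?ltW.
have ck : 0 < c ^+ k by rewrite exprn_gt0.
apply: (@le_trans _ _ (2 ^+ k * ((expR eps ^+ k * expR eps)^-1 * (v / c ^+ k)))).
  rewrite (_ : 2 ^+ k * _ = q ^+ k * v / expR eps); first by rewrite ler_pdivlMr.
  rewrite /q /g !expr_div_n; field.
  by rewrite !gt_eqF// exprn_gt0.
by rewrite /b ler_wpM2l ?exprn_ge0// ler_wpM2r// ltW// divr_gt0.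
Qed.
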